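(* Let $(A,N,\theta)_{\mathcal H}$ be an $\mathcal H$-triple. There exists an $\mathcal H$-triple $(K,Z,\lambda)_{\mathcal H}$ satisfying the following conditions. (1) There is a group isomorphism $\epsilon:A/N\to K/Z$, by which $\bar A=A/N$ is identified with $K/Z$. The subgroup $Z$ is a central $p'$-subgroup of $K_\lambda$, and $\lambda$ is a faithful linear character of $Z$. For any subgroup $J$ with $N\le J\le A$, define $J^\bullet\le K$ by $J^\bullet/Z=\epsilon(J/N)$. (2) $(\mathcal H\times\bar A)_\theta=(\mathcal H\times\bar A)_\lambda$. (3) For each subgroup $J$ with $N\le J\le A_\theta$ there is a bijection $\nu_J:\mathrm{IBr}(J\mid\theta)\to\mathrm{IBr}(J^\bullet\mid\lambda)$ such that: (a) $\nu_J(\chi)^a=\nu_{J^a}(\chi^a)$ for all $\chi\in\mathrm{IBr}(J\mid\theta)$ and $a\in(\mathcal H\times\bar A)_\theta$; (b) for any vertex $V$ of $\chi\in\mathrm{IBr}(J\mid\theta)$ there is a vertex $V_1$ of $\nu_J(\chi)$ such that $VN/N=V_1Z/Z$ (under the identification $A/N=K/Z$). Write $\chi^\bullet=\nu_J(\chi)$. (4) Let $N\subseteq Q\subseteq J\subseteq G$ be subgroups of $A$ with $Q/N$ a $p$-group and $J\subseteq A_\theta$. Put $H=N_G(Q)$ and $M=N_J(Q)$, and let $\chi\in\mathrm{IBr}(J\mid\theta)$ and $\varphi\in\mathrm{IBr}(M\mid\theta)$. Let $\ast\in\{\emptyset,c,b\}$. If $(G^\bullet,J^\bullet,\chi^\bullet)_{\mathcal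 H}$ and $(H^\bullet,M^\bullet,\varphi^\bullet)_{\mathcal H}$ are $\mathcal H$-triples and $$(G^\bullet,J^\bullet,\chi^\bullet)_{\mathcal H}\geqslant_\ast(H^\bullet,M^\bullet,\varphi^\bullet)_{\mathcal H},$$ then $$(G,J,\chi)_{\mathcal H}\geqslant_\ast(H,M,\varphi)_{\mathcal H}.$$
   Context: **Setup.** Throughout, $p$ is a fixed prime and all groups are finite. $(\mathcal K,\mathcal O,F)$ is a $p$-modular system ($\mathcal O$ a complete discrete valuation ring, $\mathcal K$ its fraction field of characteristic $0$, $F$ its residue field of characteristic $p$), with $F$ finite, sufficiently large for all groups considered (all group algebras split over $\mathcal K$ and $F$). $\mathcal H\le\mathrm{Aut}(\mathcal K)$ is a fixed finite abelian group of automorphisms preserving $\mathcal O$, hence acting on $F$, and mapping onto $\mathrm{Aut}(F)$; the action is written $x\mapsto x^\sigma$. ''Character'' means Brauer character; $\mathrm{IBr}(X)$ is the set of irreducible Brauer characters of $X$, and $\mathrm{IBr}(G\mid\lambda)$ the subset lying over $\lambda$. A vertex of $\chi\in\mathrm{IBr}(G)$ is a vertex of the simple $FG$-module affording $\chi$. If $X,B\le A$, $\chi$ is a character of $X$ and $a=(\sigma,g)\in\mathcal H\times A$, put $X^a=g^{-1}Xg$ and $\chi^a(x)=\chi(gxg^{-1})^\sigma$, a character of $X^a$. Subscripts denote stabilizers: $(\mathcal H\times B)_\chi=\{a\in\mathcal H\times B: X^a=X,\ \chi^a=\chi\}$, $B_\chi=\{g\in B: X^g=X,\ \chi^g=\chi\}$,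 and $B_{\chi^{\mathcal H}}=\{g\in B: X^g=X,\ \chi^g=\chi^\sigma\text{ for some }\sigma\in\mathcal H\}$. **Projective representations.** A projective representation $\mathcal P:G\to\mathrm{GL}_m(F)$ satisfies $\mathcal P(1)=I_m$ and $\mathcal P(g)\mathcal P(h)=\alpha(g,h)\mathcal P(gh)$ with factor set $\alpha:G\times G\to F^\times$. Two such maps are similar ($\sim$) if they are conjugate by a fixed invertible matrix. If $N\unlhd G$ and $\theta\in\mathrm{IBr}(N)$ is $G$-invariant, $\mathcal P:G\to\mathrm{GL}_{\theta(1)}(F)$ is associated with $\theta$ if $\mathcal P|_N$ is a representation affording $\theta$ and $\mathcal P(g)\mathcal P(n)=\mathcal P(gn)$, $\mathcal P(n)\mathcal P(g)=\mathcal P(ng)$ for all $n\in N,g\in G$. For $a=(\sigma,g)$, $\mathcal P^a(x)=\mathcal P(gxg^{-1})^\sigma$. For a subset $X$, $\mathcal P(X^+)=\sum_{x\in X}\mathcal P(x)$ ($0$ if $X=\emptyset$). $\mathrm{Cl}_J(x)$ is the $J$-conjugacy class of $x$. **$\mathcal H$-triples.** An $\mathcal H$-triple $(G,N,\theta)_{\mathcal H}$ consists of $N\le G$ and $\theta\in\mathrm{IBr}(N)$ with $G=G_{\theta^{\mathcal H}}$ (so $N\unlhd G$). If $\mathcal P$ is a projective representation of $G_\theta$ associated with $\theta$ and $a\in(\mathcal H\times G)_\theta$, there is a unique function $\mu_a:G_\theta\to F^\times$, constant on $N$-cosets, with $\mathcal P^a\sim\mu_a\mathcal P$. Let $(G,N,\theta)_{\mathcal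 H}$ and $(H,M,\varphi)_{\mathcal H}$ be $\mathcal H$-triples with $G=NH$, $M=N\cap H$ and $(\mathcal H\times H)_\theta=(\mathcal H\times H)_\varphi$ (so $G_\theta/N\cong H_\varphi/M$). Let $\mathcal P,\mathcal P'$ be projective representations of $G_\theta,H_\varphi$ associated with $\theta,\varphi$. - $(\mathcal P,\mathcal P')$ gives $(G,N,\theta)_{\mathcal H}\geqslant(H,M,\varphi)_{\mathcal H}$ (the case $\ast=\emptyset$) if the factor sets of $\mathcal P$ and $\mathcal P'$ agree under $G_\theta/N\cong H_\varphi/M$ and, for every $a\in(\mathcal H\times H)_\theta$, the functions $\mu_a,\mu_a'$ defined by $\mathcal P^a\sim\mu_a\mathcal P$, $\mathcal P'^a\sim\mu'_a\mathcal P'$ agree on $H_\varphi$. - It gives $\geqslant_c$ if in addition $C_G(N)\subseteq H$ and for every $c\in C_G(N)$ the scalar matrices $\mathcal P(c)$ and $\mathcal P'(c)$ have the same scalar. - It gives $\geqslant_b$ if it gives $\geqslant_c$ and, for every $x\in G_\theta$, the scalar matrices $\mathcal P(\mathrm{Cl}_{\langle N,x\rangle}(x)^+)$ and $\mathcal P'((\mathrm{Cl}_{\langle N,x\rangle}(x)\cap H)^+)$ have the same scalar. The relation $\geqslant_\ast$ holds if some pair $(\mathcal P,\mathcal P')$ gives it; stating it includes the group-theoretic conditions above. **Bar notation.** For $\bar A=A/N$ (resp. $K/Z$), $(\mathcal H\times\bar A)_\theta$ (resp. $(\mathcal H\times\bar A)_\lambda$) denotes the image of $(\mathcal H\times A)_\theta$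 in $\mathcal H\times A/N$ (resp. of $(\mathcal H\times K)_\lambda$ in $\mathcal H\times K/Z=\mathcal H\times\bar A$). For $a$ in this group and $\chi\in\mathrm{IBr}(J\mid\theta)$ (resp. $\mathrm{IBr}(J^\bullet\mid\lambda)$), $J^a$ and $\chi^a$ are computed with any preimage of $a$; this is well defined because $N\le J$ (resp. $Z\le J^\bullet$). *)

(* Defs.v *)
From HB Require Import structures.
From mathcomp Require Import all_boot all_order all_algebra all_fingroup.
From mathcomp Require Import all_solvable mxrepresentation.

Set Implicit Arguments.
Unset Strict Implicit.
Unset Printing Implicit Defensive.

Import GroupScope GRing.Theory.
Local Open Scope ring_scope.

(* The element t is a uniformizer. The last condition says that R is complete *)
(* for the filtration by the powers of its maximal ideal tR; separatedness is *)
(* automatic.                                                                 *)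
Definition complete_dvr (R : idomainType) : Prop :=
  exists t : R,
    [/\ t != 0, t \isn't a GRing.unit,
        forall x : R, x != 0 ->
          exists (u : R) (n : nat), u \is a GRing.unit /\ x = u * t ^+ n
      & forall u : nat -> R,
          (forall n, exists c, u n.+1 - u n = c * t ^+ n) ->
          exists l, forall n, exists c, l - u n = c * t ^+ n].

Record modular_system (p : nat) := ModularSystem {
  msK : fieldType;
  msO : idomainType;
  msF : finFieldType;
  ms_frac : {rmorphism msO -> msK};
  ms_res : {rmorphism msO -> msF};
  ms_pcharK : [pchar msK] =i pred0;
  ms_pcharF : p \in [pchar msF];
  ms_dvr : complete_dvr msO;
  ms_frac_inj : injective ms_frac;
  ms_fracE : forall x, exists a b, b != 0 /\ x = ms_frac a / ms_frac b;
  ms_res_surj : forall y, exists a, ms_res a = y;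
  ms_res_ker : forall a, ms_res a = 0 <-> a \isn't a GRing.unit
}.

(* A finite abelian group of automorphisms of K, acting on the right. The     *)
(* action gal_F on the residue field is determined by gal_K through gal_FE.   *)
Record galois_group (p : nat) (S : modular_system p) := GaloisGroup {
  gal_type :> finGroupType;
  gal_K : gal_type -> {rmorphism msK S -> msK S};
  gal_F : gal_type -> {rmorphism msF S -> msF S};
  gal_abelian : abelian [set: gal_type];
  gal_faithful : forall s t, gal_K s =1 gal_K t -> s = t;
  gal_KM : forall (s t : gal_type) x, gal_K (s * t)%g x = gal_K t (gal_K s x);
  gal_KO : forall s a, exists b, gal_K s (ms_frac S a) = ms_frac S b;
  gal_FE : forall s a b, gal_K s (ms_frac S a) = ms_frac S b ->
             gal_F s (ms_res S a) = ms_res S b;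
  gal_onto : forall f : {rmorphism msF S -> msF S}, exists s, gal_F s =1 f
}.

Definition splits p (S : modular_system p) (gT : finGroupType)
    (A : {group gT}) : Prop :=
  forall X : {group gT}, X \subset A ->
    group_splitting_field (msK S) X /\ group_splitting_field (msF S) X.

(* A Brauer character of X <= gT is encoded as a function on gT that vanishes *)
(* outside the set of p-regular elements of X.                                *)
Notation bfun S gT := {ffun gT -> msK S}.

Section BrauerCharacters.

Variables (p : nat) (S : modular_system p).
Local Notation F := (msF S).

(* v is the sum of the lifts, to (#|F| - 1)-th roots of unity in O, of the    *)
(* eigenvalues of M, all of which lie in F.                                   *)
Definition brauer_value n (M : 'M[F]_n) (v : msK S) : Prop :=
  exists t : seq (msO S),
    [/\ char_poly M = \prod_(z <- t) ('X - (ms_res S z)%:P),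
        {in t, forall z, z ^+ #|F|.-1 = 1}
      & v = ms_frac S (\sum_(z <- t) z)].

Variable gT : finGroupType.
Implicit Types (X Y V W : {group gT}) (chi : bfun S gT).

Definition affords X n (r : gT -> 'M[F]_n) chi : Prop :=
  forall x, if (x \in X) && p^'.-elt x then brauer_value (r x) (chi x)
            else chi x = 0.

(* Degree 0 is allowed, so that the zero function is a Brauer character.      *)
Definition brauer_char X chi : Prop :=
  exists n (r : mx_representation F X n), affords X r chi.

Definition IBr X chi : Prop :=
  exists n (r : mx_representation F X n), mx_irreducible r /\ affords X r chi.

Definition bres Y chi : bfun S gT := [ffun x => if x \in Y then chi x else 0].

Definition IBr_over X Y (theta chi : bfun S gT) : Prop :=
  IBr X chi /\
  exists psi : bfun S gT, brauer_char Y psi /\ bres Y chi = theta + psi.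

Definition rel_projective X n (r : mx_representation F X n) V : Prop :=
  forall m (w : mx_representation F X m) (f : 'M[F]_(m, n)),
    {in X, forall x, w x *m f = f *m r x} ->
    (exists s : 'M[F]_(n, m),
       s *m f = 1%:M /\ {in V, forall x, r x *m s = s *m w x}) ->
    exists s : 'M[F]_(n, m),
      s *m f = 1%:M /\ {in X, forall x, r x *m s = s *m w x}.

Definition mod_vertex X n (r : mx_representation F X n) V : Prop :=
  [/\ V \subset X, rel_projective r V
    & forall W, W \proper V -> ~ rel_projective r W].

Definition vertex X chi V : Prop :=
  exists n (r : mx_representation F X n),
    [/\ mx_irreducible r, affords X r chi & mod_vertex r V].

Definition faithful_linear X chi : Prop :=
  exists r : mx_representation F X 1, affords X r chi /\ mx_faithful r.

(* F is large enough for the irreducible FX-modules over lam, so that         *)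
(* IBr_over X Z lam does not depend on F. For Z central in X and lam linear,  *)
(* an irreducible r lies over lam if and only if its restriction to Z affords *)
(* (deg r) * lam.                                                             *)
Definition split_above X (Z : {group gT}) (lam : bfun S gT) : Prop :=
  forall n (r : mx_representation F X n),
    mx_irreducible r -> affords Z r (lam *+ n) ->
    mx_absolutely_irreducible r /\ exists chi, affords X r chi.

End BrauerCharacters.

Section Triples.

Variables (p : nat) (S : modular_system p) (Gam : galois_group S).
Variable gT : finGroupType.
Local Notation F := (msF S).
Implicit Types (G H M N B X : {group gT}) (chi theta phi : bfun S gT).
Implicit Types a : Gam * gT.

Definition bact a chi : bfun S gT :=
  [ffun x => gal_K a.1 (chi (x ^ a.2^-1)%g)].

Definition gstab B X chi : {set Gam * gT} :=
  [set a | [&& a.2 \in B, X :^ a.2 == X & bact a chi == chi]].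

Definition stab B X chi : {set gT} :=
  [set g in B | (X :^ g == X) && (bact (1%g, g) chi == chi)].

Definition orb_stab B X chi : {set gT} :=
  [set g in B | (X :^ g == X) &&
     [exists s : Gam, bact (1%g, g) chi == bact (s, 1%g) chi]].

Definition Htriple G N theta : Prop :=
  [/\ N \subset G, IBr N theta & orb_stab G N theta = G].

Definition proj_rep (D : {set gT}) m (P : gT -> 'M[F]_m)
    (al : gT -> gT -> F) : Prop :=
  [/\ P 1%g = 1%:M,
      {in D, forall g, P g \in unitmx},
      {in D &, forall g h, al g h != 0}
    & {in D &, forall g h, P g *m P h = al g h *: P (g * h)%g}].

Definition associated (D : {set gT}) N theta m (P : gT -> 'M[F]_m) : Prop :=
  [/\ mx_repr N P, affords N P theta
    & {in D & N, forall g n, P g *m P n = P (g * n)%g /\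
                             P n *m P g = P (n * g)%g}].

Definition similar_on (D : {set gT}) m (P Q : gT -> 'M[F]_m) : Prop :=
  exists2 B : 'M[F]_m, B \in unitmx &
    {in D, forall x, P x = B *m Q x *m invmx B}.

Definition pact a m (P : gT -> 'M[F]_m) (x : gT) : 'M[F]_m :=
  map_mx (gal_F a.1) (P (x ^ a.2^-1)%g).

Definition is_mu (D : {set gT}) N m (P : gT -> 'M[F]_m) a
    (mu : gT -> F) : Prop :=
  [/\ {in D, forall x, mu x != 0},
      {in D & N, forall x n, mu (x * n)%g = mu x}
    & similar_on D (pact a P) (fun x => mu x *: P x)].

Definition same_scalar m m' (M1 : 'M[F]_m) (M2 : 'M[F]_m') : Prop :=
  exists z : F, M1 = z%:M /\ M2 = z%:M.

Definition sum_on m (P : gT -> 'M[F]_m) (C : {set gT}) : 'M[F]_m :=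
  \sum_(x in C) P x.

Variant star := star_none | star_c | star_b.

Definition central_cond G N H m m' (P : gT -> 'M[F]_m)
    (P' : gT -> 'M[F]_m') : Prop :=
  'C_G(N) \subset H /\ {in 'C_G(N), forall c, same_scalar (P c) (P' c)}.

Definition block_cond G N theta H m m' (P : gT -> 'M[F]_m)
    (P' : gT -> 'M[F]_m') : Prop :=
  {in stab G N theta, forall x,
     let C := x ^: (N <*> <[x]>) in
     same_scalar (sum_on P C) (sum_on P' (C :&: H))}.

(* The factor sets al and al' are constant on cosets of N and M, and each     *)
(* coset of N in the stabilizer of theta meets the stabilizer of phi, so      *)
(* their agreement under the isomorphism of quotients is their agreement on   *)
(* the stabilizer of phi.                                                     *)
Definition gives (st : star) G N theta H M phi m m' (P : gT -> 'M[F]_m)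
    (P' : gT -> 'M[F]_m') : Prop :=
  let T := stab G N theta in
  let T' := stab H M phi in
  [/\ associated T N theta P, associated T' M phi P',
      exists al al', [/\ proj_rep T P al, proj_rep T' P' al'
                       & {in T' &, forall x y, al x y = al' x y}],
      {in gstab H N theta, forall a, exists mu mu',
         [/\ is_mu T N P a mu, is_mu T' M P' a mu' & {in T', mu =1 mu'}]}
    & match st with
      | star_none => True
      | star_c => central_cond G N H P P'
      | star_b => central_cond G N H P P' /\ block_cond G N theta H P P'
      end].

Definition triple_geq (st : star) G N theta H M phi : Prop :=
  [/\ Htriple G N theta, Htriple H M phi & N * H = G]%g /\
  [/\ N :&: H = M, gstab H N theta = gstab H M phi
    & exists m m' (P : gT -> 'M[F]_m) (P' : gT -> 'M[F]_m'),
        gives st G N theta H M phi P P'].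

End Triples.

Definition bullet (gT kT : finGroupType) (A N : {group gT}) (Z : {group kT})
    (eps : {morphism (A / N)%g >-> coset_of Z}) (J : {group gT}) : {group kT} :=
  (coset Z @*^-1 (eps @* (J / N)))%G.

(* Main.v *)
Require Import Defs.
From HB Require Import structures.
From mathcomp Require Import all_boot all_order all_algebra all_fingroup.
From mathcomp Require Import all_solvable mxrepresentation.
From mathcomp Require Import all_field mxabelem ring.
From Stdlib Require Import ClassicalEpsilon.

Set Implicit Arguments.
Unset Strict Implicit.
Unset Printing Implicit Defensive.

Import GroupScope GRing.Theory.
Local Open Scope ring_scope.

(* Write modules as row spaces. Let r be an irreducible F_p N-module such that *)
(* its extension to F maps onto a module V affording theta, by a matrix f0.   *)
(* The commuting ring E of r is a finite division ring, hence a field, and by *)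
(* the density theorem it lies in the enveloping algebra of r; so E acts on V *)
(* by scalars, through a field embedding cc : E -> F. Let X be the group of   *)
(* the pairs (g, M) with g in A and M an invertible matrix over F_p such that *)
(* r n * M = M * r (n ^ g) for all n in N. It maps onto A, because theta^g is *)
(* a Galois conjugate of theta, with kernel E^*. Put K = X / {(n, r n)}, let  *)
(* Z be the image of E^* and let lambda be the inverse of cc on Z. Both       *)
(* stabilizers of theta and lambda in H x X are the stabilizer of cc.         *)
(*   The cc-eigenspace of E^* in F (x) r is a single copy of V, so the part   *)
(* of X over A_theta acts on it; this gives a representation R that extends V *)
(* and is equal to lambda^-1 on Z. If J is a subgroup over N, the modules     *)
(* over theta are the modules W (x) R with W a module of the bullet of J over *)
(* lambda, and nu maps the character of W (x) R to that of W. Projective      *)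
(* representations lift from K to A in the same way, P |-> P (x) R. The twist *)
(* of R by an element of the stabilizer of theta is conjugate to R without a  *)
(* scalar factor, so that mu_a does not change. Vertices are compared by      *)
(* Higman's criterion, and class sums by summing over a class of X, whose     *)
(* fibres over A are cosets of p'-groups.                                     *)

(** * Group algebras and matrix representations *)

(** An ordinary construction would extend V projectively to the stabilizer of theta and absorb the
    factor set in a central extension; Galois twists could then change the extension by scalars.
    Descending to the prime field avoids this. Automorphisms fix F_p, so theta and all its
    A-conjugates come from one simple F_p N-module r, and each g in A is covered by an invertible
    matrix over F_p ([covers_exists]), unique up to the units of the commuting field of r. The pairs
    (g, matrix) form X. A Galois automorphism does not move these matrices; it moves only the
    embedding cc of the commuting field into F, which singles out V. Fixing theta, fixing cc and
    fixing lambda are therefore the same condition ([gstab_cent_char], [cent_char_twisted],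
    [ext_gstab]). The extension R of V is cut out of r by f0, so its twists by this stabilizer are
    conjugate to R exactly, with no scalar ([triple_transfer_ext]).

    The rest rests on the record [triple_transfer] alone. Z acts on R by the inverse of lambda, so W
    (x) R makes sense over J when W lies over lambda. Homomorphisms correspond by Schur's lemma
    ([hom_lift]), every simple module over theta is of this form because it equals Hom_N(V, U) (x) V
    ([lift_surj]), and simplicity is preserved ([lift_irr]). Since Brauer characters determine
    simple modules ([IBr_rsim], [affords_IBr_rsim]), this gives nu; exact conjugacy of the twists of
    R gives its equivariance ([corr_pact]).

    For vertices, relative projectivity is a decomposition of 1 indexed by cosets, and tensoring
    with 1 carries such decompositions across ([lift_rel_projective]); minimality is transported
    with the help of [rel_projective_meet]. For the order relations, corresponding characters have
    corresponding stabilizers ([gstab_corr]), and P (x) R, P' (x) R inherit factor sets and mu_a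
    unchanged, while scalars on centralizers and class sums are multiplied by a common factor
    ([lift_cent], [class_sum_lift], [triple_geq_lift]). *)

Section GroupAlgebra.

Variables (F : fieldType) (gT : finGroupType).
Implicit Types (G H : {group gT}) (a b : gT -> F).

(** The function a stands for an element of the group algebra, so that one element can be evaluated
    in several modules at once; r is a bare function so that conjugated, twisted and Kronecker
    families are allowed. *)
Definition ga (G : {set gT}) n (r : gT -> 'M[F]_n) a := \sum_(x in G) a x *: r x.

Lemma ga_hom G n1 n2 (r1 : gT -> 'M[F]_n1) (r2 : gT -> 'M[F]_n2) f a :
  {in G, forall x, r1 x *m f = f *m r2 x} -> ga G r1 a *m f = f *m ga G r2 a.
Proof.
move=> h; rewrite mulmx_suml mulmx_sumr; apply: eq_bigr => x Gx.
by rewrite -scalemxAl -scalemxAr h.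
Qed.

Lemma ga_mul G a b : exists c, forall n (r : mx_representation F G n),
  ga G r c = ga G r a *m ga G r b.
Proof.
exists (fun x => \sum_(y in G) a y * b (y^-1 * x)%g) => n r.
rewrite /ga mulmx_suml; under eq_bigr do rewrite scaler_suml.
rewrite exchange_big /=; apply: eq_bigr => y Gy.
rewrite mulmx_sumr (reindex_inj (mulgI y)) /=.
apply: eq_big => [x|x Gyx]; first by rewrite groupMl.
rewrite mulKg repr_mxM //; last by rewrite groupMl in Gyx.
by rewrite -scalemxAl -scalemxAr scalerA.
Qed.

Lemma ga_delta G y : y \in G -> exists c, forall n (r : gT -> 'M[F]_n), ga G r c = r y.
Proof.
move=> Gy; exists (fun x => (x == y)%:R) => n r.
rewrite /ga (bigD1 y) //= eqxx scale1r big1 ?addr0 // => x /andP[_ /negPf->].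
by rewrite scale0r.
Qed.

Lemma gaD G n (r : gT -> 'M[F]_n) a b :
  ga G r (fun x => a x + b x) = ga G r a + ga G r b.
Proof. by rewrite /ga -big_split; apply: eq_bigr => x _; rewrite scalerDl. Qed.

Lemma gaZ G n (r : gT -> 'M[F]_n) k a :
  ga G r (fun x => k * a x) = k *: ga G r a.
Proof. by rewrite /ga scaler_sumr; apply: eq_bigr => x _; rewrite scalerA. Qed.

Lemma ga_sum (I : Type) (s : seq I) G (a : I -> gT -> F) :
  exists c, forall n (r : mx_representation F G n),
    ga G r c = \sum_(i <- s) ga G r (a i).
Proof.
elim: s => [|i s [c hc]].
  exists (fun => 0) => n r; rewrite big_nil /ga big1 // => x _.
  by rewrite scale0r.
by exists (fun x => a i x + c x) => n r; rewrite gaD big_cons hc.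
Qed.

Lemma ga_full G n (r : mx_representation F G n) X :
  mx_absolutely_irreducible r -> exists a, X = ga G r a.
Proof. by case/mx_abs_irrP=> _ [a_ h]; exists (a_^~ X); rewrite {1}[X]h. Qed.

Lemma ga_env G n (r : mx_representation F G n) X :
  (X \in enveloping_algebra_mx r)%MS -> exists a, X = ga G r a.
Proof.
case/envelop_mxP=> a ->; exists a; apply: eq_bigr => x _ //.
Qed.

Lemma irr_deg_gt0 G n (r : mx_representation F G n) : mx_irreducible r -> (0 < n)%N.
Proof. by case/mx_irrP. Qed.

Lemma hom_irr_free G n1 n2 (r1 : mx_representation F G n1)
    (r2 : gT -> 'M[F]_n2) f :
  mx_irreducible r1 -> f != 0 -> {in G, forall x, r1 x *m f = f *m r2 x} ->
  row_free f.
Proof.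
case/mx_irrP=> _ irr nzf h; rewrite -kermx_eq0; apply: contraT => nzk.
have /irr/(_ nzk): mxmodule r1 (kermx f).
  apply/mxmoduleP=> x Gx; apply/sub_kermxP.
  by rewrite -mulmxA h // mulmxA mulmx_ker mul0mx.
rewrite -sub1mx => /sub_kermxP; rewrite mul1mx => /eqP.
by rewrite (negPf nzf).
Qed.

Lemma hom_irr_full G n1 n2 (r1 : gT -> 'M[F]_n1)
    (r2 : mx_representation F G n2) f :
  mx_irreducible r2 -> f != 0 -> {in G, forall x, r1 x *m f = f *m r2 x} ->
  row_full f.
Proof.
case/mx_irrP=> _ irr nzf h; have: row_full <<f>>%MS.
  apply: irr; last by rewrite -mxrank_eq0 genmxE mxrank_eq0.
  apply/mxmoduleP=> x Gx; rewrite (eqmxMr _ (genmxE _)) genmxE.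
  by rewrite -h // submxMl.
by rewrite -!sub1mx genmxE.
Qed.

Lemma hom_irr_rsim G n1 n2 (r1 : mx_representation F G n1)
    (r2 : mx_representation F G n2) f :
  mx_irreducible r1 -> mx_irreducible r2 -> f != 0 ->
  {in G, forall x, r1 x *m f = f *m r2 x} -> mx_rsim r1 r2.
Proof.
move=> irr1 irr2 nzf h.
have fr := hom_irr_free irr1 nzf h; have fl := hom_irr_full irr2 nzf h.
exists f => //; by rewrite -(eqP fr) (eqP fl).
Qed.

(** The matrix of the homomorphism from the regular module that sends 1 to u. *)
Definition orbit_mx (G : {set gT}) n (r : gT -> 'M[F]_n) (u : 'rV_n) :=
  \matrix_(i < #|G|) (u *m r (enum_val i)).

Lemma orbit_mxE G n (r : gT -> 'M[F]_n) (u : 'rV_n) (c : 'rV_#|G|) :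
  c *m orbit_mx G r u = u *m ga G r (fun x => c 0 (enum_rank_in (group1 G) x)).
Proof.
rewrite mulmx_sum_row mulmx_sumr [RHS]big_enum_val /=.
by apply: eq_bigr => i _; rewrite rowK enum_valK_in scalemxAr.
Qed.

Lemma orbit_mxJ G n (r : mx_representation F G n) (u : 'rV_n) x :
  x \in G -> orbit_mx G r u *m r x = regular_mx F G x *m orbit_mx G r u.
Proof.
move=> Gx; apply/row_matrixP=> i; rewrite !row_mul !rowK -mulmxA.
have Gi := enum_valP i.
by rewrite -rowE rowK /gring_index enum_rankK_in ?groupM // repr_mxM.
Qed.

Lemma orbit_mx_full G n (r : mx_representation F G n) (u : 'rV_n) :
  mx_irreducible r -> u != 0 -> row_full (orbit_mx G r u).
Proof.
move=> irr nzu; apply: (@hom_irr_full G _ _ (regular_mx F G) r) => //.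
  apply: contraNneq nzu => o0; have:= rowK (fun i => u *m r (enum_val i))
     (enum_rank_in (group1 G) 1%g).
  rewrite -/(orbit_mx G r u) o0 row0 enum_rankK_in // repr_mx1 mulmx1.
  by move<-.
by move=> x Gx; rewrite orbit_mxJ.
Qed.

(* Take the largest i such that some a in the group algebra has the first i   *)
(* rows of r1(a) zero and r2(a) nonzero. Then the i-th row of r1(a c)         *)
(* determines r2(a c), and row i of r1(a) |-> v r2(a) is the required map.    *)
Lemma ker_sub_rsim G n1 n2 (r1 : mx_representation F G n1)
    (r2 : mx_representation F G n2) :
  mx_irreducible r1 -> mx_irreducible r2 ->
  (forall a, ga G r1 a = 0 -> ga G r2 a = 0) -> mx_rsim r1 r2.
Proof.
move=> irr1 irr2 ker12.
pose P i := exists a, (forall j : 'I_n1, (j < i)%N -> row j (ga G r1 a) = 0) /\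
                      ga G r2 a != 0.
have P0: P 0%N.
  have [c hc] := ga_delta (group1 G); exists c; split=> //.
  by rewrite hc repr_mx1 -mxrank_eq0 mxrank1 -lt0n (irr_deg_gt0 irr2).
have Pn: ~ P n1.
  case=> a [h /eqP[]]; apply: ker12; apply/row_matrixP=> j.
  by rewrite h ?row0.
have [i [Pi nPi]]: exists i, P i /\ ~ P i.+1.
  apply: NNPP => nP; apply: Pn.
  suff all k : P k by apply: all.
  by elim: k => // i Pi; apply: NNPP => nPi; apply: nP; exists i.
case: Pi => a [ha nza].
have ltin: (i < n1)%N.
  rewrite ltnNge; apply/negP=> le; apply: Pn; exists a; split=> // j lj.
  by apply: ha; apply: leq_trans le.
pose oi := Ordinal ltin.
pose u := row oi (ga G r1 a).
have [v nzv]: exists v : 'rV_n2, v *m ga G r2 a != 0.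
  apply: NNPP => h; case/eqP: nza; apply/row_matrixP=> j; rewrite row0.
  apply: NNPP => nz; apply: h; exists (delta_mx 0 j); rewrite -rowE.
  exact/eqP.
pose w := v *m ga G r2 a.
have key c: u *m ga G r1 c = 0 -> w *m ga G r2 c = 0.
  move=> uc0; have [d hd] := ga_mul G a c.
  rewrite -mulmxA -hd; suff ->: ga G r2 d = 0 by rewrite mulmx0.
  apply: NNPP => nz; apply: nPi; exists d; split; last exact/eqP.
  move=> j; rewrite ltnS leq_eqVlt => /orP[/eqP ji|lji].
    have ->: j = oi by apply: val_inj.
    by rewrite hd row_mul.
  by rewrite hd row_mul ha // mul0mx.
have nzu: u != 0.
  apply: contraNneq nzv => u0; rewrite -[v *m _]mulmx1.
  have [c hc] := ga_delta (group1 G).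
  by rewrite -(repr_mx1 r2) -hc key // u0 mul0mx.
have fl := orbit_mx_full irr1 nzu.
pose M1 := orbit_mx G r1 u; pose M2 := orbit_mx G r2 w.
have ker c : c *m M1 = 0 -> c *m M2 = 0.
  move=> c0; apply/row_matrixP=> j; rewrite row_mul row0 orbit_mxE key //.
  by rewrite -orbit_mxE -row_mul c0 row0.
have [X hX]: exists X, M1 *m X = M2.
  exists (pinvmx M1 *m M2); apply/eqP.
  rewrite -subr_eq0 mulmxA -[X in _ - X]mul1mx -mulmxBl; apply/eqP.
  by apply: ker; rewrite mulmxBl mul1mx -mulmxA mulVpmx // mulmx1 subrr.
apply: (@hom_irr_rsim G _ _ r1 r2 X) => // [|x Gx].
  apply: contraNneq nzv => X0; rewrite -/w -[w]mulmx1.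
  rewrite -(repr_mx1 r2).
  have := rowK (fun i => w *m r2 (enum_val i)) (enum_rank_in (group1 G) 1%g).
  by rewrite -/(orbit_mx G r2 w) -/M2 -hX X0 mulmx0 row0 enum_rankK_in // => <-.
apply: (row_full_inj fl).
rewrite !mulmxA orbit_mxJ // -/M1 -(mulmxA _ M1 X) hX.
by rewrite -orbit_mxJ.
Qed.

Lemma delta_mul_delta m n p q (A : 'M[F]_(m, n)) (k : 'I_p) i j (l : 'I_q) :
  delta_mx k i *m A *m delta_mx j l = A i j *: delta_mx k l.
Proof.
rewrite -(mul_delta_mx (0 : 'I_1) k i) -(mul_delta_mx (0 : 'I_1) j l) !mulmxA.
rewrite -(mulmxA _ _ A) -rowE -(mulmxA _ (row i A)) -colE.
by rewrite [col _ _]mx11_scalar mul_mx_scalar -scalemxAl mul_delta_mx !mxE.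
Qed.

(** The image under r1 of the kernel of r2 is a nonzero two-sided ideal of a full matrix algebra,
    hence contains 1. Explicitly, 1 is the sum over k of E_ki A E_jk, divided by a nonzero entry
    A_ij. *)
Lemma ker_notsub_unit G n1 n2 (r1 : mx_representation F G n1)
    (r2 : mx_representation F G n2) a :
  mx_absolutely_irreducible r1 -> ga G r1 a != 0 -> ga G r2 a = 0 ->
  exists b, ga G r1 b = 1%:M /\ ga G r2 b = 0.
Proof.
move=> /mx_abs_irrP[_ [a_ hE]] nza z2.
have E X : X = ga G r1 (a_^~ X) by rewrite {1}(hE X).
have [i [j nzij]]: exists i j, ga G r1 a i j != 0.
  apply: NNPP => h; case/eqP: nza; apply/matrixP=> i j; rewrite mxE.
  by apply: NNPP => nz; apply: h; exists i, j; apply/eqP.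
set A := ga G r1 a in E nzij *.
have mid k : exists c, ga G r1 c = delta_mx k i *m A *m delta_mx j k /\ ga G r2 c = 0.
  have [c hc] := ga_mul G (a_^~ (delta_mx k i)) a.
  have [d hd] := ga_mul G c (a_^~ (delta_mx j k)).
  by exists d; rewrite !hd !hc z2 mulmx0 mul0mx -!E.
pose c_ k := sval (constructive_indefinite_description _ (mid k)).
have hc k : ga G r1 (c_ k) = delta_mx k i *m A *m delta_mx j k /\ ga G r2 (c_ k) = 0.
  by rewrite /c_; case: constructive_indefinite_description.
have [c hs] := ga_sum (index_enum 'I_n1) G c_.
exists (fun x => (A i j)^-1 * c x); rewrite !gaZ !hs.
split; last by rewrite big1 ?scaler0 // => k _; case: (hc k).
rewrite (eq_bigr (fun k => A i j *: delta_mx k k)) => [|k _].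
  by rewrite -scaler_sumr -mx1_sum_delta scalerA mulVf // scale1r.
by case: (hc k) => -> _; rewrite delta_mul_delta.
Qed.

Lemma not_rsim_unit G n1 n2 (r1 : mx_representation F G n1)
    (r2 : mx_representation F G n2) :
  mx_absolutely_irreducible r1 -> mx_irreducible r2 -> ~ mx_rsim r2 r1 ->
  exists b, ga G r1 b = 1%:M /\ ga G r2 b = 0.
Proof.
move=> abs1 irr2 nsim.
have [a [nza z2]]: exists a, ga G r1 a != 0 /\ ga G r2 a = 0.
  apply: NNPP => h; apply: nsim; apply: ker_sub_rsim => //.
    exact: mx_abs_irrW.
  by move=> a z2; apply: NNPP => /eqP nz; apply: h; exists a.
exact: ker_notsub_unit nza z2.
Qed.

(** The sequence of U and its quotient: i and pr are module homomorphisms, whereas s and t are only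
    linear splittings. *)
Lemma submod_split G n (r : mx_representation F G n) (U : 'M_n)
    (modU : mxmodule r U) :
  exists (i : 'M[F]_(\rank U, n)) (pr : 'M[F]_(n, \rank (cokermx U)))
    (s : 'M[F]_(\rank (cokermx U), n)) (t : 'M[F]_(n, \rank U)),
  [/\ {in G, forall x, submod_repr modU x *m i = i *m r x},
      {in G, forall x, r x *m pr = pr *m factmod_repr modU x},
      [/\ i *m pr = 0, i *m t = 1%:M, s *m pr = 1%:M & s *m t = 0]
    & t *m i + pr *m s = 1%:M].
Proof.
exists (val_submod 1%:M), (in_factmod U 1%:M), (val_factmod 1%:M), (in_submod U 1%:M).
split.
- by move=> x Gx; rewrite /= -val_submodE -[X in val_submod X]mul1mx val_submodJ.
- move=> x Gx; rewrite /= -in_factmodE -[X in in_factmod U X]mul1mx.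
  by rewrite in_factmodJ.
- split; last by apply/eqP; rewrite -in_submodE in_submod_eq0 val_factmodP.
  + apply/eqP; rewrite -in_factmodE in_factmod_eq0; exact: val_submodP.
  + by rewrite -in_submodE val_submodK.
  + by rewrite -in_factmodE val_factmodK.
- by rewrite -val_submodE -val_factmodE add_sub_fact_mod.
Qed.

Lemma rep_split G n (r : mx_representation F G n) :
  mx_irreducible r \/ n = 0%N \/
  exists n1 n2 (r1 : mx_representation F G n1) (r2 : mx_representation F G n2)
    (i : 'M[F]_(n1, n)) (pr : 'M[F]_(n, n2)) (s : 'M[F]_(n2, n)) (t : 'M[F]_(n, n1)),
  [/\ (0 < n1)%N, (n1 < n)%N, (0 < n2)%N, (n2 < n)%N &
   [/\ {in G, forall x, r1 x *m i = i *m r x},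
      {in G, forall x, r x *m pr = pr *m r2 x},
      [/\ i *m pr = 0, i *m t = 1%:M, s *m pr = 1%:M & s *m t = 0]
    & t *m i + pr *m s = 1%:M]].
Proof.
case: (posnP n) => [n0|n_gt0]; first by right; left.
case: (classic (mx_irreducible r)) => [|red]; [by left | right; right].
have [U [modU nzU nf]]: exists U : 'M_n,
    [/\ mxmodule r U, U != 0 & ~~ row_full U].
  apply: NNPP => h; apply: red; apply/mx_irrP; split=> // U modU nzU.
  by apply: contraT => nf; case: h; exists U.
have rU : (0 < \rank U < n)%N.
  by rewrite lt0n mxrank_eq0 nzU ltn_neqAle rank_leq_row andbT.
have [i [pr [s [t H]]]] := submod_split modU.
exists (\rank U), (\rank (cokermx U)), (submod_repr modU), (factmod_repr modU).
exists i, pr, s, t; case/andP: rU => U0 Un.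
have [rc0 rcn]: (0 < \rank (cokermx U) /\ \rank (cokermx U) < n)%N.
  by rewrite mxrank_coker subn_gt0 Un ltn_subrL U0 n_gt0.
by [].
Qed.

(** In the basis formed by the rows of i and s, the matrix C becomes block triangular with diagonal
    blocks A and B. That k = m + n follows by comparing ranks. *)
Lemma char_poly_block m n k (A : 'M[F]_m) (B : 'M[F]_n) (C : 'M[F]_k)
  (i : 'M[F]_(m, k)) (pr : 'M[F]_(k, n)) (s : 'M[F]_(n, k)) (t : 'M[F]_(k, m)) :
  A *m i = i *m C -> C *m pr = pr *m B ->
  [/\ i *m pr = 0, i *m t = 1%:M, s *m pr = 1%:M & s *m t = 0] ->
  t *m i + pr *m s = 1%:M ->
  char_poly C = char_poly A * char_poly B.
Proof.
move=> hA hB [ip it sp st] ti.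
pose E := col_mx i s; pose E' := row_mx t pr.
have EE' : E *m E' = 1%:M.
  by rewrite mul_col_row ip it sp st -scalar_mx_block.
have E'E : E' *m E = 1%:M by rewrite mul_row_col.
have kmn : k = (m + n)%N.
  apply/eqP; rewrite eqn_leq -{1}(mxrank1 F k) -{2}(mxrank1 F (m + n)).
  by rewrite -E'E -EE' !mulmx_max_rank.
have EC : E *m C *m E' = block_mx A 0 (s *m C *m t) B.
  rewrite mul_col_mx mul_col_row -hA -mulmxA it mulmx1 -(mulmxA A) ip mulmx0.
  by rewrite -(mulmxA s C pr) hB mulmxA sp mul1mx.
have: char_poly C = char_poly (E *m C *m E').
  case: _ / kmn E E' EE' E'E {EC} => E E' EE' E'E; rewrite /char_poly /char_poly_mx.
  rewrite !map_mxM /=; set e := map_mx _ E; set e' := map_mx _ E'.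
  have ee' : e *m e' = 1%:M by rewrite -map_mxM EE' map_mx1.
  have e'e : e' *m e = 1%:M by rewrite -map_mxM E'E map_mx1.
  have -> : 'X%:M = e *m 'X%:M *m e' by rewrite mul_mx_scalar -scalemxAl ee' scalemx1.
  rewrite -mulmxBl -mulmxBr !det_mulmx mulrAC -det_mulmx ee' det1 mul1r.
  by rewrite mul_mx_scalar -scalemxAl ee' scalemx1.
move=> ->; rewrite EC /char_poly /char_poly_mx map_block_mx /= map_mx0.
rewrite scalar_mx_block opp_block_mx add_block_mx oppr0 addr0.
by rewrite det_lblock.
Qed.

(** Induction along a composition series. Of an extension only two traces are kept: elements of the
    group algebra that kill r kill both pieces, and characteristic polynomials multiply. *)
Lemma rep_ind G (P : forall n, mx_representation F G n -> Prop) :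
  (forall n (r : mx_representation F G n), n = 0%N -> P n r) ->
  (forall n (r : mx_representation F G n), mx_irreducible r -> P n r) ->
  (forall n1 n2 n (r1 : mx_representation F G n1) (r2 : mx_representation F G n2)
     (r : mx_representation F G n),
     (forall a, ga G r a = 0 -> ga G r1 a = 0 /\ ga G r2 a = 0) ->
     {in G, forall x, char_poly (r x) = char_poly (r1 x) * char_poly (r2 x)} ->
     P n1 r1 -> P n2 r2 -> P n r) ->
  forall n (r : mx_representation F G n), P n r.
Proof.
move=> P0 Pirr Psub n; have [k] := ubnP n; elim: k n => // k IH n ltnk r.
have [irr|[n0|[n1 [n2 [r1 [r2 [i [pr [s [t H]]]]]]]]]] := rep_split r.
- exact: Pirr.
- exact: P0.
case: H => _ n1n _ n2n [hi hp [ip it sp st] ti].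
apply: (Psub _ _ _ r1 r2 r).
- move=> a a0; split.
    by rewrite -[LHS]mulmx1 -it mulmxA (ga_hom _ hi) a0 mulmx0 mul0mx.
  by rewrite -[LHS]mul1mx -sp -mulmxA -(ga_hom _ hp) a0 mul0mx mulmx0.
- by move=> x Gx; apply: (char_poly_block (hi x Gx) (hp x Gx) _ ti).
- by apply: IH; apply: leq_trans n1n _; rewrite -ltnS.
- by apply: IH; apply: leq_trans n2n _; rewrite -ltnS.
Qed.

End GroupAlgebra.

(** * Kronecker products *)

Section Kronecker.

Variable R : comPzRingType.

Definition mxpair m n (i : 'I_(m * n)) : 'I_m * 'I_n :=
  enum_val (cast_ord (esym (mxvec_cast m n)) i).

Lemma mxpairK m n (i : 'I_m) (j : 'I_n) : mxpair (mxvec_index i j) = (i, j).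
Proof. by rewrite /mxpair /mxvec_index cast_ordK enum_rankK. Qed.

Lemma mxpair_index m n (k : 'I_(m * n)) :
  mxvec_index (mxpair k).1 (mxpair k).2 = k.
Proof. by case/mxvec_indexP: k => i j; rewrite mxpairK. Qed.

Lemma sum_mxpair (V : nmodType) m n (f : 'I_(m * n) -> V) :
  \sum_k f k = \sum_i \sum_j f (mxvec_index i j).
Proof.
rewrite pair_bigA /= (reindex (fun ij : 'I_m * 'I_n => mxvec_index ij.1 ij.2)) //.
exists (@mxpair m n) => [[i j] _|k _]; [exact: mxpairK | exact: mxpair_index].
Qed.

Definition kron m n p q (A : 'M[R]_(m, n)) (B : 'M[R]_(p, q)) :=
  \matrix_(i < m * p, j < n * q)
     (A (mxpair i).1 (mxpair j).1 * B (mxpair i).2 (mxpair j).2).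

Lemma kronE m n p q (A : 'M_(m, n)) (B : 'M_(p, q)) i j k l :
  kron A B (mxvec_index i k) (mxvec_index j l) = A i j * B k l.
Proof. by rewrite mxE !mxpairK. Qed.

Lemma kronP m n p q (X Y : 'M[R]_(m * p, n * q)) :
  (forall i j k l, X (mxvec_index i k) (mxvec_index j l) =
                   Y (mxvec_index i k) (mxvec_index j l)) -> X = Y.
Proof.
move=> e; apply/matrixP=> i j; case/mxvec_indexP: i => i k.
by case/mxvec_indexP: j => j l.
Qed.

Lemma kronM m1 m2 m3 n1 n2 n3 (A : 'M_(m1, m2)) (C : 'M_(m2, m3))
    (B : 'M_(n1, n2)) (D : 'M_(n2, n3)) :
  kron (A *m C) (B *m D) = kron A B *m kron C D.
Proof.
apply: kronP => i j k l; rewrite kronE !mxE sum_mxpair mulr_suml.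
apply: eq_bigr => s _; rewrite mulr_sumr; apply: eq_bigr => t _.
by rewrite !kronE mulrACA.
Qed.

Lemma kron_scalar m n a b : kron (a%:M : 'M_m) (b%:M : 'M_n) = (a * b)%:M.
Proof.
apply: kronP => i j k l; rewrite kronE !mxE.
have ->: (mxvec_index i k == mxvec_index j l) = (i == j) && (k == l).
  apply/eqP/andP=> [/(congr1 (@mxpair m n))|[/eqP-> /eqP->]] //.
  by rewrite !mxpairK => -[-> ->].
by case: (i == j); case: (k == l); rewrite ?mulr0n ?mulr1n ?mulr0 ?mul0r.
Qed.

Lemma kron1 m n : kron (1%:M : 'M_m) (1%:M : 'M_n) = 1%:M.
Proof. by rewrite kron_scalar mulr1. Qed.

Lemma kronZl a m n p q (A : 'M_(m, n)) (B : 'M_(p, q)) :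
  kron (a *: A) B = a *: kron A B.
Proof. by apply/matrixP=> i j; rewrite !mxE mulrA. Qed.

Lemma kronZr a m n p q (A : 'M_(m, n)) (B : 'M_(p, q)) :
  kron A (a *: B) = a *: kron A B.
Proof. by apply/matrixP=> i j; rewrite !mxE mulrCA. Qed.

Lemma kron_suml (I : Type) (r : seq I) (P : pred I) m n p q
    (A : I -> 'M_(m, n)) (B : 'M_(p, q)) :
  kron (\sum_(i <- r | P i) A i) B = \sum_(i <- r | P i) kron (A i) B.
Proof.
apply/matrixP=> i j; rewrite !mxE !summxE mulr_suml.
by apply: eq_bigr => s _; rewrite mxE.
Qed.

Lemma kron_sumr (I : Type) (r : seq I) (P : pred I) m n p q
    (A : 'M_(m, n)) (B : I -> 'M_(p, q)) :
  kron A (\sum_(i <- r | P i) B i) = \sum_(i <- r | P i) kron A (B i).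
Proof.
apply/matrixP=> i j; rewrite !mxE !summxE mulr_sumr.
by apply: eq_bigr => s _; rewrite mxE.
Qed.

End Kronecker.

Lemma map_kron (R1 R2 : comPzRingType) (f : {rmorphism R1 -> R2}) m n p q
    (A : 'M_(m, n)) (B : 'M_(p, q)) :
  map_mx f (kron A B) = kron (map_mx f A) (map_mx f B).
Proof. by apply/matrixP=> i j; rewrite !mxE rmorphM. Qed.

Section KroneckerField.

Variable F : fieldType.

Lemma kron_eq0 m n p q (A : 'M[F]_(m, n)) (B : 'M_(p, q)) :
  B != 0 -> kron A B = 0 -> A = 0.
Proof.
move=> nzB AB0; apply/matrixP=> i j; rewrite mxE.
apply: contraNeq nzB => nzA; apply/eqP/matrixP=> k l; rewrite mxE.
have := kronE A B i j k l; rewrite AB0 mxE => /esym/eqP.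
by rewrite mulf_eq0 (negPf nzA) => /eqP.
Qed.

Lemma kron_inj m n p q (A A' : 'M[F]_(m, n)) (B : 'M_(p, q)) :
  B != 0 -> kron A B = kron A' B -> A = A'.
Proof.
move=> nzB AB; apply/eqP; rewrite -subr_eq0; apply/eqP.
apply: (kron_eq0 nzB); apply/matrixP=> i j; rewrite !mxE mulrBl.
by move/matrixP/(_ i j): AB; rewrite !mxE => ->; rewrite subrr.
Qed.

Lemma kron_unit m n (A : 'M[F]_m) (B : 'M_n) :
  A \in unitmx -> B \in unitmx -> kron A B \in unitmx.
Proof.
move=> uA uB; have: kron A B *m kron (invmx A) (invmx B) = 1%:M.
  by rewrite -kronM !mulmxV // kron1.
by case/mulmx1_unit.
Qed.

Lemma invmx_kron m n (A : 'M[F]_m) (B : 'M_n) :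
  A \in unitmx -> B \in unitmx -> invmx (kron A B) = kron (invmx A) (invmx B).
Proof.
move=> uA uB; apply: (can_inj (mulKmx (kron_unit uA uB))).
by rewrite mulmxV ?kron_unit // -kronM !mulmxV // kron1.
Qed.

Lemma kron1_hom_block m e e' (P Q : 'M[F]_m) (X : 'M_(e * m, e' * m)) i j :
  kron 1%:M P *m X = X *m kron 1%:M Q ->
  let B := \matrix_(k, l) X (mxvec_index i k) (mxvec_index j l) in P *m B = B *m Q.
Proof.
move=> /matrixP cX B; apply/matrixP=> k l.
have := cX (mxvec_index i k) (mxvec_index j l).
rewrite !mxE !sum_mxpair (bigD1 i) //= [X in _ + X]big1 => [|s nsi].
  rewrite addr0 [in RHS](bigD1 j) //= [X in _ = _ + X]big1 => [|s nsj].
    rewrite addr0 => E; transitivity (\sum_t P k t * X (mxvec_index i t) (mxvec_index j l)).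
      by apply: eq_bigr => t _; rewrite mxE.
    transitivity (\sum_t X (mxvec_index i k) (mxvec_index j t) * Q t l); last first.
      by apply: eq_bigr => t _; rewrite mxE.
    transitivity (\sum_t X (mxvec_index i k) (mxvec_index j t) *
      kron 1%:M Q (mxvec_index j t) (mxvec_index j l)).
      by rewrite -E; apply: eq_bigr => t _; rewrite kronE !mxE eqxx mul1r.
    by apply: eq_bigr => t _; rewrite kronE !mxE eqxx mul1r.
  by rewrite big1 // => t _; rewrite kronE !mxE (negPf nsj) mul0r mulr0.
by rewrite big1 // => t _; rewrite kronE !mxE eq_sym (negPf nsi) !mul0r.
Qed.

(** Each m by m block of X commutes with V, so it is a scalar by Schur's lemma; t collects these
    scalars. *)
Lemma kron_comm (gT : finGroupType) (N : {group gT}) m (V : mx_representation F N m)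
    e e' (X : 'M[F]_(e * m, e' * m)) :
  mx_absolutely_irreducible V ->
  {in N, forall x, kron 1%:M (V x) *m X = X *m kron 1%:M (V x)} ->
  exists t : 'M_(e, e'), X = kron t 1%:M.
Proof.
move=> absV cX.
pose B i j := \matrix_(k, l) X (mxvec_index i k) (mxvec_index j l) : 'M[F]_m.
have [m0 _] := mx_abs_irrP absV.
have scB i j : exists c, B i j = c%:M.
  apply/is_scalar_mxP; apply: (mx_abs_irr_cent_scalar absV).
  by apply/centgmxP=> x Nx; rewrite (kron1_hom_block i j (cX x Nx)).
exists (\matrix_(i, j) B i j (Ordinal m0) (Ordinal m0)).
apply: kronP => i j k l; rewrite kronE mxE.
have [c Bc] := scB i j; move/matrixP/(_ k l): (Bc); rewrite mxE => ->.
by rewrite Bc !mxE eqxx mulr_natr.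
Qed.

End KroneckerField.

(** Descent on the dimension: if h is nonzero on a submodule it is restricted to it, and otherwise
    it factors through the quotient. *)
Lemma exists_irr_quot (F1 F2 : fieldType) (phi : {rmorphism F1 -> F2})
    (gT : finGroupType) (J N : {group gT}) m (rho : gT -> 'M[F2]_m) n
    (R : mx_representation F1 J n) (h : 'M[F2]_(n, m)) :
  N \subset J -> h != 0 -> {in N, forall x, map_mx phi (R x) *m h = h *m rho x} ->
  exists n' (U : mx_representation F1 J n') (f : 'M[F2]_(n', m)),
    [/\ mx_irreducible U, f != 0
      & {in N, forall x, map_mx phi (U x) *m f = f *m rho x}].
Proof.
move=> sNJ; have [k] := ubnP n; elim: k n R h => // k IH n R h ltnk nzh homh.
have [irr|[n0|[n1 [n2 [r1 [r2 [i [pr [s [t H]]]]]]]]]] := rep_split R.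
- by exists n, R, h.
- case/eqP: nzh; apply/matrixP=> i; have := ltn_ord i; by rewrite {2}n0.
case: H => _ n1n _ n2n [hi hp [ip it sp st] ti].
have [ih0|nzih] := eqVneq (map_mx phi i *m h) 0; last first.
  apply: (IH n1 r1) nzih _ => [|x Nx]; first by apply: leq_trans n1n _; rewrite -ltnS.
  by rewrite mulmxA -map_mxM hi ?(subsetP sNJ) // map_mxM -mulmxA homh // mulmxA.
have hE : map_mx phi pr *m (map_mx phi s *m h) = h.
  rewrite mulmxA -map_mxM -[RHS]mul1mx -(map_mx1 phi) -ti map_mxD mulmxDl.
  by rewrite [in RHS]map_mxM -[X in _ = X + _]mulmxA ih0 mulmx0 add0r.
apply: (IH n2 r2 (map_mx phi s *m h)) => [||x Nx].
- by apply: leq_trans n2n _; rewrite -ltnS.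
- by apply: contraNneq nzh => h0; rewrite -hE h0 mulmx0.
have Jx := subsetP sNJ x Nx.
rewrite -[LHS]mul1mx -(map_mx1 phi) -{1}sp map_mxM -!mulmxA.
rewrite (mulmxA (map_mx phi pr)) -map_mxM -hp // map_mxM -!mulmxA hE.
by rewrite homh.
Qed.

(** The descent starts from the regular module of J, with the map that sends x in N to v rho(x) and
    kills the elements outside N. It serves both for induction from N to J over one field and for
    descent from F to the prime field. *)
Lemma exists_irr_above (F1 F2 : fieldType) (phi : {rmorphism F1 -> F2})
    (gT : finGroupType) (J N : {group gT}) m (rho : mx_representation F2 N m) :
  N \subset J -> (0 < m)%N ->
  exists n' (U : mx_representation F1 J n') (f : 'M[F2]_(n', m)),
    [/\ mx_irreducible U, f != 0
      & {in N, forall x, map_mx phi (U x) *m f = f *m rho x}].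
Proof.
move=> sNJ m0; pose v : 'rV[F2]_m := delta_mx 0 (Ordinal m0).
pose h : 'M[F2]_(#|J|, m) := \matrix_(i < #|J|)
  (if enum_val i \in N then v *m rho (enum_val i) else 0).
apply: (@exists_irr_quot F1 F2 phi gT J N m rho _ (regular_repr F1 J) h) => //.
  apply/eqP=> h0; have := rowK (fun i => if enum_val i \in N then
     v *m rho (enum_val i) else 0) (enum_rank_in (group1 J) 1%g).
  rewrite -/h h0 row0 enum_rankK_in // group1 repr_mx1 mulmx1.
  move/matrixP/(_ 0 (Ordinal m0))/eqP.
  by rewrite !mxE !eqxx eq_sym oner_eq0.
move=> x Nx; apply/row_matrixP=> i; rewrite !row_mul.
rewrite map_regular_mx [in RHS]rowK /regular_mx rowK -rowE rowK.
have Jx := subsetP sNJ x Nx; have Ji := enum_valP i.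
rewrite /gring_index enum_rankK_in ?(groupM Ji Jx) // groupMr //.
by case: ifP => [Ni|_]; rewrite ?mul0mx // repr_mxM // mulmxA.
Qed.

(** * Clifford theory *)

Section Clifford.

Variables (F : fieldType) (gT : finGroupType).
Implicit Types (J N : {group gT}).

Lemma exists_irr_sub N n (r : mx_representation F N n) : (0 < n)%N ->
  exists n1 (S : mx_representation F N n1) (i : 'M[F]_(n1, n)),
    [/\ mx_irreducible S, i != 0 & {in N, forall x, S x *m i = i *m r x}].
Proof.
have [k] := ubnP n; elim: k n r => // k IH n r ltnk n0.
have [irr|[n00|[n1 [n2 [r1 [r2 [i [pr [s [t H]]]]]]]]]] := rep_split r.
- exists n, r, 1%:M; split=> // [|x _]; last by rewrite mulmx1 mul1mx.
  by rewrite -mxrank_eq0 mxrank1 -lt0n.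
- by rewrite n00 in n0.
case: H => n10 n1n _ _ [hi _ [_ it _ _] _].
have [|d [S [j [irrS nzj hj]]]] := IH n1 r1 _ n10.
  by apply: leq_trans n1n _; rewrite -ltnS.
exists d, S, (j *m i); split=> // [|x Nx].
  apply: contraNneq nzj => ji0.
  by rewrite -[j]mulmx1 -it mulmxA ji0 mul0mx.
by rewrite mulmxA hj // -!mulmxA hi.
Qed.

Lemma ga_conj N j a : j \in 'N(N) -> exists b, forall n (r : gT -> 'M[F]_n),
  ga N r b = ga N (fun x => r (x ^ j)%g) a.
Proof.
move=> nNj; exists (fun x => a (x ^ j^-1)%g) => n r.
rewrite /ga (reindex_inj (conjg_inj j)) /=.
apply: eq_big => [x|x _]; first by rewrite memJ_norm.
by rewrite conjgK.
Qed.

(* A simple FN-submodule S of U is isomorphic to V: otherwise some element b  *)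
(* of FN acts as 1 on V and as 0 on S, and the product of the conjugates of b *)
(* acts as 1 on V and as 0 on the sum U of the conjugates of S.               *)
Lemma Clifford_embed J N n (U : mx_representation F J n) m
    (V : mx_representation F N m) :
  N <| J -> mx_irreducible U -> mx_absolutely_irreducible V ->
  {in J, forall j, exists2 T, T \in unitmx &
    {in N, forall x, T *m V (x ^ j)%g = V x *m T}} ->
  (forall a, ga N U a = 0 -> ga N V a = 0) ->
  exists g : 'M[F]_(m, n), g != 0 /\ {in N, forall x, V x *m g = g *m U x}.
Proof.
move=> nNJ irrU absV invV kerUV; have [sNJ /subsetP nN] := andP nNJ.
have [n1 [S [i [irrS nzi hi]]]] := exists_irr_sub (subg_repr U sNJ) (irr_deg_gt0 irrU).
rewrite /= in hi.
case: (classic (mx_rsim V S)) => [/mx_rsim_def[B [B' B'B hB]]|nsim]; last first.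
  have {}nsim: ~ mx_rsim S V by move=> h; apply: nsim; apply: mx_rsim_sym.
  have [b [Vb Sb]] := not_rsim_unit absV irrS nsim.
  have conjE j x : j \in J -> x \in J -> U j *m U (x ^ j)%g = U x *m U j.
    by move=> Jj Jx; rewrite -!repr_mxM ?groupJ // -conjgC.
  have key (l : seq gT) : {subset l <= J} ->
      exists c, ga N V c = 1%:M /\ {in l, forall j, i *m U j *m ga N U c = 0}.
    elim: l => [|j l IHl] sl.
      have [c hc] := ga_delta F (group1 N).
      by exists c; rewrite hc repr_mx1.
    have [|c [Vc Uc]] := IHl; first by move=> y ly; apply: sl; rewrite inE ly orbT.
    have Jj: j \in J by apply: sl; rewrite inE eqxx.
    have [bj hbj] := ga_conj b (nN j Jj); have [d hd] := ga_mul N bj c.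
    have hdU := hd _ (subg_repr U sNJ); rewrite /= in hdU.
    exists d; rewrite hd hdU hbj Vc mulmx1; split.
      have [T uT hT] := invV j Jj.
      apply: (can_inj (mulKmx uT)); rewrite mulmx1.
      by rewrite -(@ga_hom _ _ _ _ _ V) ?Vb ?mul1mx // => x Nx; rewrite hT.
    move=> k; rewrite inE => /predU1P[->|lk].
      rewrite mulmxA -(mulmxA i) hbj.
      rewrite -(@ga_hom _ _ _ _ _ U) => [|x Nx]; last first.
        by rewrite conjE // (subsetP sNJ).
      by rewrite (mulmxA i) -(ga_hom b hi) Sb !mul0mx.
    have Jk: k \in J by apply: sl; rewrite inE lk orbT.
    rewrite mulmxA -[X in X *m ga N U c](@ga_hom _ _ _ _ _ (fun x => S (x ^ k^-1)%g)).
      by rewrite -!mulmxA (mulmxA i) Uc // mulmx0.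
    move=> x Nx; have Nxk : (x ^ k^-1)%g \in N by rewrite memJ_norm ?groupV ?nN.
    rewrite mulmxA hi // -!mulmxA -conjE // ?(subsetP sNJ) //.
    by rewrite conjgKV.
  have [|c [Vc Uc]] := key (enum J); first by move=> y; rewrite mem_enum.
  suff Uc0: ga N U c = 0.
    move: (kerUV c Uc0); rewrite Vc => /eqP; have [m0 _] := mx_abs_irrP absV.
    by rewrite -mxrank_eq0 mxrank1 eqn0Ngt m0.
  pose Y := (\sum_(j in J) <<i *m U j>>)%MS.
  have Y1: row_full Y.
    case/mx_irrP: irrU => _; apply.
      apply/mxmoduleP=> x Jx; rewrite sumsmxMr; apply/sumsmx_subP=> j Jj.
      rewrite (eqmxMr _ (genmxE _)) -mulmxA -repr_mxM //.
      by rewrite (sumsmx_sup (j * x)%g) ?groupM // genmxE.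
    apply: contraNneq nzi => Y0; rewrite -submx0 -Y0 (sumsmx_sup 1%g) //.
    by rewrite genmxE repr_mx1 mulmx1.
  apply: (row_full_inj Y1); rewrite mulmx0; apply/eqP; rewrite -submx0.
  rewrite sumsmxMr; apply/sumsmx_subP=> j Jj.
  by rewrite (eqmxMr _ (genmxE _)) Uc ?mem_enum // sub0mx.
exists (B *m i); split=> [|x Nx].
  by apply: contraNneq nzi => Bi0; rewrite -[i]mul1mx -B'B -mulmxA Bi0 mulmx0.
by rewrite hB // -!mulmxA (mulmxA B') B'B mul1mx hi.
Qed.

End Clifford.

(** * The evaluation map from Hom_N(V, U) (x) V to U *)

Section Stack.

Variable F : fieldType.

(** When the rows of H are the vectorized members of a basis of Hom_N(V, U), this is the matrix of
    the evaluation map from Hom_N(V, U) (x) V to U. *)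
Definition stack e m n (H : 'M[F]_(e, m * n)) : 'M_(e * m, n) :=
  \matrix_(k, j) H (mxpair k).1 (mxvec_index (mxpair k).2 j).

Lemma stackE e m n (H : 'M[F]_(e, m * n)) i k j :
  stack H (mxvec_index i k) j = H i (mxvec_index k j).
Proof. by rewrite mxE mxpairK. Qed.

Lemma stackP e m n (A B : 'M[F]_(e * m, n)) :
  (forall i k j, A (mxvec_index i k) j = B (mxvec_index i k) j) -> A = B.
Proof. by move=> h; apply/matrixP=> i j; case/mxvec_indexP: i => i k. Qed.

Lemma kron_stack e e' m m' n (D : 'M_(e, e')) (T : 'M_(m, m')) H H' :
  (forall i, T *m vec_mx (row i (D *m H)) = vec_mx (row i H') :> 'M[F]_(m, n)) ->
  kron D T *m stack H = stack H'.
Proof.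
move=> h; apply: stackP => i k j.
have /matrixP/(_ k j) hE := h i; rewrite !mxE in hE; rewrite stackE -hE mxE sum_mxpair.
rewrite exchange_big /=; apply: eq_bigr => t _; rewrite !mxE mulr_sumr.
by apply: eq_bigr => s _; rewrite kronE stackE mulrA [D i s * _]mulrC.
Qed.

Lemma stack_mul e m n n' (H : 'M[F]_(e, m * n)) H' (Y : 'M_(n, n')) :
  (forall i, vec_mx (row i H) *m Y = vec_mx (row i H')) ->
  stack H *m Y = stack H'.
Proof.
move=> h; apply: stackP => i k j; have /matrixP/(_ k j) hE := h i.
rewrite !mxE in hE; rewrite stackE -hE mxE; apply: eq_bigr => s _.
by rewrite stackE !mxE.
Qed.

(** The group algebra of N acts on V by all matrices, so the kernel of the evaluation map is stable
    under every 1 (x) Y. Taking matrix units for Y reduces injectivity to the independence of the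
    rows of H. *)
Lemma stack_free (gT : finGroupType) (N : {group gT}) m n e
    (V : mx_representation F N m) (U : gT -> 'M[F]_n) (H : 'M_(e, m * n)) :
  mx_absolutely_irreducible V -> row_free H ->
  (forall i, {in N, forall x, V x *m vec_mx (row i H) = vec_mx (row i H) *m U x}) ->
  row_free (stack H).
Proof.
move=> absV frH homH; rewrite -kermx_eq0; apply/rowV0P=> w /sub_kermxP w0.
have key (Y : 'M_m) : w *m kron 1%:M Y *m stack H = 0.
  have [a ->] := ga_full Y absV.
  have hom : {in N, forall x, kron 1%:M (V x) *m stack H = stack H *m U x}.
    move=> x Nx; pose H' := \matrix_i mxvec (V x *m vec_mx (row i H)).
    rewrite (@kron_stack _ _ _ _ _ _ _ _ H') => [|i].
      apply/esym/stack_mul => i; by rewrite rowK mxvecK homH.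
    by rewrite mul1mx rowK mxvecK.
  rewrite kron_sumr -mulmxA -/(ga N (fun x => kron 1%:M (V x)) a).
  rewrite (eq_bigr (fun x => a x *: kron 1%:M (V x))) => [|x _]; last exact: kronZr.
  by rewrite (ga_hom (r1 := fun x => kron 1%:M (V x)) a hom) mulmxA w0 mul0mx.
apply/rowP=> k; rewrite mxE; case/mxvec_indexP: k => i k.
pose v := \row_s w 0 (mxvec_index s k).
suff: v = 0 by move/rowP/(_ i); rewrite !mxE.
apply: (row_free_inj frH); rewrite mul0mx; apply/rowP=> j; rewrite [RHS]mxE.
case/mxvec_indexP: j => b j; have /matrixP/(_ 0 j) := key (delta_mx k b).
rewrite mxE [RHS]mxE => <-; rewrite mxE sum_mxpair; apply: eq_bigr => s _.
rewrite (bigD1 b) //= [X in _ + X]big1 => [|t ntb].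
  rewrite addr0 stackE [v 0 s]mxE; congr (_ * _); rewrite mxE sum_mxpair.
  rewrite (bigD1 s) //= [X in _ + X]big1 => [|u nus].
    rewrite addr0 (bigD1 k) //= big1 => [|u nuk].
      by rewrite kronE !mxE !eqxx !mulr1 addr0.
    by rewrite kronE !mxE (negPf nuk) mulr0 mulr0.
  by rewrite big1 // => t _; rewrite kronE !mxE (negPf nus) mul0r mulr0.
rewrite mxE sum_mxpair big1 ?mul0r // => u _; rewrite big1 // => l _.
by rewrite kronE !mxE (negPf ntb) andbF !mulr0.
Qed.

Lemma hom_space (gT : finGroupType) (N : {group gT}) m n
    (V : gT -> 'M[F]_m) (U : gT -> 'M[F]_n) :
  exists e (H : 'M_(e, m * n)), row_free H /\
    forall g, (mxvec g <= H)%MS <-> {in N, forall x, V x *m g = g *m U x}.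
Proof.
pose f x := lin_mx (mulmx (V x) \- mulmxr (U x)).
pose H := (\bigcap_(x in N) kermx (f x))%MS.
exists (\rank H), (row_base H); split=> [|g]; first exact: row_base_free.
rewrite eq_row_base; split=> [/sub_bigcapmxP h x Nx|h].
  have /sub_kermxP := h x Nx; rewrite mul_vec_lin /= => /(canRL mxvecK).
  by rewrite linear0 => /eqP; rewrite subr_eq0 => /eqP.
apply/sub_bigcapmxP=> x Nx; apply/sub_kermxP; rewrite mul_vec_lin /= h //.
by rewrite subrr linear0.
Qed.

End Stack.

(** * Tensoring with an extension of V *)

Section Lift.

Variables (F : fieldType) (gT kT xT : finGroupType).
Variables (X : {group xT}) (A N : {group gT}) (K Z : {group kT}).
Variables (p1 : xT -> gT) (p2 : xT -> kT).

(* X is an extension of A by Z and of K by N: A / N = X / (N x Z) = K / Z.     *)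
Record two_projections : Prop := TwoProjections {
  p1M : {in X &, {morph p1 : x y / (x * y)%g}};
  p2M : {in X &, {morph p2 : x y / (x * y)%g}};
  p1A : {in X, forall x, p1 x \in A};
  p2K : {in X, forall x, p2 x \in K};
  p1_onto : {in A, forall g, exists2 x, x \in X & p1 x = g};
  p2_onto : {in K, forall k, exists2 x, x \in X & p2 x = k};
  p1N : {in X, forall x, p2 x = 1%g -> p1 x \in N};
  p2Z : {in X, forall x, p1 x = 1%g -> p2 x \in Z};
  p1_ontoN : {in N, forall g, exists2 x, x \in X & p1 x = g /\ p2 x = 1%g};
  p2_ontoZ : {in Z, forall k, exists2 x, x \in X & p2 x = k /\ p1 x = 1%g};
  p12_inj : {in X, forall x, p1 x = 1%g -> p2 x = 1%g -> x = 1%g}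
}.

Hypothesis TP : two_projections.

Lemma p1_1 : p1 1%g = 1%g.
Proof. by apply: (mulgI (p1 1%g)); rewrite -(p1M TP) // !mulg1. Qed.

Lemma p2_1 : p2 1%g = 1%g.
Proof. by apply: (mulgI (p2 1%g)); rewrite -(p2M TP) // !mulg1. Qed.

Lemma p1V : {in X, {morph p1 : x / (x^-1)%g}}.
Proof.
by move=> x Xx; apply: (mulgI (p1 x)); rewrite -(p1M TP) ?groupV // !mulgV p1_1.
Qed.

Lemma p2V : {in X, {morph p2 : x / (x^-1)%g}}.
Proof.
by move=> x Xx; apply: (mulgI (p2 x)); rewrite -(p2M TP) ?groupV // !mulgV p2_1.
Qed.

Lemma p1J : {in X &, {morph p1 : x y / (x ^ y)%g}}.
Proof. by move=> x y Xx Xy; rewrite /conjg !(p1M TP) ?p1V ?groupM ?groupV. Qed.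

Lemma p2J : {in X &, {morph p2 : x y / (x ^ y)%g}}.
Proof. by move=> x y Xx Xy; rewrite /conjg !(p2M TP) ?p2V ?groupM ?groupV. Qed.

Lemma p1X n : {in X, {morph p1 : x / (x ^+ n)%g}}.
Proof.
by move=> x Xx; elim: n => [|n IHn]; rewrite ?p1_1 // !expgS (p1M TP) ?groupX ?IHn.
Qed.

Lemma p2X n : {in X, {morph p2 : x / (x ^+ n)%g}}.
Proof.
by move=> x Xx; elim: n => [|n IHn]; rewrite ?p2_1 // !expgS (p2M TP) ?groupX ?IHn.
Qed.

Lemma same_p1 x y : x \in X -> y \in X -> p1 x = p1 y ->
  exists2 z, z \in X /\ p1 z = 1%g & y = (x * z)%g.
Proof.
move=> Xx Xy xy; exists (x^-1 * y)%g; last by rewrite mulKVg.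
by rewrite groupM ?groupV //; rewrite (p1M TP) ?groupV // p1V // xy mulVg.
Qed.

Lemma same_p2 x y : x \in X -> y \in X -> p2 x = p2 y ->
  exists2 z, z \in X /\ p2 z = 1%g & y = (x * z)%g.
Proof.
move=> Xx Xy xy; exists (x^-1 * y)%g; last by rewrite mulKVg.
by rewrite groupM ?groupV //; rewrite (p2M TP) ?groupV // p2V // xy mulVg.
Qed.

Definition sec1 g := odflt 1%g [pick x in X | p1 x == g].
Definition sec2 k := odflt 1%g [pick x in X | p2 x == k].

Lemma sec1P g : g \in A -> sec1 g \in X /\ p1 (sec1 g) = g.
Proof.
move=> Ag; rewrite /sec1; case: pickP => /= [x /andP[Xx /eqP]|none] //.
by have [x Xx xg] := p1_onto TP Ag; move: (none x); rewrite /= xg eqxx Xx.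
Qed.

Lemma sec2P k : k \in K -> sec2 k \in X /\ p2 (sec2 k) = k.
Proof.
move=> Kk; rewrite /sec2; case: pickP => /= [x /andP[Xx /eqP]|none] //.
by have [x Xx xk] := p2_onto TP Kk; move: (none x); rewrite /= xk eqxx Xx.
Qed.

(** The relation between J and its bullet, expressed by a common preimage in X. Since that preimage
    contains the kernels of both projections up to N and Z, it forces J to contain N and J' to
    contain Z ([matched_sub]). *)
Definition matched (J : {set gT}) (J' : {set kT}) :=
  [/\ J \subset A, J' \subset K
    & {in X, forall x, (p1 x \in J) = (p2 x \in J')}].

Lemma matched_sub (J J' : {group _}) : matched J J' -> N \subset J /\ Z \subset J'.
Proof.
case=> _ _ m; split; apply/subsetP=> y Hy.
  by have [x Xx [<- x1]] := p1_ontoN TP Hy; rewrite m // x1.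
by have [x Xx [<- x1]] := p2_ontoZ TP Hy; rewrite -m // x1.
Qed.

(* R extends V to the preimage of J in X, with Z acting through the inverse   *)
(* of the linear character lz.                                                *)
Variables (m : nat) (V : mx_representation F N m) (R : xT -> 'M[F]_m) (lz : kT -> F).

Record extends (J : {set gT}) : Prop := Extends {
  ext1 : R 1%g = 1%:M;
  extM : {in X &, forall x y, p1 x \in J -> p1 y \in J -> R (x * y)%g = R x *m R y};
  extN : {in X, forall x, p2 x = 1%g -> R x = V (p1 x)};
  extZ : {in X, forall x, p1 x = 1%g -> R x = (lz (p2 x))^-1%:M};
  lz_neq0 : {in Z, forall z, lz z != 0}
}.

Hypothesis absV : mx_absolutely_irreducible V.

Variables (J : {group gT}) (J' : {group kT}).
Hypotheses (mJ : matched J J') (extR : extends J).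

Let sNJ : N \subset J. Proof. by case: (matched_sub mJ). Qed.
Let sZJ : Z \subset J'. Proof. by case: (matched_sub mJ). Qed.
Let sJA : J \subset A. Proof. by case: mJ. Qed.
Let sJK : J' \subset K. Proof. by case: mJ. Qed.

Lemma R_unit x : x \in X -> p1 x \in J -> R x \in unitmx.
Proof.
move=> Xx Jx; suff: R x *m R x^-1%g = 1%:M by case/mulmx1_unit.
by rewrite -(extM extR) ?groupV // ?mulgV ?(ext1 extR) // p1V // groupV.
Qed.

Lemma R_neq0 x : x \in X -> p1 x \in J -> R x != 0.
Proof.
move=> Xx Jx; have uR := R_unit Xx Jx; have [m0 _] := mx_abs_irrP absV.
by rewrite -mxrank_eq0 (mxrank_unit uR) -lt0n.
Qed.

Definition lz_scalar e (W : kT -> 'M[F]_e) :=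
  {in J' & Z, forall k z, W (k * z)%g = lz z *: W k}.

Definition lift_mx e (W : kT -> 'M[F]_e) g := kron (W (p2 (sec1 g))) (R (sec1 g)).

(** Two elements of X over the same g differ by an element over Z, which acts on W by lz and on R by
    its inverse; the two factors cancel, so the chosen section does not matter. *)
Lemma liftE e (W : kT -> 'M[F]_e) x : lz_scalar W -> x \in X -> p1 x \in J ->
  lift_mx W (p1 x) = kron (W (p2 x)) (R x).
Proof.
move=> scW Xx Jx; have Ax := subsetP sJA _ Jx.
have [Xs sx] := sec1P Ax; have [z [Xz z1] xE] := same_p1 Xs Xx sx.
have mX : p2 (sec1 (p1 x)) \in J' by case: mJ => _ _ <- //; rewrite sx.
have Zz := p2Z TP Xz z1.
rewrite /lift_mx {3 4}xE (p2M TP) // scW // (extM extR) ?sx ?z1 //.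
rewrite (extZ extR Xz z1) mul_mx_scalar kronZl kronZr scalerA divff ?scale1r //.
exact: (lz_neq0 extR).
Qed.

Lemma liftN e (W : kT -> 'M[F]_e) g : lz_scalar W -> W 1%g = 1%:M -> g \in N ->
  lift_mx W g = kron 1%:M (V g).
Proof.
move=> scW W1 Ng; have [x Xx [<- x1]] := p1_ontoN TP Ng.
by rewrite liftE ?x1 ?W1 ?(extN extR) // (subsetP sNJ) ?(p1N TP).
Qed.

Lemma lift_mx_repr e (W : mx_representation F J' e) : lz_scalar W ->
  mx_repr J (lift_mx W).
Proof.
move=> scW; split=> [|g h Jg Jh].
  by rewrite -p1_1 liftE // ?p1_1 // p2_1 repr_mx1 (ext1 extR) kron1.
have [Xg gE] := sec1P (subsetP sJA _ Jg); have [Xh hE] := sec1P (subsetP sJA _ Jh).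
have Jg' : p2 (sec1 g) \in J' by case: mJ => _ _ <- //; rewrite gE.
have Jh' : p2 (sec1 h) \in J' by case: mJ => _ _ <- //; rewrite hE.
rewrite -gE -hE -(p1M TP) // !liftE ?(p1M TP) ?gE ?hE ?groupM // ?(p2M TP) //.
by rewrite repr_mxM // (extM extR) ?gE ?hE // kronM.
Qed.

Definition lift_repr e (W : mx_representation F J' e) (scW : lz_scalar W) :=
  MxRepresentation (lift_mx_repr scW).

Lemma lift_hom e1 e2 (W1 : kT -> 'M[F]_e1) (W2 : kT -> 'M[F]_e2)
    (t : 'M_(e1, e2)) : lz_scalar W1 -> lz_scalar W2 ->
  {in J', forall k, W1 k *m t = t *m W2 k} ->
  {in J, forall g, lift_mx W1 g *m kron t 1%:M = kron t 1%:M *m lift_mx W2 g}.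
Proof.
move=> sc1 sc2 h g Jg; have [Xg gE] := sec1P (subsetP sJA _ Jg).
by rewrite -gE !liftE ?gE // -!kronM mulmx1 mul1mx h //; case: mJ => _ _ <- //;
  rewrite gE.
Qed.

(** On N both lifts are multiples of V, so f has the form t (x) 1 by [kron_comm]; then the nonzero
    factor R x can be cancelled. *)
Lemma hom_lift e1 e2 (W1 : kT -> 'M[F]_e1) (W2 : kT -> 'M[F]_e2)
    (f : 'M_(e1 * m, e2 * m)) : lz_scalar W1 -> lz_scalar W2 ->
  W1 1%g = 1%:M -> W2 1%g = 1%:M ->
  {in J, forall g, lift_mx W1 g *m f = f *m lift_mx W2 g} ->
  exists2 t, f = kron t 1%:M & {in J', forall k, W1 k *m t = t *m W2 k}.
Proof.
move=> sc1 sc2 W11 W21 h; have [t ft]: exists t : 'M_(e1, e2), f = kron t 1%:M.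
  apply: (kron_comm absV) => x Nx; have := h x (subsetP sNJ x Nx).
  by rewrite !liftN.
exists t => // k Jk; have [Xk kE] := sec2P (subsetP sJK _ Jk).
have Jpk : p1 (sec2 k) \in J by case: mJ => _ _ ->; rewrite ?kE.
have := h _ Jpk; rewrite !liftE // ft -!kronM kE mulmx1 mul1mx.
by apply: kron_inj; apply: R_neq0.
Qed.

Lemma lz_scalar_mono e1 e2 (W1 : mx_representation F J' e1)
    (W2 : mx_representation F J' e2) f : row_free f ->
  {in J', forall k, W1 k *m f = f *m W2 k} -> lz_scalar W2 -> lz_scalar W1.
Proof.
move=> fr h sc k z Jk Zz; have Jz := subsetP sZJ _ Zz; apply: (row_free_inj fr).
by rewrite h ?groupM // sc // -scalemxAr -h // scalemxAl.
Qed.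

Let m_gt0 : (0 < m)%N. Proof. by case: (mx_abs_irrP absV). Qed.
Lemma lift_irr_inv e (W : mx_representation F J' e) (scW : lz_scalar W) :
  mx_irreducible (lift_repr scW) -> mx_irreducible W.
Proof.
move=> irr; have [irrW|[n0|[n1 [n2 [r1 [r2 [i [pr [s [t H]]]]]]]]]] := rep_split W.
- by [].
- by have := irr_deg_gt0 irr; rewrite muln_gt0 {1}n0.
case: H => n10 n1n _ _ [hi _ [_ it _ _] _].
have fi : row_free i by apply/row_freeP; exists t.
have sc1 := lz_scalar_mono fi hi scW.
have h := lift_hom sc1 scW hi.
have nzi : kron i 1%:M != 0 :> 'M[F]_(n1 * m, e * m).
  apply: contraTneq fi => /kron_eq0 -> //.
    by rewrite -row_leq_rank mxrank0 -ltnNge.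
  by rewrite -mxrank_eq0 mxrank1 -lt0n.
have := hom_irr_full irr nzi h.
move/eqP=> rk; have := rank_leq_row (kron i 1%:M : 'M[F]_(n1 * m, e * m)).
by rewrite rk leq_pmul2r // leqNgt n1n.
Qed.

Lemma lift_abs_irr_inv e (W : mx_representation F J' e) (scW : lz_scalar W) :
  mx_absolutely_irreducible (lift_repr scW) -> mx_absolutely_irreducible W.
Proof.
move=> absU; have irrW := lift_irr_inv (mx_abs_irrW absU).
apply: cent_mx_scalar_abs_irr => //.
rewrite leqNgt; apply/negP.
move=> /(has_non_scalar_mxP (scalar_mx_cent _ _))[t]; rewrite memmx_cent_envelop.
move=> /centgmxP ct /negP[].
have /centgmxP/(mx_abs_irr_cent_scalar absU)/is_scalar_mxP[c tc]: forall x, x \in J ->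
    kron t 1%:M *m lift_repr scW x = lift_repr scW x *m kron t 1%:M.
  by move=> x Jx; rewrite (lift_hom scW scW) // => k Jk; rewrite ct.
apply/is_scalar_mxP; exists c; apply: (@kron_inj _ _ _ m m _ _ 1%:M).
  by rewrite -mxrank_eq0 mxrank1 -lt0n.
by rewrite tc kron_scalar mulr1.
Qed.

Lemma RV x y : x \in X -> p1 x \in J -> y \in N ->
  (y ^ p1 x)%g \in N /\ V y *m R x = R x *m V (y ^ p1 x)%g.
Proof.
move=> Xx Jx Ny; have [z Xz [<- z1]] := p1_ontoN TP Ny.
have Jz : p1 z \in J by rewrite (subsetP sNJ) ?(p1N TP).
have Xzx : (z ^ x)%g \in X by rewrite groupJ.
have zx1 : p2 (z ^ x)%g = 1%g by rewrite p2J // z1 conj1g.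
rewrite -p1J // (p1N TP) //; split=> //.
by rewrite -!(extN extR) // -!(extM extR) -?conjgC // p1J // groupJ.
Qed.

(** U is recovered as Hom_N(V, U) (x) V. An element x acts on Hom_N(V, U) by h |-> R(x)^-1 h U(p1
    x); this action D is trivial when p2 x = 1, so it defines W on J'. The evaluation map Psi is
    injective by [stack_free] and surjective because U is irreducible. *)
Lemma lift_surj n (U : mx_representation F J n) (g : 'M_(m, n)) :
  mx_irreducible U -> g != 0 -> {in N, forall x, V x *m g = g *m U x} ->
  exists e (W : mx_representation F J' e) (scW : lz_scalar W),
    mx_rsim (lift_repr scW) U.
Proof.
move=> irrU nzg homg; have [e [H [frH homH]]] := hom_space N V U.
have homHi i : {in N, forall x, V x *m vec_mx (row i H) = vec_mx (row i H) *m U x}.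
  by apply/homH; rewrite vec_mxK row_sub.
pose Psi := stack H; have frP := stack_free absV frH homHi; rewrite -/Psi in frP.
have e0 : (0 < e)%N.
  have : (mxvec g <= H)%MS by apply/homH.
  case: (posnP e) => // e0; move: (H); rewrite e0 => H0.
  rewrite [H0]flatmx0 => /submx0null/(congr1 vec_mx); rewrite mxvecK linear0.
  by move/eqP; rewrite (negPf nzg).
have Dex x : x \in X -> p1 x \in J ->
    exists D : 'M_e, Psi *m U (p1 x) = kron D (R x) *m Psi.
  move=> Xx Jx; have uR := R_unit Xx Jx.
  pose H' := \matrix_i mxvec (invmx (R x) *m vec_mx (row i H) *m U (p1 x)).
  have sH' : (H' <= H)%MS.
    apply/row_subP=> i; rewrite rowK; apply/homH=> y Ny.
    have Xx' : x^-1%g \in X by rewrite groupV.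
    have Jx' : p1 x^-1%g \in J by rewrite p1V ?groupV.
    have [Nyx yE] := RV Xx' Jx' Ny.
    have VR : V y *m invmx (R x) = invmx (R x) *m V (y ^ p1 x^-1)%g.
      have RR' : R x^-1%g = invmx (R x).
        apply: (can_inj (mulKmx uR)); rewrite mulmxV //.
        by rewrite -(extM extR) // mulgV (ext1 extR).
      by rewrite -RR'.
    rewrite !mulmxA VR -!mulmxA; congr (_ *m _).
    rewrite mulmxA homHi // -mulmxA; congr (_ *m _).
    have Jy := subsetP sNJ _ Ny; have Jyx := subsetP sNJ _ Nyx.
    by rewrite -!repr_mxM // p1V // -conjgCV.
  exists (H' *m pinvmx H).
  pose H2 := \matrix_i mxvec (vec_mx (row i H) *m U (p1 x)).
  rewrite (@kron_stack _ _ _ _ _ _ _ _ _ H2) => [|i].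
    by apply: stack_mul => i; rewrite rowK mxvecK.
  by rewrite mulmxKpV // !rowK !mxvecK -!mulmxA mulKVmx.
(* Psi is injective and R x is nonzero, so D x is determined by its defining equation; the
   identities for D below are proved by comparing such equations. *)
have uniqD x (D D' : 'M_e) : x \in X -> p1 x \in J ->
    kron D (R x) *m Psi = kron D' (R x) *m Psi -> D = D'.
  by move=> Xx Jx /(row_free_inj frP)/kron_inj-> //; apply: R_neq0.
pose D x := epsilon (inhabits (0 : 'M_e))
  (fun D => Psi *m U (p1 x) = kron D (R x) *m Psi).
have hD x : x \in X -> p1 x \in J -> Psi *m U (p1 x) = kron (D x) (R x) *m Psi.
  by move=> Xx Jx; apply: (epsilon_spec (inhabits (0 : 'M_e)) _ (Dex x Xx Jx)).
have DM x y : x \in X -> y \in X -> p1 x \in J -> p1 y \in J ->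
    D (x * y)%g = D x *m D y.
  move=> Xx Xy Jx Jy; apply: (uniqD (x * y)%g); rewrite ?groupM //.
    by rewrite (p1M TP) ?groupM.
  rewrite -hD ?groupM ?(p1M TP) ?groupM // repr_mxM // mulmxA hD //.
  by rewrite -mulmxA hD // mulmxA -kronM (extM extR).
have D2 x : x \in X -> p2 x = 1%g -> D x = 1%:M.
  move=> Xx x1; have Nx := p1N TP Xx x1; have Jx := subsetP sNJ _ Nx.
  apply: (uniqD x) => //; rewrite -hD // (extN extR) //.
  pose H' := \matrix_i mxvec (V (p1 x) *m vec_mx (row i H)).
  rewrite (@kron_stack _ _ _ _ _ _ _ _ _ H') => [|i].
    by apply: stack_mul => i; rewrite rowK mxvecK homHi.
  by rewrite mul1mx rowK mxvecK.
have DE x : x \in X -> p1 x \in J -> D (sec2 (p2 x)) = D x.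
  move=> Xx Jx; have [Xs sx] := sec2P (p2K TP Xx).
  have [z [Xz z1] {2}->] := same_p2 Xs Xx sx.
  have Js : p1 (sec2 (p2 x)) \in J by case: mJ => _ _ mE; rewrite mE // sx -mE.
  have Jz := subsetP sNJ _ (p1N TP Xz z1).
  by rewrite DM // (D2 z) // mulmx1.
have secJ k : k \in J' -> [/\ sec2 k \in X, p2 (sec2 k) = k & p1 (sec2 k) \in J].
  move=> Jk; have [Xk kE] := sec2P (subsetP sJK _ Jk).
  by split=> //; case: mJ => _ _ ->; rewrite ?kE.
have Wrep : mx_repr J' (fun k => D (sec2 k)).
  split=> [|k l Jk Jl].
    by rewrite -p2_1 DE ?p1_1 // D2 // p2_1.
  have [Xk kE Jpk] := secJ k Jk; have [Xl lE Jpl] := secJ l Jl.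
  by rewrite -{1}kE -{1}lE -(p2M TP) // DE ?groupM ?(p1M TP) ?groupM // DM.
pose W := MxRepresentation Wrep.
have scW : lz_scalar W.
  move=> k z Jk Zz; have Jz := subsetP sZJ _ Zz.
  rewrite repr_mxM // -mul_mx_scalar; congr (_ *m _).
  have [x Xx [xz x1]] := p2_ontoZ TP Zz.
  have Jx : p1 x \in J by rewrite x1.
  have nzz : lz z != 0 by apply: (lz_neq0 extR).
  rewrite /= -xz DE //; apply: (uniqD x) => //.
  rewrite -hD // x1 repr_mx1 mulmx1 (extZ extR) // xz kron_scalar mulfV //.
  by rewrite mul1mx.
have homP x : x \in X -> p1 x \in J -> lift_mx W (p1 x) *m Psi = Psi *m U (p1 x).
  by move=> Xx Jx; rewrite liftE // /= DE // -hD.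
have homPJ : {in J, forall h, lift_mx W h *m Psi = Psi *m U h}.
  by move=> h Jh; have [Xh <-] := sec1P (subsetP sJA _ Jh); rewrite homP //;
    have [_ ->] := sec1P (subsetP sJA _ Jh).
exists e, W, scW; have nzP : Psi != 0.
  by rewrite -mxrank_eq0 (eqP frP) -lt0n muln_gt0 e0.
have fuP := hom_irr_full irrU nzP homPJ.
by exists Psi => //; rewrite -(eqP frP) (eqP fuP).
Qed.

(** A simple submodule S of the lift contains V by Clifford theory, so it is itself the lift of some
    simple W'. Its inclusion is t (x) 1 with t a nonzero homomorphism from W' to W, hence an
    isomorphism, and S is the whole lift. *)
Lemma lift_irr e (W : mx_representation F J' e) (scW : lz_scalar W) :
  N <| J -> mx_irreducible W -> mx_irreducible (lift_repr scW).
Proof.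
move=> nNJ irrW; have e0 := irr_deg_gt0 irrW.
have [|n [S [i [irrS nzi homi]]]] := exists_irr_sub (lift_repr scW).
  by rewrite muln_gt0 e0.
have homiN x : x \in N -> S x *m i = i *m kron 1%:M (V x).
  by move=> Nx; rewrite homi ?(subsetP sNJ) //= liftN // repr_mx1.
have [|a Sa0|g [nzg homg]] := Clifford_embed nNJ irrS absV.
- move=> j Jj; have [Xj jE] := sec1P (subsetP sJA _ Jj).
  exists (R (sec1 j)); first by rewrite R_unit ?jE.
  by move=> x Nx; have [|_] := RV Xj _ Nx; rewrite ?jE // => ->.
- apply: NNPP => /eqP nza.
  have [|b [Vb Sb]] := ker_notsub_unit (r2 := subg_repr S sNJ) absV nza => //.
  case/eqP: nzi; rewrite /= in Sb.
  have := ga_hom b homiN; rewrite Sb mul0mx => ->.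
  rewrite /ga (eq_bigr (fun x => kron 1%:M (b x *: V x))) => [|x _]; last first.
    by rewrite kronZr.
  by rewrite -kron_sumr -/(ga N V b) Vb kron1 mulmx1.
have [e' [W' [scW' simW']]] := lift_surj irrS nzg homg.
have [B [B' B'B hB]] := mx_rsim_def simW'.
pose f := B *m i.
have homf : {in J, forall x, lift_mx W' x *m f = f *m lift_mx W x}.
  move=> x Jx; have /= -> := hB x Jx.
  by rewrite /f -!mulmxA (mulmxA B') B'B mul1mx homi.
have nzf : f != 0.
  by apply: contraNneq nzi => f0; rewrite -[i]mul1mx -B'B -mulmxA -/f f0 mulmx0.
have [||t ft homt] := hom_lift scW' scW _ _ homf; rewrite ?repr_mx1 //.
have nzt : t != 0.
  apply: contraNneq nzf => t0; rewrite ft t0; apply/eqP/matrixP=> k l.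
  by rewrite !mxE mul0r.
have irrW' : mx_irreducible W'.
  by apply: lift_irr_inv; apply: mx_rsim_irr (mx_rsim_sym simW') irrS.
have [_ dim _ _] := hom_irr_rsim irrW' irrW nzt homt.
have /row_freeP[t' tt'] := hom_irr_free irrW' nzt homt.
apply: mx_rsim_irr (_ : mx_rsim S _) irrS.
apply: mx_rsim_trans (mx_rsim_sym simW') _.
exists (kron t 1%:M); first by rewrite dim.
  by apply/row_freeP; exists (kron t' 1%:M); rewrite -kronM tt' mulmx1 kron1.
exact: lift_hom.
Qed.

End Lift.

(** * Brauer characters *)

Section Brauer.

Variables (p : nat) (S : modular_system p).
Local Notation F := (msF S).
Local Notation O := (msO S).
Local Notation res := (ms_res S).
Local Notation frac := (ms_frac S).
Local Notation q := #|F|.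

Lemma q_gt1 : (1 < q)%N.
Proof. exact: finNzRing_gt1. Qed.

Lemma qE : q = q.-1.+1.
Proof. by rewrite prednK // ltnW ?q_gt1. Qed.

Lemma natq0 : q%:R = 0 :> F.
Proof. by have := expg_cardG (in_setT (1 : F)); rewrite cardsT. Qed.

Lemma expq1 (y : F) : y != 0 -> y ^+ q.-1 = 1.
Proof. by move=> nz; apply: (mulfI nz); rewrite -exprS -qE expf_card mulr1. Qed.

Lemma expq1_neq0 (R : nzRingType) (y : R) : y ^+ q.-1 = 1 -> y != 0.
Proof.
move=> y1; apply: contra_eq_neq y1 => ->; rewrite expr0n.
by rewrite -[q.-1 == _]negbK -lt0n -ltnS -qE q_gt1 /= eq_sym oner_neq0.
Qed.

Lemma expq_expq1 (R : nzRingType) (y : R) : y ^+ q.-1 = 1 -> y ^+ q = y.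
Proof. by move=> y1; rewrite qE exprS y1 mulr1. Qed.

(** The cofactor is a sum of q terms with equal residues, and q = 0 in F. Thus raising to the power
    q brings congruent elements closer together. *)
Lemma sub_expq (z w : O) : res z = res w ->
  exists2 e, res e = 0 & z ^+ q - w ^+ q = (z - w) * e.
Proof.
move=> zw; rewrite subrXX; eexists; last by [].
rewrite rmorph_sum (eq_bigr (fun=> res w ^+ q.-1)) => [|i _]; last first.
  by rewrite rmorphM !rmorphXn /= zw -exprD subnK // -ltnS -qE.
by rewrite sumr_const card_ord -mulr_natl natq0 mul0r.
Qed.

Lemma teich_uniq (z w : O) : z ^+ q = z -> w ^+ q = w -> res z = res w -> z = w.
Proof.
move=> zq wq zw; have [e e0] := sub_expq zw; rewrite zq wq => /eqP.
rewrite -subr_eq0 -{1}[z - w]mulr1 -mulrBr mulf_eq0 !subr_eq0.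
case/orP=> /eqP // e1; move/eqP: e0.
by rewrite -e1 rmorph1 oner_eq0.
Qed.

(** The Teichmuller representative is the limit of a^(q^n) for any a over y; consecutive terms agree
    modulo growing powers of t by [sub_expq]. *)
Lemma teich_exists (y : F) : exists z : O, (z ^+ q == z) && (res z == y).
Proof.
have [t [nzt nut dvr compl]] := ms_dvr S.
have [a ay] := ms_res_surj y.
have resM e : res e = 0 -> exists c, e = c * t.
  move=> e0; have [->|nze] := eqVneq e 0; first by exists 0; rewrite mul0r.
  have [u [[|n] [Uu eE]]] := dvr e nze; last first.
    by exists (u * t ^+ n); rewrite eE exprSr mulrA.
  by move/ms_res_ker: e0; rewrite eE mulr1 Uu.
have rest : res t = 0 by apply/ms_res_ker.
pose u n := a ^+ (q ^ n).
have ru n : res (u n) = y.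
  rewrite rmorphXn ay; elim: n => [|n IHn]; first by rewrite expn0 expr1.
  by rewrite expnSr exprM IHn expf_card.
have uS n : u n.+1 = u n ^+ q by rewrite /u expnSr exprM.
have step n : exists c, u n.+1 - u n = c * t ^+ n.+1.
  elim: n => [|n [c IHn]].
    have [|c cE] := resM (u 1%N - u 0%N); first by rewrite rmorphB !ru subrr.
    by exists c; rewrite cE expr1.
  have [|e /resM[d ->]] := sub_expq (z := u n.+1) (w := u n); first by rewrite !ru.
  rewrite -!uS => ->; exists (c * d); rewrite IHn [t ^+ n.+2]exprS.
  by rewrite mulrACA [t ^+ _ * t]mulrC.
have [|l lE] := compl u.
  by move=> n; have [c ->] := step n; exists (c * t); rewrite exprS mulrA.
have rl : res l = y.
  have [c] := lE 1%N => /(congr1 res); rewrite rmorphB rmorphM rmorphXn /= rest.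
  by rewrite expr0n mulr0 ru => /eqP; rewrite subr_eq0 => /eqP.
exists l; rewrite rl eqxx andbT.
have lq n : exists c, l ^+ q - l = c * t ^+ n.
  have [c cE] := lE n; have [d dE] := step n.
  have [|e _ eE] := sub_expq (z := l) (w := u n); first by rewrite ru rl.
  exists (c * e + d * t - c).
  have -> : (c * e + d * t - c) * t ^+ n = c * t ^+ n * e + d * t ^+ n.+1 - c * t ^+ n.
    by rewrite exprS; ring.
  by rewrite -dE -cE -eE uS; ring.
(* A nonzero difference would be a unit times some t^n, but it is also divisible by t^(n+1). *)
apply/eqP/eqP; rewrite -subr_eq0; apply/negPn/negP=> nz.
have [v [n [Uv vE]]] := dvr _ nz; have [c] := lq n.+1.
rewrite vE exprS mulrA => /(mulIf (expf_neq0 n nzt)) vt.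
by move: Uv; rewrite vt unitrM (negPf nut) andbF.
Qed.

Definition teich (y : F) : O := xchoose (teich_exists y).

Lemma teichq y : teich y ^+ q = teich y.
Proof. by have /andP[/eqP] := xchooseP (teich_exists y). Qed.

Lemma res_teich y : res (teich y) = y.
Proof. by have /andP[_ /eqP] := xchooseP (teich_exists y). Qed.

Lemma teich_res (z : O) : z ^+ q = z -> teich (res z) = z.
Proof. by move=> zq; apply: teich_uniq; rewrite ?teichq ?res_teich. Qed.

Lemma teichq1 y : y != 0 -> teich y ^+ q.-1 = 1.
Proof.
move=> nz; have nzt : teich y != 0.
  by apply: contraNneq nz => t0; rewrite -(res_teich y) t0 rmorph0.
by apply: (mulfI nzt); rewrite -exprS -qE teichq mulr1.
Qed.

Definition split_poly (P : {poly F}) (s : seq F) :=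
  P = \prod_(y <- s) ('X - y%:P) /\ {in s, forall y, y != 0}.

(** The roots of unity in the definition must be the Teichmuller lifts of the eigenvalues, so a
    Brauer value depends only on the multiset of eigenvalues in F. *)
Lemma brauer_valueP n (M : 'M[F]_n) v :
  brauer_value M v <->
  exists2 s, split_poly (char_poly M) s & v = frac (\sum_(y <- s) teich y).
Proof.
split=> [[t [cM t1 ->]]|[s [cM nzs] ->]]; last first.
  exists (map teich s); split; last by rewrite big_map.
    by rewrite cM big_map; apply: eq_bigr => y _; rewrite res_teich.
  by move=> _ /mapP[y sy ->]; rewrite teichq1 ?nzs.
exists (map res t).
  split; first by rewrite big_map.
  move=> _ /mapP[z tz ->]; apply: expq1_neq0.
  by rewrite -rmorphXn t1 // rmorph1.
rewrite big_map; congr (frac _); apply: eq_big_seq => z tz.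
by rewrite teich_res // expq_expq1 ?t1.
Qed.

Lemma split_poly_uniq P s1 s2 : split_poly P s1 -> split_poly P s2 -> perm_eq s1 s2.
Proof. by case=> -> _ [/prod_XsubC_eq]. Qed.

Lemma brauer_value_uniq n (M : 'M[F]_n) v w :
  brauer_value M v -> brauer_value M w -> v = w.
Proof.
move=> /brauer_valueP[s hs ->] /brauer_valueP[t ht ->]; congr (frac _).
exact: perm_big (split_poly_uniq hs ht).
Qed.

Lemma brauer_value_char_poly n1 n2 (M1 : 'M[F]_n1) (M2 : 'M[F]_n2) v :
  char_poly M1 = char_poly M2 -> brauer_value M1 v -> brauer_value M2 v.
Proof. by rewrite /brauer_value => ->. Qed.

Lemma brauer_valueD n n1 n2 (M : 'M[F]_n) (M1 : 'M[F]_n1) (M2 : 'M[F]_n2) v1 v2 :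
  char_poly M = char_poly M1 * char_poly M2 ->
  brauer_value M1 v1 -> brauer_value M2 v2 -> brauer_value M (v1 + v2).
Proof.
move=> cM /brauer_valueP[s [hs nzs] ->] /brauer_valueP[t [ht nzt] ->].
apply/brauer_valueP; exists (s ++ t); last by rewrite big_cat rmorphD.
split; first by rewrite cM hs ht big_cat.
by move=> y; rewrite mem_cat => /orP[/nzs|/nzt].
Qed.

Lemma brauer_value_tr n (M : 'M[F]_n) v :
  brauer_value M v -> exists2 a, v = frac a & res a = \tr M.
Proof.
move=> /brauer_valueP[s [hs _] ->]; eexists; first by [].
rewrite rmorph_sum /=; under eq_bigr do rewrite res_teich.
have := size_char_poly M; rewrite hs size_prod_XsubC => -[sn].
case: (posnP n) => [n0|n0].
  rewrite (size0nil (_ : size s = 0%N)) ?sn // big_nil.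
  by rewrite /mxtrace big1 // => i; have := ltn_ord i; rewrite {2}n0.
have := char_poly_trace M n0; rewrite hs (_ : n.-1 = (size s).-1); last by rewrite sn.
rewrite coefPn_prod_XsubC => [/oppr_inj//|].
by rewrite sn -lt0n.
Qed.

Section Group.

Variable gT : finGroupType.
Implicit Types (X Y N : {group gT}) (chi : bfun S gT).

(** This makes F contain the eigenvalues of the p-regular elements in every representation, so that
    every representation of X over F affords a Brauer character ([exists_affords]). *)
Definition reg_exp (X : {set gT}) :=
  {in X, forall x, p^'.-elt x -> (x ^+ q.-1 = 1)%g}.

(** Each r x is a root of X^q - X, the product of the X - a over a in F. If r x were not scalar,
    every factor r x - a would be invertible by Schur's lemma. Once all r x are scalar, every line
    is a submodule. *)
Lemma irr_abelian_deg1 X n (r : mx_representation F X n) :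
  abelian X -> {in X, forall x, (x ^+ q.-1 = 1)%g} -> mx_irreducible r -> n = 1%N.
Proof.
move=> cXX X1; case: n r => [|n] r irr; first by case/mx_irrP: irr.
have scal x : x \in X -> is_scalar_mx (r x).
  move=> Xx; apply: contraT => nscal.
  have: horner_mx (r x) ('X^q - 'X) == 0.
    have rx1 : r x ^+ q.-1 = 1 by rewrite -repr_mxX // X1 // repr_mx1.
    by rewrite rmorphB rmorphXn /= horner_mx_X qE exprS rx1 mulr1 subrr.
  apply: contraTT => nscal0; have: horner_mx (r x) ('X^q - 'X) \in unitmx.
    rewrite finField_genPoly rmorph_prod.
    apply: (big_ind (fun M : 'M_n.+1 => M \in unitmx)) => [|M1 M2 u1 u2|a _].
    - exact: unitmx1.
    - by rewrite unitmx_mul u1 u2.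
    rewrite rmorphB /= horner_mx_X horner_mx_C.
    apply: (mx_Schur irr); last first.
      rewrite subr_eq0; apply: contraNneq nscal => ->; exact: scalar_mx_is_scalar.
    apply/centgmxP=> y Xy; rewrite mulmxBl mulmxBr scalar_mxC -!repr_mxM //.
    by rewrite (centsP cXX x Xx y Xy).
  by move=> u; apply: contraTneq u => ->; rewrite unitmxE det0 unitr0.
pose M := <<delta_mx 0 0 : 'rV[F]_n.+1>>%MS.
have linM: \rank M = 1%N by rewrite genmxE mxrank_delta.
have modM: mxmodule r M.
  apply/mxmoduleP=> x Xx; have /is_scalar_mxP[a ->] := scal x Xx.
  by rewrite scalar_mxC submxMl.
apply/eqP; rewrite eq_sym -linM.
by case/mx_irrP: irr => _; apply; rewrite // -mxrank_eq0 linM.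
Qed.

Lemma split_char_poly X n (r : mx_representation F X n) x :
  x \in X -> (x ^+ q.-1 = 1)%g -> exists s, split_poly (char_poly (r x)) s.
Proof.
move=> Xx x1; have sxX : <[x]> \subset X by rewrite cycle_subG.
have xx := cycle_id x.
rewrite -[r x]/(subg_repr r sxX x); move: (subg_repr r sxX) => {}r {sxX}.
move: n r; apply: rep_ind => [n r n0|n r irr|n1 n2 n r1 r2 r _ cp [s1 [h1 nz1]] [s2 [h2 nz2]]].
- exists [::]; split=> //; rewrite big_nil /char_poly.
  by move: r; rewrite n0 => r; rewrite det_mx00.
- have n1 : n = 1%N.
    apply: irr_abelian_deg1 (cycle_abelian x) _ irr => _ /cycleP[i ->].
    by rewrite -expgM mulnC expgM x1 expg1n.
  move: r irr; rewrite n1 => r irr; exists [:: r x 0 0].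
  split; first by rewrite big_seq1 /char_poly det_mx11 !mxE eqxx.
  move=> y; rewrite inE => /eqP->; have := repr_mx_unit r xx.
  by rewrite unitmxE det_mx11 unitfE.
exists (s1 ++ s2); split; first by rewrite cp // big_cat h1 h2.
by move=> y; rewrite mem_cat => /orP[/nz1|/nz2].
Qed.

Lemma exists_affords X n (r : mx_representation F X n) :
  reg_exp X -> exists chi : bfun S gT, affords X r chi.
Proof.
move=> eX; pose P x v := if (x \in X) && p^'.-elt x then brauer_value (r x) v else v = 0.
have ex x : exists v, P x v.
  rewrite /P; case: (boolP ((x \in X) && p^'.-elt x)) => [/andP[Xx rx]|_]; last by exists 0.
  have [s hs] := split_char_poly r Xx (eX x Xx rx).
  by eexists; apply/brauer_valueP; exists s.
exists [ffun x => epsilon (inhabits 0) (P x)] => x; rewrite ffunE.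
exact: (epsilon_spec (inhabits 0) (P x) (ex x)).
Qed.

Lemma affords_uniq X n (r : gT -> 'M[F]_n) chi1 chi2 :
  affords X r chi1 -> affords X r chi2 -> chi1 = chi2.
Proof.
move=> h1 h2; apply/ffunP=> x; move: (h1 x) (h2 x).
by case: ifP => _; [apply: brauer_value_uniq | move=> -> ->].
Qed.

Lemma affords_char_poly X n1 n2 (r1 : gT -> 'M[F]_n1) (r2 : gT -> 'M[F]_n2) chi :
  {in X, forall x, char_poly (r1 x) = char_poly (r2 x)} ->
  affords X r1 chi -> affords X r2 chi.
Proof.
move=> cp h x; move: (h x); case: ifP => // /andP[Xx _].
exact: brauer_value_char_poly (cp x Xx).
Qed.

Lemma rsim_char_poly (E : fieldType) X n1 n2 (r1 : mx_representation E X n1)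
    (r2 : mx_representation E X n2) :
  mx_rsim r1 r2 -> {in X, forall x, char_poly (r1 x) = char_poly (r2 x)}.
Proof.
case=> B n12 frB hB x Xx.
have [B' BB'] := row_freeP frB.
have B'B : B' *m B = 1%:M.
  by move: r2 B frB B' BB' {hB}; rewrite -n12 => _ B _ B' /mulmx1C.
have := @char_poly_block E n1 0 n2 (r1 x) 1%:M (r2 x) B 0 0 B' (hB x Xx).
rewrite [X in _ = _ * X](_ : _ = 1) ?mulr1; last by rewrite /char_poly det_mx00.
move=> -> //; rewrite ?mulmx0 ?mul0mx ?addr0 //.
by split=> //; apply/matrixP=> [] [].
Qed.

Lemma char_poly_simmx (E : fieldType) n (A B C : 'M[E]_n) :
  C \in unitmx -> C *m A = B *m C -> char_poly A = char_poly B.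
Proof.
move=> uC h.
have := @char_poly_block E n 0 n B 1%:M A C 0 0 (invmx C) (esym h).
rewrite [X in _ = _ * X](_ : _ = 1) ?mulr1; last by rewrite /char_poly det_mx00.
move=> -> //; rewrite ?mulmx0 ?mul0mx ?addr0 ?mulVmx //.
by split=> //; rewrite ?mulmxV // ?mul0mx //; apply/matrixP=> [] [].
Qed.

Lemma affords_rsim X n1 n2 (r1 : mx_representation F X n1)
    (r2 : mx_representation F X n2) chi :
  mx_rsim r1 r2 -> affords X r1 chi -> affords X r2 chi.
Proof. by move=> sim; apply: affords_char_poly; apply: rsim_char_poly. Qed.

Lemma affords_sub X Y n (r : gT -> 'M[F]_n) chi :
  Y \subset X -> affords X r chi -> affords Y r (bres Y chi).
Proof.
move=> sYX h x; rewrite ffunE; case: (boolP (x \in Y)) => [Yx|]//=.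
by have := h x; rewrite (subsetP sYX).
Qed.

(** On each composition factor for the cyclic group of x the p-part of x acts trivially, since a
    normal p-subgroup lies in the kernel of every simple module in characteristic p. *)
Lemma char_poly_constt X n (r : mx_representation F X n) x :
  x \in X -> char_poly (r x) = char_poly (r x.`_p^')%g.
Proof.
move=> Xx; have sxX : <[x]> \subset X by rewrite cycle_subG.
suff: char_poly (subg_repr r sxX x) = char_poly (subg_repr r sxX x.`_p^'%g) by [].
move: (subg_repr r sxX) => {}r {sxX}; have xx := cycle_id x.
have xx' : x.`_p^'%g \in <[x]>%g by rewrite mem_cycle.
have xxp : x.`_p%g \in <[x]>%g by rewrite mem_cycle.
move: n r; apply: rep_ind => [n r n0|n r irr|n1 n2 n r1 r2 r _ cp h1 h2].
- by move: r; rewrite n0 => r; rewrite /char_poly !det_mx00.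
- have := pcore_sub_rker_mx_irr_pchar (ms_pcharF S) irr.
  move/subsetP/(_ x.`_p%g); have: x.`_p%g \in 'O_p(<[x]>).
    apply: (subsetP (pcore_max _ _) _ (cycle_id _)).
      exact: p_elt_constt.
    by rewrite -sub_abelian_normal ?cycle_abelian // cycle_subG.
  move=> Op /(_ Op) /rkerP[_ rp].
  by rewrite -[r x.`_p^'%g]mul1mx -rp -repr_mxM // consttC.
by rewrite !cp // h1 h2.
Qed.

Lemma mxtrace_constt X n (r : mx_representation F X n) x :
  x \in X -> \tr (r x) = \tr (r x.`_p^')%g.
Proof.
move=> Xx; case: (posnP n) => [n0|n0].
  by move: r; rewrite n0 => r; rewrite /mxtrace !big_ord0.
apply: oppr_inj; rewrite -!char_poly_trace //.
by rewrite char_poly_constt.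
Qed.

Lemma affords_tr X n (r : mx_representation F X n) chi x :
  affords X r chi -> x \in X ->
  exists2 a, chi x.`_p^'%g = frac a & res a = \tr (r x).
Proof.
move=> h Xx; have := h x.`_p^'%g.
have Xx' : x.`_p^'%g \in X by rewrite groupX.
rewrite Xx' p_elt_constt => /brauer_value_tr[a aE ra].
by exists a => //; rewrite ra -mxtrace_constt.
Qed.

(** By [not_rsim_unit] some element of the group algebra acts as 1 on r i and as 0 on the other
    modules. Multiplied by an element acting on r i as a diagonal matrix unit, which has trace 1, it
    isolates c i. *)
Lemma IBr_tr_indep X (I : eqType) (s : seq I) (n : I -> nat)
    (r : forall i, mx_representation F X (n i)) (c : I -> F) :
  {in s, forall i, mx_absolutely_irreducible (r i)} -> uniq s ->
  {in s &, forall i j, i != j -> ~ mx_rsim (r i) (r j)} ->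
  {in X, forall x, \sum_(i <- s) c i * \tr (r i x) = 0} ->
  {in s, forall i, c i = 0}.
Proof.
move=> absr us nsim s0 i si.
have trga j a : \tr (ga X (r j) a) = \sum_(x in X) a x * \tr (r j x).
  by rewrite /ga raddf_sum; apply: eq_bigr => x _; rewrite /= mxtraceZ.
have key a : \sum_(j <- s) c j * \tr (ga X (r j) a) = 0.
  under eq_bigr do rewrite trga mulr_sumr.
  rewrite exchange_big big1 //= => x Xx.
  under eq_bigr do rewrite mulrCA.
  by rewrite -mulr_sumr s0 // mulr0.
have sep (t : seq I) : {subset t <= s} -> i \notin t ->
    exists a, ga X (r i) a = 1%:M /\ {in t, forall j, ga X (r j) a = 0}.
  elim: t => [|j t IHt] sts nit.
    by have [a ha] := ga_delta F (group1 X); exists a; rewrite ha repr_mx1.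
  move: nit; rewrite inE negb_or => /andP[nij nit].
  have [|a [ai aj]] := IHt _ nit; first by move=> k tk; rewrite sts // inE tk orbT.
  have sj : j \in s by rewrite sts // inE eqxx.
  have nji : ~ mx_rsim (r j) (r i) by apply: nsim => //; rewrite eq_sym.
  have [b [bi bj]] := not_rsim_unit (absr i si) (mx_abs_irrW (absr j sj)) nji.
  have [d hd] := ga_mul X a b; exists d; rewrite !hd ai bi mulmx1; split=> // k.
  rewrite hd inE => /predU1P[->|tk]; first by rewrite bj mulmx0.
  by rewrite aj // mul0mx.
have [||a [ai aj]] := sep (rem i s); first by move=> j /mem_rem.
  by rewrite mem_rem_uniq // inE eqxx.
have n0 : (0 < n i)%N by case: (mx_abs_irrP (absr i si)).
pose i0 := Ordinal n0; have [b bE] := ga_full (delta_mx i0 i0) (absr i si).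
have [d hd] := ga_mul X a b; have := key d.
rewrite (perm_big _ (perm_to_rem si)) big_cons /= big_seq big1 => [|j sj].
  rewrite hd ai mul1mx -bE addr0 /mxtrace (bigD1 i0) //= big1 => [|k /negPf nk].
    by rewrite addr0 !mxE !eqxx mulr1.
  by rewrite mxE nk.
by rewrite hd aj // mul0mx mxtrace0 mulr0.
Qed.

Lemma IBr_rsim X n1 n2 (r1 : mx_representation F X n1)
    (r2 : mx_representation F X n2) chi :
  mx_absolutely_irreducible r1 -> mx_absolutely_irreducible r2 ->
  affords X r1 chi -> affords X r2 chi -> mx_rsim r1 r2.
Proof.
move=> abs1 abs2 h1 h2; apply: NNPP => nsim.
pose n (b : bool) := if b then n1 else n2.
pose r (b : bool) : mx_representation F X (n b) := if b return
  mx_representation F X (if b then n1 else n2) then r1 else r2.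
pose c (b : bool) : F := if b then 1 else -1.
suff: c true = 0 by move/eqP; rewrite oner_eq0.
apply: (@IBr_tr_indep X bool [:: true; false] n r c) => // [[] //||x Xx].
  by move=> [] [] //= _ _ _ sim; apply: nsim => //; apply: mx_rsim_sym.
rewrite !big_cons big_nil /= addr0 mul1r mulN1r.
have [a aE <-] := affords_tr h1 Xx; have [b bE <-] := affords_tr h2 Xx.
have /ms_frac_inj-> : frac a = frac b by rewrite -aE -bE.
by rewrite subrr.
Qed.

Lemma bfunMz (psi : bfun S gT) (c : int) x : (psi *~ c) x = psi x *~ c.
Proof. by case: c => k; rewrite /intmul ?ffunE ffunMnE. Qed.

(** Reducing an integral relation to F gives a relation between traces, so every coefficient is
    divisible by p. As K has characteristic 0 the relation can be divided by p, and descent on the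
    sum of absolute values ends at zero. *)
Lemma IBr_int_indep X (u : seq (bfun S gT)) (c : bfun S gT -> int) :
  group_splitting_field F X -> uniq u -> {in u, forall psi, IBr X psi} ->
  \sum_(psi <- u) psi *~ c psi = 0 -> {in u, forall psi, c psi = 0}.
Proof.
move=> splitX uu IBru.
pose rp0 := existT (fun n => mx_representation F X n) _ (regular_repr F X).
pose good psi (nr : {n & mx_representation F X n}) :=
  mx_irreducible (projT2 nr) /\ affords X (projT2 nr) psi.
pose rp psi := epsilon (inhabits rp0) (good psi).
have rpP psi : psi \in u -> good psi (rp psi).
  move=> upsi; apply: (epsilon_spec (inhabits rp0)).
  by have [n [r [irr aff]]] := IBru psi upsi; exists (existT _ n r).
have rp_tr x : x \in X -> exists2 b : bfun S gT -> O,
    {in u, forall psi : bfun S gT, psi x.`_p^'%g = frac (b psi)} &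
    {in u, forall psi, res (b psi) = \tr (projT2 (rp psi) x)}.
  move=> Xx; pose P psi b := (psi : bfun S gT) x.`_p^'%g = frac b /\
    res b = \tr (projT2 (rp psi) x).
  have bP psi : psi \in u -> P psi (epsilon (inhabits 0) (P psi)).
    move=> upsi; apply: (epsilon_spec (inhabits 0)); have [_ aff] := rpP psi upsi.
    by have [b ? ?] := affords_tr aff Xx; exists b.
  by exists (fun psi => epsilon (inhabits 0) (P psi)) => psi /bP[].
have dvd (d : bfun S gT -> int) : \sum_(psi <- u) psi *~ d psi = 0 ->
    {in u, forall psi, (p %| d psi)%Z}.
  move=> d0 psi upsi; rewrite (dvdz_pcharf (ms_pcharF S)); apply/eqP.
  apply: (@IBr_tr_indep X _ u _ (fun psi => projT2 (rp psi)) (fun psi => (d psi)%:~R)) upsi => //.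
  - by move=> psi' upsi'; apply: splitX; case: (rpP psi' upsi').
  - move=> i j ui uj /eqP nij sim; apply: nij.
    have [_ affi] := rpP i ui; have [_ affj] := rpP j uj.
    exact: affords_uniq (affords_rsim sim affi) affj.
  move=> x Xx; have [b bE br] := rp_tr x Xx.
  have: frac (\sum_(psi <- u) b psi *~ d psi) = 0.
    move/ffunP/(_ x.`_p^'%g): d0; rewrite sum_ffunE ffunE => d0.
    rewrite -[RHS]d0 rmorph_sum; apply: eq_big_seq => psi' upsi'.
    by rewrite rmorphMz -bE // bfunMz.
  rewrite -(rmorph0 frac) => /ms_frac_inj/(congr1 res).
  rewrite rmorph0 => e0; rewrite -[RHS]e0 rmorph_sum; apply: eq_big_seq => psi' upsi'.
  by rewrite /= rmorphMz br // mulrzl.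
have [k] := ubnP (\sum_(psi <- u) `|c psi|)%N; elim: k c => // k IHk c ltck c0.
pose c' psi := (c psi %/ p)%Z.
have cE : {in u, forall psi, c psi = c' psi * p}.
  by move=> psi upsi; rewrite divzK // dvd.
have p_pr := pcharf_prime (ms_pcharF S).
have c'0 : \sum_(psi <- u) psi *~ c' psi = 0.
  apply/ffunP=> x; rewrite ffunE; apply: (@mulIf _ p%:R).
    by rewrite ((pcharf0P _).1 (@ms_pcharK _ S)) -lt0n prime_gt0.
  move/ffunP/(_ x): c0; rewrite ffunE mul0r => <-.
  rewrite !sum_ffunE mulr_suml; apply: eq_big_seq => psi upsi.
  by rewrite !bfunMz [in RHS]cE // mulrzA -[RHS]mulr_natr.
have sumE : (\sum_(psi <- u) `|c psi| = p * \sum_(psi <- u) `|c' psi|)%N.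
  rewrite big_distrr /=; apply: eq_big_seq => psi upsi.
  by rewrite [in LHS]cE // abszM mulnC.
have [s0|s0] := posnP (\sum_(psi <- u) `|c' psi|)%N.
  move=> psi upsi; apply/eqP; rewrite -absz_eq0 -leqn0.
  by move: sumE; rewrite s0 muln0 (perm_big _ (perm_to_rem upsi)) big_cons => <-; apply: leq_addr.
have {}IHk := IHk c' _ c'0; move=> psi upsi; rewrite cE // IHk ?mul0r //.
apply: leq_trans (_ : (\sum_(psi <- u) `|c psi|)%N <= k)%N; last by rewrite -ltnS.
by rewrite sumE -[X in (X < _)%N]mul1n ltn_pmul2r // prime_gt1.
Qed.

Lemma affords_sum X n (r : mx_representation F X n) chi :
  reg_exp X -> affords X r chi ->
  exists2 s : seq (bfun S gT), chi = \sum_(psi <- s) psi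
    & {in s, forall psi, exists n1 (r1 : mx_representation F X n1),
        [/\ mx_irreducible r1, affords X r1 psi
          & forall a, ga X r a = 0 -> ga X r1 a = 0]}.
Proof.
move=> eX; move: n r chi.
apply: rep_ind => [n r n0|n r irr|n1 n2 n r1 r2 r kr cp h1 h2] chi aff.
- exists [::] => //; rewrite big_nil; apply/ffunP=> x; rewrite ffunE.
  have := aff x; case: ifP => // _ /brauer_valueP[s [hs _] ->].
  have: size s = 0%N.
    by apply: succn_inj; rewrite -(size_prod_XsubC s (fun y => y)) -hs size_char_poly n0.
  by move/size0nil=> ->; rewrite big_nil rmorph0.
- exists [:: chi]; first by rewrite big_seq1.
  by move=> psi; rewrite inE => /eqP->; exists n, r.
have [chi1 aff1] := exists_affords r1 eX; have [chi2 aff2] := exists_affords r2 eX.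
have [s1 s1E s1P] := h1 _ aff1; have [s2 s2E s2P] := h2 _ aff2.
exists (s1 ++ s2).
  rewrite big_cat -s1E -s2E; apply: (affords_uniq aff) => x.
  have := aff1 x; have := aff2 x; rewrite ffunE; case: ifP => [/andP[Xx _]|_ -> ->].
    by move=> v2 v1; apply: brauer_valueD v1 v2; apply: cp.
  by rewrite addr0.
move=> psi; rewrite mem_cat => /orP[/s1P|/s2P] [d [r' [irr' aff' kr']]].
  by exists d, r'; split=> // a /kr[/kr'].
by exists d, r'; split=> // a /kr[_ /kr'].
Qed.

(** Independence over the integers shows that theta occurs among the characters of the composition
    factors of r, so one of these factors is isomorphic to V. The conclusion is the form in which
    [Clifford_embed] takes this fact. *)
Lemma constituent_ker X n (r : mx_representation F X n) m
    (V : mx_representation F X m) theta eta psi :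
  group_splitting_field F X -> reg_exp X -> mx_irreducible V ->
  affords X V theta -> affords X r eta -> brauer_char X psi -> eta = theta + psi ->
  forall a, ga X r a = 0 -> ga X V a = 0.
Proof.
move=> splitX eX irrV affV affr [d [r' affr']] etaE a ra0.
have [s sE sP] := affords_sum eX affr; have [t tE tP] := affords_sum eX affr'.
have IBrs : {in s ++ theta :: t, forall chi, IBr X chi}.
  move=> chi; rewrite mem_cat inE => /orP[/sP|/predU1P[->|/tP]].
  - by case=> n1 [r1 [irr1 aff1 _]]; exists n1, r1.
  - by exists m, V.
  - by case=> n1 [r1 [irr1 aff1 _]]; exists n1, r1.
pose c chi : int := (count_mem chi s)%:Z - (count_mem chi (theta :: t))%:Z.
have sumc (l : seq (bfun S gT)) (u : seq (bfun S gT)) : uniq u -> {subset l <= u} ->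
    \sum_(chi <- u) chi *+ count_mem chi l = \sum_(chi <- l) chi.
  move=> uu; elim: l => [|chi l IHl] slu.
    by rewrite big_nil big1.
  rewrite big_cons -IHl => [|y ly]; last by rewrite slu // inE ly orbT.
  have uchi : chi \in u by rewrite slu // inE eqxx.
  under eq_bigr do rewrite /= mulrnDr.
  rewrite big_split /= (bigD1_seq chi) //= eqxx mulr1n big1 ?addr0 // => y nyc.
  by rewrite eq_sym (negPf nyc).
have [u uu su] : exists2 u, uniq u & u =i s ++ theta :: t.
  by exists (undup (s ++ theta :: t)); [exact: undup_uniq | exact: mem_undup].
have thu : theta \in u by rewrite su mem_cat inE eqxx orbT.
have: c theta = 0.
  apply: (IBr_int_indep splitX uu) thu => [chi|].
    by rewrite su; apply: IBrs.
  under eq_bigr do rewrite mulrzBr -!pmulrn.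
  rewrite sumrB !sumc // => [|y|y].
  - by rewrite big_cons -sE -tE etaE subrr.
  - by rewrite su mem_cat => ->; rewrite orbT.
  - by rewrite su mem_cat => ->.
move/eqP; rewrite subr_eq0 eqz_nat /= eqxx => /eqP cE.
have : theta \in s by rewrite -has_pred1 has_count cE.
case/sP=> n1 [r1 [irr1 aff1 kr1]].
have [B [B' B'B hB]] := mx_rsim_def (IBr_rsim (splitX _ _ irrV) (splitX _ _ irr1) affV aff1).
have homB : {in X, forall x, V x *m B = B *m r1 x}.
  by move=> x Xx; rewrite hB // -!mulmxA B'B mulmx1.
have := ga_hom a homB; rewrite kr1 // mulmx0 => VB0.
have /row_freeP[C BC] : row_free B.
  have m0 := irr_deg_gt0 irrV; case: (classic (B = 0)) => [B0|/eqP nzB].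
    have := hB 1%g (group1 X); rewrite B0 !mul0mx repr_mx1 => /eqP.
    by rewrite -mxrank_eq0 mxrank1 eqn0Ngt m0.
  exact: hom_irr_free irrV nzB homB.
by rewrite -[LHS]mulmx1 -BC mulmxA VB0 mul0mx.
Qed.

Lemma hom_over X n (r : mx_representation F X n) m
    (V : mx_representation F X m) theta chi (g : 'M_(m, n)) :
  reg_exp X -> mx_irreducible V -> affords X V theta -> affords X r chi ->
  g != 0 -> {in X, forall x, V x *m g = g *m r x} ->
  exists psi : bfun S gT, brauer_char X psi /\ chi = theta + psi.
Proof.
move=> eX irrV affV aff nzg homg; pose U := <<g>>%MS.
have modU : mxmodule r U.
  by apply/mxmoduleP=> x Xx; rewrite (eqmxMr _ (genmxE _)) genmxE -homg // submxMl.
have sgU : (g <= U)%MS by rewrite genmxE.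
have frg := hom_irr_free irrV nzg homg.
have sim : mx_rsim V (submod_repr modU).
  exists (in_submod U g); first by rewrite genmxE (eqP frg).
    by rewrite -row_leq_rank mxrank_in_submod // (eqP frg).
  by move=> x Xx; rewrite -in_submodJ // -homg // [in RHS]in_submodE in_submodE mulmxA.
have [i [pr [s [t [hi hp ist ti]]]]] := submod_split modU.
have [psi affp] := exists_affords (factmod_repr modU) eX.
exists psi; split; first by exists _, (factmod_repr modU).
apply: (affords_uniq aff) => x; have := affp x; have := affords_rsim sim affV x.
rewrite ffunE; case: ifP => [/andP[Xx _]|_ -> ->]; last by rewrite addr0.
by apply: brauer_valueD; apply: char_poly_block (hi x Xx) (hp x Xx) ist ti.
Qed.

End Group.

End Brauer.

Lemma char_poly_scalar (E : fieldType) n (a : E) :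
  char_poly (a%:M : 'M_n) = ('X - a%:P) ^+ n.
Proof.
by rewrite /char_poly /char_poly_mx map_scalar_mx -raddfB det_scalar.
Qed.

Lemma brauer_value_scalar p (S : modular_system p) n (a : msF S) v :
  brauer_value (a%:M : 'M_1) v -> brauer_value (a%:M : 'M_n) (v *+ n).
Proof.
move=> v1; elim: n => [|n IHn].
  apply/brauer_valueP; exists [::]; last by rewrite big_nil rmorph0.
  by rewrite char_poly_scalar; split; rewrite ?big_nil.
rewrite mulrS; apply: brauer_valueD v1 IHn.
by rewrite !char_poly_scalar expr1 exprS.
Qed.

(** * Modules that afford an irreducible Brauer character *)

Section AffordsIrreducible.

Variables (p : nat) (S : modular_system p) (gT : finGroupType).
Local Notation F := (msF S).
Implicit Types (X : {group gT}) (chi : bfun S gT).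

Lemma affords_deg X n1 n2 (r1 : mx_representation F X n1)
    (r2 : mx_representation F X n2) chi :
  affords X r1 chi -> affords X r2 chi -> n1 = n2.
Proof.
have v1 : brauer_value (1%:M : 'M[F]_1) 1.
  apply/brauer_valueP; exists [:: 1].
    split; first by rewrite char_poly_scalar expr1 big_seq1.
    by move=> y; rewrite inE => /eqP->; apply: oner_neq0.
  rewrite big_seq1 -(rmorph1 (ms_res S)) teich_res ?rmorph1 //.
  by rewrite expr1n.
have val n (r : mx_representation F X n) : affords X r chi -> chi 1%g = n%:R.
  move=> /(_ 1%g); rewrite group1 /p_elt order1 /= repr_mx1 => h.
  exact: brauer_value_uniq h (brauer_value_scalar n v1).
move=> /val h1 /val; rewrite h1 => /eqP.
have charK := (pcharf0P (msK S)).1 (@ms_pcharK _ S).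
wlog le12 : n1 n2 {r1 r2 h1} / (n1 <= n2)%N => [W|].
  by case: (leqP n1 n2) => [|/ltnW] le; [apply: W | rewrite eq_sym => /W-> ].
rewrite eq_sym -subr_eq0 -natrB // charK subn_eq0 => le21.
by apply/eqP; rewrite eqn_leq le12.
Qed.

Lemma mxtrace_split n1 n2 n (A : 'M[F]_n1) (B : 'M[F]_n2) (C : 'M[F]_n)
    (i : 'M_(n1, n)) (pr : 'M_(n, n2)) (s : 'M_(n2, n)) (t : 'M_(n, n1)) :
  A *m i = i *m C -> C *m pr = pr *m B -> i *m t = 1%:M -> s *m pr = 1%:M ->
  t *m i + pr *m s = 1%:M -> \tr C = \tr A + \tr B.
Proof.
move=> hA hB it sp ti; rewrite -[C]mulmx1 -ti mulmxDr mxtraceD; congr (_ + _).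
  by rewrite mulmxA mxtrace_mulC mulmxA -hA -mulmxA it mulmx1.
by rewrite mulmxA hB -mulmxA mxtrace_mulC -mulmxA sp mulmx1.
Qed.

(** The composition factors of r have smaller dimension than W, so each is separated from W by some
    element. The product of these elements acts as 1 on W and as 0 on every factor of r, so all its
    multiples have trace 0 on r. *)
Lemma small_rep_separated X m (W : mx_representation F X m) n
    (r : mx_representation F X n) :
  mx_absolutely_irreducible W -> (n < m)%N ->
  exists a, ga X W a = 1%:M /\ forall b, \tr (ga X r a *m ga X r b) = 0.
Proof.
move=> absW; have [k] := ubnP n; elim: k n r => // k IH n r ltnk ltnm.
have [irr|[n0|[n1 [n2 [r1 [r2 [i [pr [s [t H]]]]]]]]]] := rep_split r.
- have nsim : ~ mx_rsim r W by case=> B nm _ _; move: ltnm; rewrite {1}nm ltnn.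
  have [a [Wa ra]] := not_rsim_unit absW irr nsim.
  by exists a; split=> // b; rewrite ra mul0mx mxtrace0.
- have [a ha] := ga_delta F (group1 X); exists a; rewrite ha repr_mx1; split=> // b.
  by rewrite /mxtrace big1 // => j; have := ltn_ord j; rewrite {2}n0.
case: H => _ n1n _ n2n [hi hp [_ it sp _] ti].
have [|a1 [W1 h1]] := IH n1 r1 _ (ltn_trans n1n ltnm).
  by apply: leq_trans n1n _; rewrite -ltnS.
have [|a2 [W2 h2]] := IH n2 r2 _ (ltn_trans n2n ltnm).
  by apply: leq_trans n2n _; rewrite -ltnS.
have [a ha] := ga_mul X a1 a2; exists a; split; first by rewrite ha W1 W2 mulmx1.
move=> b; have [c hc] := ga_mul X a b; rewrite -hc.
rewrite (mxtrace_split (ga_hom c hi) (ga_hom c hp) it sp ti) !hc !ha.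
have [d hd] := ga_mul X a2 b; have [d' hd'] := ga_mul X b a1.
by rewrite -mulmxA -hd h1 mxtrace_mulC mulmxA -hd' mxtrace_mulC h2 addr0.
Qed.

(** Irreducibility of r is part of what is proved, so the lemma applies directly to twisted modules
    and to restrictions of projective representations. W and r have equal traces; if r were
    reducible, its pieces would be smaller than W, and [small_rep_separated] would give a matrix
    unit on W the trace 0. *)
Lemma affords_IBr_rsim X m (W : mx_representation F X m) n
    (r : mx_representation F X n) chi :
  mx_absolutely_irreducible W -> affords X W chi -> affords X r chi -> mx_rsim W r.
Proof.
move=> absW affW affr; have nm := affords_deg affr affW.
have tr c : \tr (ga X W c) = \tr (ga X r c).
  rewrite /ga !raddf_sum; apply: eq_bigr => x Xx; rewrite /= !mxtraceZ; congr (_ * _).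
  have [a aE <-] := affords_tr affW Xx; have [b bE <-] := affords_tr affr Xx.
  by have /ms_frac_inj-> : ms_frac S a = ms_frac S b by rewrite -aE -bE.
have [m0 _] := mx_abs_irrP absW; pose i0 := Ordinal m0.
have [b bE] := ga_full (delta_mx i0 i0) absW.
have absurd a : ga X W a = 1%:M -> \tr (ga X r a *m ga X r b) = 0 -> False.
  have [c hc] := ga_mul X a b; rewrite -hc -tr hc => -> /eqP.
  rewrite mul1mx -bE /mxtrace (bigD1 i0) //= big1 => [|j /negPf nj].
    by rewrite mxE !eqxx addr0 oner_eq0.
  by rewrite mxE nj.
have [irr|[n0|[n1 [n2 [r1 [r2 [i [pr [s [t H]]]]]]]]]] := rep_split r.
- apply: NNPP => nsim.
  have {}nsim : ~ mx_rsim r W by move=> h; apply: nsim; apply: mx_rsim_sym.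
  have [a [Wa ra]] := not_rsim_unit absW irr nsim.
  by apply: (absurd a Wa); rewrite ra mul0mx mxtrace0.
- by exfalso; move: (m0); rewrite -nm n0.
case: H => _ n1n _ n2n [hi hp [_ it sp _] ti].
have [|a1 [W1 h1]] := small_rep_separated r1 absW _; first by rewrite -nm.
have [|a2 [W2 h2]] := small_rep_separated r2 absW _; first by rewrite -nm.
have [a ha] := ga_mul X a1 a2; case: (absurd a); first by rewrite ha W1 W2 mulmx1.
have [c hc] := ga_mul X a b; rewrite -hc.
rewrite (mxtrace_split (ga_hom c hi) (ga_hom c hp) it sp ti) !hc !ha.
have [d hd] := ga_mul X a2 b; have [d' hd'] := ga_mul X b a1.
by rewrite -mulmxA -hd h1 mxtrace_mulC mulmxA -hd' mxtrace_mulC h2 addr0.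
Qed.

End AffordsIrreducible.

(** * Twisting characters and modules by Galois automorphisms and group elements *)

Section Twist.

Variables (p : nat) (S : modular_system p) (Gam : galois_group S).
Local Notation F := (msF S).
Local Notation res := (ms_res S).
Local Notation frac := (ms_frac S).
Local Notation q := #|F|.

Lemma gal_K_frac (s : Gam) z : z ^+ q = z ->
  gal_K s (frac z) = frac (teich (gal_F s (res z))).
Proof.
move=> zq; have [b bE] := gal_KO s z; rewrite bE (gal_FE bE) teich_res //.
by apply: (@ms_frac_inj _ S); rewrite rmorphXn -bE -!rmorphXn zq.
Qed.

Lemma gal_K1 x : gal_K (1%g : Gam) x = x.
Proof. by apply: (fmorph_inj (gal_K (1%g : Gam))); rewrite -gal_KM mulg1. Qed.

Lemma gal_FM (s t : Gam) y : gal_F (s * t)%g y = gal_F t (gal_F s y).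
Proof.
have [a <-] := ms_res_surj y; have [b bE] := gal_KO s a.
have [c cE] := gal_KO t b; rewrite (gal_FE bE) (gal_FE cE).
by apply: gal_FE; rewrite gal_KM bE.
Qed.

Lemma gal_F1 y : gal_F (1%g : Gam) y = y.
Proof. by apply: (fmorph_inj (gal_F (1%g : Gam))); rewrite -gal_FM mulg1. Qed.

Lemma gal_FK (s : Gam) : cancel (gal_F s) (gal_F s^-1%g).
Proof. by move=> y; rewrite -gal_FM mulgV gal_F1. Qed.

Lemma brauer_value_gal n (M : 'M[F]_n) v (s : Gam) :
  brauer_value M v -> brauer_value (map_mx (gal_F s) M) (gal_K s v).
Proof.
move=> /brauer_valueP[t [tE nzt] ->]; apply/brauer_valueP.
exists (map (gal_F s) t); last first.
  rewrite !rmorph_sum big_map; apply: eq_bigr => y _.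
  by rewrite gal_K_frac ?teichq // res_teich.
split; last by move=> _ /mapP[y ty ->]; rewrite fmorph_eq0 nzt.
rewrite -map_char_poly tE rmorph_prod big_map; apply: eq_bigr => y _.
by rewrite /= map_polyXsubC.
Qed.

Variable gT : finGroupType.
Implicit Types (X Y N : {group gT}) (chi : bfun S gT) (a b : (Gam * gT)%type).

Lemma pact_mx_repr X n (r : mx_representation F X n) a :
  mx_repr (X :^ a.2)%g (pact a r).
Proof.
split=> [|x y Xx Xy]; first by rewrite /pact conj1g repr_mx1 map_mx1.
by rewrite /pact conjMg repr_mxM -?mem_conjg // map_mxM.
Qed.

Definition pact_repr X n (r : mx_representation F X n) a :=
  @MxRepresentation _ _ (X :^ a.2)%G _ _ (pact_mx_repr r a).

Lemma pact_irr X n (r : mx_representation F X n) a :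
  mx_irreducible r -> mx_irreducible (pact_repr r a).
Proof.
case/mx_irrP=> n0 irr; apply/mx_irrP; split=> // U modU nzU.
rewrite -(row_full_map (gal_F a.1^-1%g)); apply: irr.
  apply/mxmoduleP=> x Xx.
  have Xxa : (x ^ a.2)%g \in (X :^ a.2)%g by rewrite memJ_conjg.
  have := mxmoduleP modU _ Xxa; rewrite /= /pact conjgK.
  rewrite -(map_submx (gal_F a.1^-1%g)) map_mxM -map_mx_comp.
  rewrite (@map_mx_id _ _ _ (gal_F a.1^-1%g \o gal_F a.1)) //.
  exact: gal_FK.
by rewrite map_mx_eq0.
Qed.

Lemma affords_pact X n (r : gT -> 'M[F]_n) chi a :
  affords X r chi -> affords (X :^ a.2)%G (pact a r) (bact a chi).
Proof.
move=> h x; rewrite ffunE /= mem_conjg; have := h (x ^ a.2^-1)%g.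
rewrite p_eltJ; case: ifP => _; first exact: brauer_value_gal.
by move=> ->; rewrite rmorph0.
Qed.

Lemma bactM a b chi : bact b (bact a chi) = bact (a * b)%g chi.
Proof. by apply/ffunP=> x; rewrite !ffunE /= gal_KM invMg conjgM. Qed.

Lemma bact1 chi : bact (1%g : Gam * gT) chi = chi.
Proof. by apply/ffunP=> x; rewrite !ffunE /= gal_K1 invg1 conjg1. Qed.

Lemma bact_inj a : injective (@bact _ _ Gam gT a).
Proof. by move=> c1 c2 /(congr1 (bact a^-1%g)); rewrite !bactM mulgV !bact1. Qed.

Lemma bact_split (s : Gam) (g : gT) chi :
  bact (1%g : Gam, g) chi = bact (s, 1%g) chi <-> bact (s^-1%g, g) chi = chi.
Proof.
have E : (s^-1%g, g) = ((1%g, g) * (s^-1, 1))%g :> Gam * gT.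
  by congr pair; rewrite /= ?mul1g ?mulg1.
have E1 : ((s, 1) * (s^-1, 1))%g = 1%g :> Gam * gT.
  by congr pair; rewrite /= ?mulgV ?mulg1.
rewrite E -bactM; split=> [->|h]; first by rewrite bactM E1 bact1.
by apply: (@bact_inj (s^-1%g, 1%g)); rewrite h bactM E1 bact1.
Qed.

Lemma orb_stabP (B X : {group gT}) chi : reflect
  {in B, forall g, (X :^ g)%g = X /\ exists s : Gam, bact (s, g) chi = chi}
  (orb_stab Gam B X chi == B).
Proof.
apply: (iffP eqP) => [<- g|h].
  rewrite inE => /and3P[_ /eqP-> /existsP[s /eqP/bact_split h]]; split=> //.
  by exists s^-1%g.
apply/setP=> g; rewrite inE; case: (boolP (g \in B)) => //= Bg.
have [-> [s sE]] := h g Bg; rewrite eqxx /=; apply/existsP; exists s^-1%g.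
by apply/eqP/bact_split; rewrite invgK.
Qed.

(** A splitting field of a cyclic p'-group contains a primitive root of unity of its order, which
    therefore divides q - 1. *)
Lemma splits_reg_exp (A : {group gT}) : splits S A -> reg_exp S A.
Proof.
move=> splA x Ax rx; have sxA : <[x]> \subset A by rewrite cycle_subG.
have [_ splx] := splA <[x]>%G sxA.
have p'x : [pchar F]^'.-group <[x]>.
  by rewrite /pgroup (eq_pnat _ (eq_negn (pcharf_eq (ms_pcharF S)))).
have := splitting_cyclic_primitive_root_pchar (cycle_cyclic x) p'x splx.
move/(_ (x ^+ q.-1 == 1)%g) => h; apply/eqP/h => -[z prz].
rewrite -order_dvdn (prim_order_dvd prz) expq1 //.
by rewrite (prim_root_eq0 prz) -lt0n order_gt0.
Qed.

End Twist.

(** * Relative projectivity *)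

Section RelativeProjectivity.

Variables (p : nat) (S : modular_system p) (gT : finGroupType).
Local Notation F := (msF S).
Implicit Types X D : {group gT}.

Lemma rel_projective_mono X n (r : mx_representation F X n) D D' :
  D \subset D' -> rel_projective r D -> rel_projective r D'.
Proof.
move=> sDD' h m w f hf [s [sf hs]]; apply: h hf _; exists s; split=> // x Dx.
by apply: hs; apply: (subsetP sDD').
Qed.

Lemma rel_projective_rsim X n1 n2 (r1 : mx_representation F X n1)
    (r2 : mx_representation F X n2) D :
  D \subset X -> mx_rsim r1 r2 -> rel_projective r1 D -> rel_projective r2 D.
Proof.
move=> sDX [B n12 frB hB]; have [B' BB'] := row_freeP frB.
have B'B : B' *m B = 1%:M.
  by move: r2 B frB B' BB' {hB}; rewrite -n12 => _ B _ B' /mulmx1C.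
have hB' x : x \in X -> r2 x *m B' = B' *m r1 x.
  by move=> Xx; rewrite -[LHS]mul1mx -B'B -!mulmxA (mulmxA B) -hB // -mulmxA BB' mulmx1.
move=> h m w f hf [s [sf hs]].
have [||s' [sf' hs']] := h m w (f *m B').
- by move=> x Xx; rewrite mulmxA hf // -!mulmxA hB'.
- exists (B *m s); split=> [|x Dx].
    by rewrite -mulmxA (mulmxA s) sf mul1mx.
  by rewrite mulmxA hB ?(subsetP sDX) // -!mulmxA hs.
exists (B' *m s'); split=> [|x Xx]; last by rewrite mulmxA hB' // -!mulmxA hs'.
by rewrite -mulmxA -[s' *m f]mulmx1 -{1}B'B (mulmxA (s' *m f)) -(mulmxA s') sf' mul1mx.
Qed.

(** The sufficient half of Higman's criterion for any transitive X-set whose point stabilizer lies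
    in D. The splitting is a relative trace of m(w0) s: the summand T x depends only on the point w0
    x, since s commutes with D. This generality is needed for orbits on pairs of cosets and for
    actions that pass through X. *)
Lemma transitive_rel_projective X n (r : mx_representation F X n) D
    (sT : finType) (act : sT -> gT -> sT) (Om : {set sT}) w0 (m : sT -> 'M_n) :
  {in Om & X, forall w x, act w x \in Om} ->
  {in Om, forall w, act w 1%g = w} ->
  {in X &, forall x y w, w \in Om -> act w (x * y)%g = act (act w x) y} ->
  w0 \in Om -> {in Om, forall w, exists2 x, x \in X & act w0 x = w} ->
  {in X, forall x, act w0 x = w0 -> x \in D} ->
  {in Om & X, forall w x, r x *m m (act w x) = m w *m r x} ->
  \sum_(w in Om) m w = 1%:M -> rel_projective r D.
Proof.
move=> actO act1 actM O0 trans stabD mE sum1 d w f hf [s [sf hs]].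
pose g o := odflt 1%g [pick x in X | act w0 x == o].
have gP o : o \in Om -> g o \in X /\ act w0 (g o) = o.
  move=> Oo; rewrite /g; case: pickP => /= [x /andP[Xx /eqP]|none] //.
  by have [x Xx xo] := trans o Oo; move: (none x); rewrite /= xo eqxx Xx.
pose T x := r x^-1%g *m m w0 *m s *m w x.
have TE x : x \in X -> T x = T (g (act w0 x)).
  move=> Xx; have [] := gP (act w0 x) (actO _ _ O0 Xx).
  set y := g _ => Xy yE; have [e eE] : {e | e = (y * x^-1)%g} by exists (y * x^-1)%g.
  have Xe : e \in X by rewrite eE groupM ?groupV.
  have we : act w0 e = w0 by rewrite eE actM ?groupV // yE -actM ?groupV // mulgV act1.
  have De := stabD e Xe we.
  have -> : y = (e * x)%g by rewrite eE mulgKV.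
  rewrite /T invMg !repr_mxM ?groupV // !mulmxA; congr (_ *m _).
  rewrite -!mulmxA; congr (_ *m _); rewrite -(hs e De) (mulmxA (m w0)).
  have := mE w0 e O0 Xe; rewrite we => <-.
  by rewrite !mulmxA -repr_mxM ?groupV // mulVg repr_mx1 mul1mx.
exists (\sum_(o in Om) T (g o)); split=> [|x Xx].
  rewrite mulmx_suml -[RHS]sum1; apply: eq_bigr => o Oo; have [Xg gE] := gP o Oo.
  rewrite /T -!mulmxA hf // (mulmxA s) sf mul1mx -mE // gE mulmxA.
  by rewrite -repr_mxM ?groupV // mulVg repr_mx1 mul1mx.
rewrite mulmx_sumr mulmx_suml.
rewrite (reindex_onto (act^~ x) (act^~ x^-1%g)) /=; last first.
  by move=> o Oo; rewrite -actM ?groupV // mulVg act1.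
apply: eq_big => [o|o].
  apply/andP/idP=> [[Oox /eqP <-]|Oo]; first by rewrite actO ?groupV.
  by rewrite actO // -actM ?groupV // mulgV act1 // eqxx.
case/andP=> Oox /eqP oE.
have Oo : o \in Om by rewrite -oE actO ?groupV.
have [Xg gE] := gP o Oo; rewrite -{1}gE -actM // -TE ?groupM //.
rewrite /T invMg !repr_mxM ?groupV // !mulmxA -repr_mxM ?groupV //.
by rewrite mulgV repr_mx1 mul1mx.
Qed.

(* Higman's criterion, with the relative trace written as a sum of an         *)
(* equivariant family of matrices indexed by the cosets of D.                 *)
Definition higman X n (r : gT -> 'M[F]_n) D :=
  exists m : {set gT} -> 'M[F]_n,
    {in rcosets D X & X, forall c x, r x *m m (c :* x)%g = m c *m r x} /\
    \sum_(c in rcosets D X) m c = 1%:M.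

(** Relative projectivity is applied to the surjection onto r from its tensor product with the
    permutation module on the cosets of D. Over D it splits through the coset D itself; the
    components of a splitting over X are the required matrices. *)
Lemma rel_projective_higman X n (r : mx_representation F X n) D :
  D \subset X -> rel_projective r D -> higman X r D.
Proof.
move=> sDX proj; pose I := rcosets D X.
have rcx c x : x \in X -> ((c :* x)%g \in I) = (c \in I).
  move=> Xx; apply/rcosetsP/rcosetsP=> [[y Xy cE]|[y Xy ->]].
    by exists (y * x^-1)%g; rewrite ?groupM ?groupV // rcosetM -cE -rcosetM mulgV rcoset1.
  by exists (y * x)%g; rewrite ?groupM // rcosetM.
have ID : (D : {set gT}) \in I by apply/rcosetsP; exists 1%g; rewrite // mulg1.
pose k := #|I|; pose rk c : 'I_k := enum_rank_in ID c.
have rkK c : c \in I -> enum_val (rk c) = c by move=> Ic; rewrite enum_rankK_in.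
have valK i : rk (enum_val i) = i by rewrite /rk enum_valK_in.
pose PX x : 'M[F]_k := \matrix_(i, j) ((enum_val i :* x)%g == enum_val j)%:R.
have PXE x i j : x \in X -> PX x i j = (j == rk (enum_val i :* x)%g)%:R.
  move=> Xx; rewrite mxE eq_sym; congr (nat_of_bool _)%:R.
  apply/eqP/eqP=> [<-|->]; first by rewrite valK.
  by rewrite rkK // rcx // enum_valP.
have PXr : mx_repr X PX.
  split=> [|x y Xx Xy]; apply/matrixP=> i j.
    by rewrite PXE // mulg1 valK mxE eq_sym.
  rewrite [RHS]mxE (bigD1 (rk (enum_val i :* x)%g)) //= big1 => [|l nl].
    rewrite !PXE ?groupM // eqxx mul1r addr0 rkK ?rcosetM //.
    by rewrite rcx // enum_valP.
  by rewrite PXE // (negPf nl) mul0r.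
have [PX1 PXM] := PXr.
have wr : mx_repr X (fun x => kron (PX x) (r x)).
  split=> [|x y Xx Xy]; first by rewrite PX1 repr_mx1 kron1.
  by rewrite PXM // repr_mxM // kronM.
pose f : 'M[F]_(k * n, n) := \matrix_(i, j) ((mxpair i).2 == j)%:R.
pose s : 'M[F]_(n, k * n) :=
  \matrix_(a, j) (((mxpair j).1 == rk D) && ((mxpair j).2 == a))%:R.
have fE i a b : f (mxvec_index i a) b = (a == b)%:R by rewrite mxE mxpairK.
have sE i a b : s b (mxvec_index i a) = ((i == rk D) && (a == b))%:R.
  by rewrite mxE mxpairK.
have [x Xx||s' [sf' hs']] := proj _ (MxRepresentation wr) f.
- apply/matrixP=> i b; case/mxvec_indexP: i => i a; rewrite !mxE /= sum_mxpair.
  rewrite (bigD1 (rk (enum_val i :* x)%g)) //= [X in _ + X]big1 ?addr0.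
    rewrite (bigD1 b) //= big1 ?addr0 => [|c ncb].
      rewrite [RHS](bigD1 a) //= [X in _ = _ + X]big1 ?addr0 => [|c nca].
        by rewrite kronE PXE // !fE !eqxx mulr1 mul1r.
      by rewrite fE eq_sym (negPf nca) mul0r.
    by rewrite fE (negPf ncb) mulr0.
  by move=> j nj; rewrite big1 // => c _; rewrite kronE PXE // (negPf nj) !mul0r.
- exists s; split=> [|x Dx].
    apply/matrixP=> a b; rewrite !mxE sum_mxpair.
    rewrite (bigD1 (rk D)) //= [X in _ + X]big1 ?addr0; last first.
      by move=> j nj; rewrite big1 // => c _; rewrite sE (negPf nj) mul0r.
    rewrite (bigD1 a) //= big1 ?addr0 => [|c nca]; first by rewrite sE fE !eqxx mul1r.
    by rewrite sE (negPf nca) andbF mul0r.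
  have Xx := subsetP sDX x Dx.
  apply/matrixP=> a j; case/mxvec_indexP: j => j b; rewrite !mxE /= sum_mxpair.
  rewrite (bigD1 b) //= big1 ?addr0 => [|c ncb]; last first.
    by rewrite sE [b == c]eq_sym (negPf ncb) andbF mulr0.
  rewrite [RHS](bigD1 (rk D)) //= [X in _ = _ + X]big1 ?addr0; last first.
    by move=> i ni; rewrite big1 // => c _; rewrite sE (negPf ni) mul0r.
  rewrite [RHS](bigD1 a) //= [X in _ = _ + X]big1 ?addr0 => [|c nca]; last first.
    by rewrite sE (negPf nca) andbF mul0r.
  by rewrite !sE kronE PXE // !eqxx andbT mul1r rkK // rcoset_id // mulrC.
pose m c := \matrix_(a, b) s' a (mxvec_index (rk c) b) : 'M[F]_n.
exists m; split=> [c x Ic Xx|].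
  apply/matrixP=> a b.
  have /matrixP/(_ a (mxvec_index (rk (c :* x)%g) b)) := hs' x Xx.
  rewrite !mxE /= sum_mxpair (bigD1 (rk c)) //= [X in _ + X]big1 => [|i ni]; last first.
    rewrite big1 // => e _; rewrite kronE PXE //.
    case: eqP => [E|_]; last by rewrite mul0r mulr0.
    case/eqP: ni; have := congr1 enum_val E; rewrite !rkK ?rcx ?enum_valP //.
    move/(congr1 (fun C : {set gT} => (C :* x^-1)%g)); rewrite -!rcosetM mulgV !rcoset1 => cE.
    by rewrite -(valK i) -cE.
  rewrite addr0 => E; transitivity (\sum_j r x a j * s' j (mxvec_index (rk (c :* x)%g) b)).
    by apply: eq_bigr => j _; rewrite mxE.
  rewrite E; apply: eq_bigr => e _; rewrite kronE PXE // rkK // eqxx mul1r.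
  by rewrite mxE.
apply/matrixP=> a b; rewrite summxE -sf' [RHS]mxE sum_mxpair.
rewrite [LHS]big_enum_val /=; apply: eq_bigr => i _; rewrite mxE valK.
rewrite [RHS](bigD1 b) //= big1 ?addr0 => [|c ncb]; first by rewrite fE eqxx mulr1.
by rewrite fE (negPf ncb) mulr0.
Qed.

(** Multiplying the two decompositions of 1 gives one indexed by pairs of cosets. The sum over an
    X-orbit of pairs commutes with r, so it is scalar, and for some orbit it is nonzero. That orbit
    contains a pair whose first member is D1; the stabilizer of this pair is D1 meet a conjugate of
    D2, and dividing by the scalar allows [transitive_rel_projective] to be used. *)
Lemma rel_projective_meet X n (r : mx_representation F X n) D1 D2 :
  mx_absolutely_irreducible r -> D1 \subset X -> D2 \subset X ->
  rel_projective r D1 -> rel_projective r D2 ->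
  exists2 x, x \in X & rel_projective r (D1 :&: D2 :^ x)%G.
Proof.
move=> absr sD1 sD2 /(rel_projective_higman sD1)[m1 [h1 s1]].
case/(rel_projective_higman sD2) => m2 [h2 s2].
pose Om := setX (rcosets D1 X) (rcosets D2 X).
pose act (w : {set gT} * {set gT}) x := ((w.1 :* x)%g, (w.2 :* x)%g).
have rcx (D : {group gT}) c x : c \in rcosets D X -> x \in X -> (c :* x)%g \in rcosets D X.
  case/rcosetsP=> y Xy -> Xx; apply/rcosetsP.
  by exists (y * x)%g; rewrite ?groupM ?rcosetM.
have actO : {in Om & X, forall w x, act w x \in Om}.
  by move=> w x; rewrite !inE => /andP[w1 w2] Xx; rewrite !rcx.
have act1 w : act w 1%g = w by rewrite /act !rcoset1; case: w.
have actM x y w : act w (x * y)%g = act (act w x) y by rewrite /act !rcosetM.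
pose m w := m1 w.1 *m m2 w.2.
have mE : {in Om & X, forall w x, r x *m m (act w x) = m w *m r x}.
  by move=> w x; rewrite inE => /andP[w1 w2] Xx; rewrite /m mulmxA h1 // -!mulmxA h2.
have sm : \sum_(w in Om) m w = 1%:M.
  rewrite -(mulmx1 1%:M) -{1}s1 -s2 mulmx_suml.
  under [RHS]eq_bigr do rewrite mulmx_sumr.
  by rewrite pair_big /=; apply: eq_bigl => w; rewrite inE.
pose orb w := [set act w x | x in X].
have orbP w w' : w \in Om -> (w' \in orb w) = (w' \in Om) && (orb w' == orb w).
  move=> Ow; apply/imsetP/andP=> [[x Xx ->]|[Ow' /eqP ww']].
    split; first exact: actO.
    apply/eqP/setP=> v; apply/imsetP/imsetP=> [] [y Xy ->].
      by exists (x * y)%g; rewrite ?groupM ?actM.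
    by exists (x^-1 * y)%g; rewrite ?groupM ?groupV // -actM mulKVg.
  have: w' \in orb w' by apply/imsetP; exists 1%g; rewrite ?act1.
  by rewrite ww' => /imsetP[x Xx ->]; exists x.
have scal w : w \in Om -> exists c, \sum_(v in orb w) m v = c%:M.
  move=> Ow; apply/is_scalar_mxP/(mx_abs_irr_cent_scalar absr)/centgmxP => x Xx.
  rewrite mulmx_suml mulmx_sumr [RHS](reindex_onto (act^~ x) (act^~ x^-1%g)) /=.
    apply: eq_big => [v|v]; last by rewrite orbP // => /andP[Ov _]; rewrite mE.
    rewrite -actM mulgV act1 eqxx andbT; apply/imsetP/imsetP=> [] [y Xy vE].
      by exists (y * x)%g; rewrite ?groupM // vE actM.
    exists (y * x^-1)%g; first by rewrite groupM ?groupV.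
    by rewrite actM -vE -actM mulgV act1.
  by move=> v _; rewrite -actM mulVg act1.
have [w [Ow nzw]] : exists w, w \in Om /\ \sum_(v in orb w) m v != 0.
  apply: NNPP => h; have := sm; rewrite (partition_big orb (mem (orb @: Om))) /=.
    rewrite big1 => [/esym/eqP|O /imsetP[w Ow ->]].
      have [n0 _] := mx_abs_irrP absr.
      by rewrite -mxrank_eq0 mxrank1 eqn0Ngt n0.
    apply: NNPP => nz; apply: h; exists w; split=> //; apply/eqP.
    by under eq_bigl do rewrite orbP //.
  by move=> w Ow; apply: imset_f.
have [c cE] := scal w Ow.
have nzc : c != 0 by apply: contraNneq nzw => c0; rewrite cE c0 raddf0.
have := Ow; rewrite inE => /andP[/rcosetsP[y1 Xy1 w1] /rcosetsP[y2 Xy2 w2]].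
pose w0 := act w y1^-1%g.
have orb0 : w0 \in orb w by apply: imset_f; rewrite groupV.
have Ow0 : w0 \in Om by apply: actO; rewrite ?groupV.
have w01 : w0.1 = D1 by rewrite /= w1 -rcosetM mulgV rcoset1.
have w02 : w0.2 = (D2 :* (y2 * y1^-1))%g by rewrite /= w2 -rcosetM.
exists (y2 * y1^-1)%g; first by rewrite groupM ?groupV.
have orbE : orb w0 = orb w by move: orb0; rewrite orbP // => /andP[_ /eqP].
apply: (@transitive_rel_projective X n r _ _ act (orb w) w0 (fun v => c^-1 *: m v)) => //.
- move=> v x; rewrite orbP // => /andP[Ov /eqP vE] Xx; rewrite -vE.
  exact: imset_f.
- by move=> v; rewrite -orbE => /imsetP[x Xx ->]; exists x.
- move=> x Xx w0x; rewrite inE mem_conjg.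
  have w1x : (w0.1 :* x)%g = w0.1 by rewrite -{2}w0x.
  have w2x : (w0.2 :* x)%g = w0.2 by rewrite -{2}w0x.
  apply/andP; split; first by rewrite -w01 -w1x w01 rcoset_refl.
  have : (y2 * y1^-1)%g \in (D2 :* (y2 * y1^-1))%g by rewrite rcoset_refl.
  rewrite -w02 -w2x w02 -rcosetM mem_rcoset !invMg invgK => h.
  by rewrite conjgE !invMg !invgK -groupV !invMg !invgK !mulgA in h *.
- move=> v x; rewrite orbP // => /andP[Ov _] Xx.
  by rewrite -scalemxAr mE // scalemxAl.
by rewrite -scaler_sumr cE scale_scalar_mx mulVf.
Qed.

End RelativeProjectivity.

(** * The character correspondence *)

Section Stabilizers.

Variables (p : nat) (S : modular_system p) (Gam : galois_group S).
Variable gT : finGroupType.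
Implicit Types (B X : {group gT}) (chi : bfun S gT).

Lemma gstabP B X chi (s : Gam) g : reflect
  [/\ g \in B, (X :^ g)%g = X & bact (s, g) chi = chi] ((s, g) \in gstab Gam B X chi).
Proof. by rewrite inE; apply: (iffP and3P) => -[? /eqP ? /eqP ?]. Qed.

Lemma stab_gstab B X chi g :
  (g \in stab Gam B X chi) = ((1%g : Gam, g) \in gstab Gam B X chi).
Proof. by rewrite !inE. Qed.

Lemma stab_group_set B X chi : group_set (stab Gam B X chi).
Proof.
apply/group_setP; split=> [|g h]; rewrite !stab_gstab.
  by apply/gstabP; rewrite group1 conjsg1 bact1.
case/gstabP=> Bg Xg cg /gstabP[Bh Xh ch]; apply/gstabP.
rewrite groupM // conjsgM Xg Xh; split=> //.
have -> : (1, g * h)%g = ((1%g, g) * (1%g, h))%g :> Gam * gT by congr pair; rewrite /= mulg1.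
by rewrite -bactM cg.
Qed.

Canonical stab_group B X chi := Group (stab_group_set B X chi).

Lemma gstab_group_set B X chi : group_set (gstab Gam B X chi).
Proof.
apply/group_setP; split=> [|[s g] [t h]].
  by apply/gstabP; rewrite group1 conjsg1 bact1.
case/gstabP=> Bg Xg cg /gstabP[Bh Xh ch]; apply/gstabP.
by rewrite /= groupM // conjsgM Xg Xh -[(_, _)]/((s, g) * (t, h))%g -bactM cg.
Qed.

Canonical gstab_group B X chi := Group (gstab_group_set B X chi).

End Stabilizers.

Section Transfer.

Variables (p : nat) (S : modular_system p) (Gam : galois_group S).
Local Notation F := (msF S).
Local Notation q := #|F|.
Variables (gT kT xT : finGroupType).
Variables (X : {group xT}) (A N : {group gT}) (K Z : {group kT}).
Variables (p1 : xT -> gT) (p2 : xT -> kT).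
Variables (m : nat) (V : mx_representation F N m) (R : xT -> 'M[F]_m) (lz : kT -> F).
Variables (theta : bfun S gT) (lam : bfun S kT).

Local Notation At := (stab Gam A N theta).
Local Notation Kl := (stab Gam K Z lam).

(** This gathers what the transfer of characters, vertices and order relations uses about the two
    sides, independently of how X is built. In [tr_twist] the twist of R is conjugate to R without a
    scalar factor, which is what preserves equivariance and mu_a. *)
Record triple_transfer : Prop := TripleTransfer {
  tr_TP : two_projections X A N K Z p1 p2;
  tr_irrV : mx_irreducible V;
  tr_affV : affords N V theta;
  tr_ext : extends X Z p1 p2 V R lz At;
  tr_faithful : {in Z, forall z, lz z = 1 -> z = 1%g};
  tr_lam : affords Z (fun z => (lz z)%:M : 'M_1) lam;
  tr_splits : splits S A;
  tr_triple : Htriple Gam A N theta;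
  tr_gstab : forall s, {in X, forall x,
    ((s, p1 x) \in gstab Gam A N theta) = ((s, p2 x) \in gstab Gam K Z lam)};
  tr_cent : Kl \subset 'C(Z);
  tr_twist : forall s, {in X, forall x, (s, p1 x) \in gstab Gam A N theta ->
    exists2 C, C \in unitmx &
      {in X, forall y, p1 y \in At ->
         C *m map_mx (gal_F s) (R (y ^ x^-1)%g) = R y *m C}}
}.

Hypothesis TR : triple_transfer.

Let TP := tr_TP TR.

Lemma sub_splitting (J : {group gT}) : J \subset A -> group_splitting_field F J.
Proof. by move=> sJA; case: (tr_splits TR sJA). Qed.

Let sNA : N \subset A. Proof. by case: (tr_triple TR). Qed.

Let absV : mx_absolutely_irreducible V.
Proof. by apply: (sub_splitting sNA); apply: (tr_irrV TR). Qed.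

Lemma extends_sub (J : {set gT}) : J \subset At -> extends X Z p1 p2 V R lz J.
Proof.
move=> sJ; case: (tr_ext TR) => e1 eM eN eZ lz0; split=> //.
by move=> x y Xx Xy Jx Jy; apply: eM => //; apply: (subsetP sJ).
Qed.

Lemma At_Kl x : x \in X -> (p1 x \in At) = (p2 x \in Kl).
Proof. by move=> Xx; rewrite !stab_gstab (tr_gstab TR). Qed.

Lemma normal_N (J : {group gT}) : N \subset J -> J \subset A -> N <| J.
Proof.
move=> sNJ sJA; rewrite /normal sNJ; apply/subsetP=> g Jg.
have [_ _ /eqP/orb_stabP/(_ g (subsetP sJA g Jg))[Ng _]] := tr_triple TR.
by rewrite inE Ng.
Qed.

Lemma matched_exists (J : {group gT}) : N \subset J -> J \subset A ->
  exists J' : {group kT}, matched X A K p1 p2 J J'.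
Proof.
move=> sNJ sJA; pose B := [set p2 x | x in X & p1 x \in J].
have gB : group_set B.
  apply/group_setP; split.
    by apply/imsetP; exists 1%g; rewrite ?(p2_1 TP) // inE group1 (p1_1 TP) group1.
  move=> _ _ /imsetP[x /setIdP[Xx Jx] ->] /imsetP[y /setIdP[Xy Jy] ->].
  by apply/imsetP; exists (x * y)%g; rewrite ?(p2M TP) // inE (p1M TP) ?groupM.
exists (Group gB); split=> // [|x Xx].
  by apply/subsetP=> _ /imsetP[x /setIdP[Xx _] ->]; apply: (p2K TP).
apply/idP/imsetP=> [Jx|[y /setIdP[Xy Jy] xy]]; first by exists x; rewrite // inE Xx.
have [z [Xz z1] ->] := same_p2 TP Xy Xx (esym xy).
by rewrite (p1M TP) // groupM // (subsetP sNJ) // (p1N TP).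
Qed.

Lemma matched_exists2 (J' : {group kT}) : Z \subset J' -> J' \subset K ->
  exists J : {group gT}, matched X A K p1 p2 J J'.
Proof.
move=> sZJ sJK; pose B := [set p1 x | x in X & p2 x \in J'].
have gB : group_set B.
  apply/group_setP; split.
    by apply/imsetP; exists 1%g; rewrite ?(p1_1 TP) // inE group1 (p2_1 TP) group1.
  move=> _ _ /imsetP[x /setIdP[Xx Jx] ->] /imsetP[y /setIdP[Xy Jy] ->].
  by apply/imsetP; exists (x * y)%g; rewrite ?(p1M TP) // inE (p2M TP) ?groupM.
exists (Group gB); split=> // [|x Xx].
  by apply/subsetP=> _ /imsetP[x /setIdP[Xx _] ->]; apply: (p1A TP).
apply/imsetP/idP=> [[y /setIdP[Xy Jy] xy]|Jx]; last by exists x; rewrite // inE Xx.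
have [z [Xz z1] ->] := same_p1 TP Xy Xx (esym xy).
by rewrite (p2M TP) // groupM // (subsetP sZJ) // (p2Z TP).
Qed.

Lemma lzM : {in Z &, {morph lz : y z / (y * z)%g >-> y * z}}.
Proof.
move=> y z Zy Zz; have [_ _ _ eZ nz] := tr_ext TR.
have [a Xa [ay a1]] := p2_ontoZ TP Zy; have [b Xb [bz b1]] := p2_ontoZ TP Zz.
have At1 : 1%g \in At by apply: group1.
have := extM (tr_ext TR) Xa Xb; rewrite a1 b1 => /(_ At1 At1).
rewrite !eZ ?groupM // ?(p1M TP) // ?(p2M TP) // ?a1 ?b1 ?mulg1 //.
rewrite ay bz -scalar_mxM; have [m0 _] := mx_abs_irrP absV.
move/(congr1 (fun M : 'M_m => M (Ordinal m0) (Ordinal m0))).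
by rewrite !mxE eqxx !mulr1n -invfM => /invr_inj.
Qed.

Lemma lz_mx_repr : mx_repr Z (fun z => (lz z)%:M : 'M[F]_1).
Proof.
split=> [|y z Zy Zz]; last by rewrite lzM // scalar_mxM.
congr (_%:M); have Z1 := group1 Z; apply: (mulfI (lz_neq0 (tr_ext TR) Z1)).
by rewrite -lzM // mulg1 mulr1.
Qed.

Definition lz_repr := MxRepresentation lz_mx_repr.

Lemma expZ z : z \in Z -> (z ^+ q.-1 = 1)%g.
Proof.
move=> Zz; apply: (tr_faithful TR); first exact: groupX.
have nz : lz z != 0 by apply: (lz_neq0 (tr_ext TR)).
have lX i : lz (z ^+ i)%g = lz z ^+ i.
  elim: i => [|i IHi]; last by rewrite expgS exprS lzM ?groupX ?IHi.
  have [/(congr1 (fun M : 'M_1 => M 0 0))] := lz_mx_repr.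
  by rewrite !mxE.
by rewrite lX expq1.
Qed.

Section Matched.

Variables (J : {group gT}) (J' : {group kT}).
Hypotheses (mJ : matched X A K p1 p2 J J') (sJ : J \subset At).

Let sNJ : N \subset J. Proof. by case: (matched_sub TP mJ). Qed.
Let sJA : J \subset A. Proof. by case: mJ. Qed.
Let extJ := extends_sub sJ.

Lemma J'_Kl k : k \in J' -> k \in Kl.
Proof.
move=> Jk; case: (mJ) => _ sJK mE.
have [x Xx xk] := p2_onto TP (subsetP sJK k Jk).
by rewrite -xk -At_Kl // (subsetP sJ) // mE // xk.
Qed.

Lemma J'_cent k z : k \in J' -> z \in Z -> commute k z.
Proof. by move=> Jk Zz; apply: (centP (subsetP (tr_cent TR) _ (J'_Kl Jk))). Qed.

(** Here V is a quotient of the restriction of U; Clifford theory makes it a submodule as well, as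
    [lift_surj] requires. *)
Lemma lift_over n (U : mx_representation F J n) (f : 'M_(n, m)) :
  mx_irreducible U -> f != 0 -> {in N, forall x, U x *m f = f *m V x} ->
  exists e (W : mx_representation F J' e) (scW : lz_scalar Z lz J' W),
    mx_rsim (lift_repr TP mJ extJ scW) U.
Proof.
move=> irrU nzf homf.
have fuf := hom_irr_full (tr_irrV TR) nzf homf.
have nNJ := normal_N sNJ sJA.
have [|a Ua0|g [nzg homg]] := Clifford_embed nNJ irrU absV.
- move=> j Jj; have [Xj jE] := sec1P TP (subsetP sJA _ Jj).
  exists (R (sec1 X p1 j)); first by rewrite (R_unit TP extJ) ?jE.
  by move=> x Nx; have [|_] := RV TP mJ extJ Xj _ Nx; rewrite ?jE // => ->.
- apply: (row_full_inj fuf); rewrite mulmx0 -(ga_hom a homf).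
  by rewrite Ua0 mul0mx.
exact: (lift_surj TP absV mJ extJ irrU nzg homg).
Qed.

Lemma lift_absV e (W : mx_representation F J' e) (scW : lz_scalar Z lz J' W) :
  mx_irreducible W -> mx_absolutely_irreducible W.
Proof.
move=> irrW; have irrU := lift_irr TP absV mJ extJ scW (normal_N sNJ sJA) irrW.
exact: lift_abs_irr_inv (sub_splitting sJA irrU).
Qed.

End Matched.

Lemma p2_reg_lift x : x \in X -> p^'.-elt (p2 x) ->
  exists2 y, y \in <[x]>%g & p2 y = p2 x /\ p^'.-elt y.
Proof.
(* The exponent e is the p-part of the order of x. It is prime to the order of p2 x, so u can invert
   it there: (x^e)^u is p-regular and still lies over p2 x. *)
move=> Xx rx; pose e := (#[x]`_p)%N.
have cop : coprime #|<[p2 x]>%g| e.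
  by rewrite coprime_sym; apply: (pnat_coprime (part_pnat p _)).
pose u := expg_invn <[p2 x]> e.
exists ((x ^+ e) ^+ u)%g; first by rewrite !groupX ?cycle_id.
rewrite !(p2X TP) ?groupX // (expgK cop) ?cycle_id; split=> //.
apply: p_eltX; rewrite /p_elt; apply: pnat_dvd (part_pnat p^' #[x]).
by rewrite order_dvdn -expgM partnC ?expg_order.
Qed.

Lemma sNAt : N \subset At.
Proof.
apply/subsetP=> n Nn; have [x Xx [<- x1]] := p1_ontoN TP Nn.
by rewrite At_Kl // x1 group1.
Qed.

(* The p-regular elements of K_lam have order dividing q - 1: above a cyclic  *)
(* quotient J/N the projective extension of V is a constituent of the split   *)
(* group algebra FJ, twisted by a linear representation of J'.                *)
Lemma reg_exp_Kl : reg_exp S Kl.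
Proof.
move=> k Kk rk; have Kk' : k \in K by move: Kk; rewrite inE => /andP[].
have [x Xx xk] := p2_onto TP Kk'; rewrite -xk in rk Kk *.
have [y yx [py ry]] := p2_reg_lift Xx rk.
have Xy : y \in X by apply: subsetP yx; rewrite cycle_subG.
rewrite -py in Kk *; move: y Xy ry Kk {k xk Kk' rk x Xx yx py} => x Xx rx Kk.
pose g := p1 x; have Ag : g \in At by rewrite At_Kl.
pose J := (N <*> <[g]>)%G.
have sJ : J \subset At by rewrite join_subG sNAt cycle_subG.
have sJA : J \subset A by apply: subset_trans sJ _; apply/subsetP=> h; rewrite inE => /andP[].
have sNJ : N \subset J by apply: joing_subl.
have [J' mJ] := matched_exists sNJ sJA.
have [m0 _] := mx_abs_irrP absV.
have [n [U [f [irrU nzf homf]]]] := exists_irr_above idfun V sNJ m0.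
have [|e [W [scW sim]]] := lift_over mJ sJ irrU nzf _.
  by move=> y Ny; rewrite -homf // map_mx_id.
have absW : mx_absolutely_irreducible W.
  have irrU' := mx_rsim_irr (mx_rsim_sym sim) irrU.
  exact: (lift_absV mJ sJ scW (lift_irr_inv absV irrU')).
have Jx : p1 x \in J by apply: (subsetP (joing_subr _ _)); apply: cycle_id.
have Jk : p2 x \in J' by case: (mJ) => _ _ <-.
have cJJ : abelian J'.
  have J'E k : k \in J' -> exists i z, z \in Z /\ k = (p2 x ^+ i * z)%g.
    case: (mJ) => _ sJK mE Jk'; have [y Xy yk] := p2_onto TP (subsetP sJK k Jk').
    have : p1 y \in J by rewrite mE // yk.
    have nNg : <[g]> \subset 'N(N).
      rewrite cycle_subG; apply: subsetP (subsetP sJA _ Jx).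
      by have /andP[] := normal_N sNA (subxx A).
    rewrite /= norm_joinEr // => /mulsgP[b _ Nb /cycleP[i ->] yE].
    have [c Xc [cb c1]] := p1_ontoN TP Nb.
    have yE' : p1 (c * x ^+ i)%g = p1 y by rewrite (p1M TP) ?groupX // (p1X TP) // cb yE.
    have [z [Xz z1] yz] := same_p1 TP (groupM Xc (groupX i Xx)) Xy yE'.
    exists i, (p2 z); rewrite (p2Z TP) //; split=> //.
    by rewrite -yk yz !(p2M TP) ?groupM ?groupX // c1 mul1g (p2X TP).
  apply/centsP=> k1 Jk1 k2 Jk2; have [i [z [Zz k1E]]] := J'E k1 Jk1.
  have [j [w [Zw k2E]]] := J'E k2 Jk2.
  rewrite k1E; apply/commute_sym/commuteM; last exact: (J'_cent mJ sJ Jk2).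
  rewrite k2E; apply/commute_sym/commuteM; first by apply: commuteX2.
  by apply: (J'_cent mJ sJ) => //; apply: groupX.
have e1 : e = 1%N by apply/eqP; rewrite -(abelian_abs_irr W cJJ).
(* As p1 x is a p-regular element of A, its order divides q - 1 and (p2 x)^(q-1) lies in Z. There
   the one-dimensional W takes the value lz, and also the (q-1)-th power of a nonzero element of F,
   which is 1; faithfulness of lz concludes. *)
have p1z : p1 (x ^+ q.-1)%g = 1%g.
  rewrite (p1X TP) //; apply: (splits_reg_exp (tr_splits TR)); first exact: (p1A TP).
  apply: pnat_dvd rx; rewrite order_dvdn -(p1X TP) // expg_order (p1_1 TP) //.
have Zz : p2 (x ^+ q.-1)%g \in Z by rewrite (p2Z TP) ?groupX.
rewrite -(p2X TP) //; apply: (tr_faithful TR) => //.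
have detX i : \det (W (p2 x ^+ i)%g) = \det (W (p2 x)) ^+ i.
  elim: i => [|i IHi]; first by rewrite repr_mx1 det1.
  by rewrite expgS exprS repr_mxM ?groupX // det_mulmx IHi.
have := detX q.-1; rewrite expq1; last first.
  by have := repr_mx_unit W Jk; rewrite unitmxE unitfE.
rewrite -(p2X TP) // -[p2 _]mul1g scW // repr_mx1 detZ det1 mulr1 e1.
by rewrite expr1 mul1g.
Qed.

Lemma reg_exp_A : reg_exp S A.
Proof. exact: splits_reg_exp (tr_splits TR). Qed.

Lemma reg_exp_sub (hT : finGroupType) (Y Y' : {set hT}) :
  Y' \subset Y -> reg_exp S Y -> reg_exp S Y'.
Proof. by move=> sY h x Yx; apply: h; apply: (subsetP sY). Qed.

Lemma ZKl : Z \subset Kl.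
Proof.
apply/subsetP=> z Zz; have [x Xx [<- x1]] := p2_ontoZ TP Zz.
by rewrite -At_Kl // x1 group1.
Qed.

Lemma abelianZ : abelian Z.
Proof. by apply: subset_trans ZKl (tr_cent TR). Qed.

Lemma splitting_Z : group_splitting_field F Z.
Proof.
move=> n r irr; apply: linear_mx_abs_irr.
apply: (irr_abelian_deg1 abelianZ _ irr) => z; exact: expZ.
Qed.

Lemma exp_p'group (hT : finGroupType) (Y : {group hT}) :
  {in Y, forall y, (y ^+ q.-1 = 1)%g} -> p^'.-group Y.
Proof.
move=> Y1; apply/pgroupP=> l l_pr /Cauchy[] // y Yy yl; rewrite !inE.
apply: contraTneq isT => lp.
have := Y1 y Yy => /eqP; rewrite -order_dvdn yl lp (dvdn_pcharf (ms_pcharF S)).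
rewrite -subn1 natrB ?(ltnW (q_gt1 S)) // natq0 sub0r oppr_eq0.
by rewrite oner_eq0.
Qed.

Lemma p'Z : p^'.-group Z.
Proof. by apply: exp_p'group => z; apply: expZ. Qed.

(* Modular characters of J over theta and of J' over lam correspond when they *)
(* are afforded by W (x) V and W.                                             *)
Definition corr (J : {group gT}) (J' : {group kT}) chi psi :=
  exists e (W : mx_representation F J' e),
    [/\ mx_irreducible W, lz_scalar Z lz J' W, affords J' W psi
      & affords J (lift_mx X p1 p2 R W) chi].

Section Correspondence.

Variables (J : {group gT}) (J' : {group kT}).
Hypotheses (mJ : matched X A K p1 p2 J J') (sJ : J \subset At).

Let sNJ : N \subset J. Proof. by case: (matched_sub TP mJ). Qed.
Let sZJ : Z \subset J'. Proof. by case: (matched_sub TP mJ). Qed.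
Let sJA : J \subset A. Proof. by case: mJ. Qed.
Let extJ := extends_sub sJ.
Let eJ : reg_exp S J. Proof. exact: reg_exp_sub sJA reg_exp_A. Qed.

Lemma reg_exp_J' : reg_exp S J'.
Proof. by apply: reg_exp_sub reg_exp_Kl; apply/subsetP=> k; apply: (J'_Kl mJ sJ). Qed.

Lemma over_hom n (r : mx_representation F J n) chi psi : mx_irreducible r ->
  affords J r chi -> brauer_char N psi -> bres N chi = theta + psi ->
  exists g : 'M[F]_(m, n), g != 0 /\ {in N, forall x, V x *m g = g *m r x}.
Proof.
move=> irr aff bc chiE; have nNJ := normal_N sNJ sJA.
apply: (Clifford_embed nNJ irr absV) => [j Jj|].
  have [Xj jE] := sec1P TP (subsetP sJA _ Jj).
  exists (R (sec1 X p1 j)); first by rewrite (R_unit TP extJ) ?jE.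
  by move=> x Nx; have [|_] := RV TP mJ extJ Xj _ Nx; rewrite ?jE // => ->.
apply: (@constituent_ker p S gT N n (subg_repr r sNJ) m V theta _ psi _ _ _ _ _ bc chiE).
- exact: sub_splitting sNA.
- exact: reg_exp_sub sNA reg_exp_A.
- exact: (tr_irrV TR).
- exact: (tr_affV TR).
- exact: affords_sub sNJ aff.
Qed.

Lemma corr_total chi : IBr_over J N theta chi -> exists psi, corr J J' chi psi.
Proof.
case=> -[n [r [irr aff]]] [psi [bc chiE]].
have [g [nzg homg]] := over_hom irr aff bc chiE.
have [e [W [scW sim]]] := lift_surj TP absV mJ extJ irr nzg homg.
have [psi' aff'] := exists_affords W reg_exp_J'.
exists psi', e, W; split=> //.
  have irrU := mx_rsim_irr (mx_rsim_sym sim) irr.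
  exact: (lift_irr_inv absV irrU).
exact: affords_rsim (mx_rsim_sym sim) aff.
Qed.

(** Z is central in J', so r z - lz z is an endomorphism of the irreducible r. It is not invertible,
    because by Clifford theory it kills the image of a nonzero map from the module of lz; hence it
    is 0. *)
Lemma lz_scalar_over n (r : mx_representation F J' n) psi : mx_irreducible r ->
  affords Z r (lam + psi) -> brauer_char Z psi -> lz_scalar Z lz J' r.
Proof.
move=> irr aff bc; have nZJ : Z <| J'.
  apply/andP; split=> //; apply/subsetP=> k Jk; rewrite inE.
  apply/subsetP=> _ /imsetP[z Zz ->].
  by rewrite /conjg -(J'_cent mJ sJ Jk Zz) mulKg.
have absl : mx_absolutely_irreducible lz_repr by apply: linear_mx_abs_irr.
have [|a ra|g [nzg homg]] := Clifford_embed nZJ irr absl.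
- move=> k Jk; exists 1%:M; rewrite ?unitmx1 // => z Zz; rewrite mul1mx mulmx1 /=.
  by rewrite /conjg -(J'_cent mJ sJ Jk Zz) mulKg.
- apply: (@constituent_ker p S kT Z n (subg_repr r sZJ) 1 lz_repr lam _ psi _ _ _ _ aff bc) => //.
  + exact: splitting_Z.
  + by move=> z Zz _; apply: expZ.
  + exact: mx_abs_irrW absl.
  + exact: (tr_lam TR).
move=> k z Jk Zz; have Jz := subsetP sZJ z Zz; rewrite repr_mxM // -mul_mx_scalar.
congr (_ *m _); apply/eqP; rewrite -subr_eq0; apply: contraTT isT => nz.
have : r z - (lz z)%:M \in unitmx.
  apply: (mx_Schur irr _ nz); apply/centgmxP=> l Jl; rewrite mulmxBl mulmxBr.
  by rewrite scalar_mxC -!repr_mxM // (J'_cent mJ sJ Jl Zz).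
move=> u; case/eqP: nzg; apply: (can_inj (mulmxK u)); rewrite mul0mx mulmxBr.
by rewrite -homg //= mul_scalar_mx mul_mx_scalar subrr.
Qed.

Lemma corr_IBr chi psi : corr J J' chi psi -> IBr J chi.
Proof.
case=> e [W [irrW scW _ affl]]; exists _, (lift_repr TP mJ extJ scW); split=> //.
exact: (lift_irr TP absV mJ extJ scW (normal_N sNJ sJA) irrW).
Qed.

Lemma corr_over chi psi : corr J J' chi psi -> IBr_over J' Z lam psi.
Proof.
case=> e [W [irrW scW affW _]]; split; first by exists e, W.
have e0 := irr_deg_gt0 irrW.
have absl : mx_absolutely_irreducible lz_repr by apply: linear_mx_abs_irr.
have eZ : reg_exp S Z by move=> z Zz _; apply: expZ.
have h := @hom_over p S kT Z e (subg_repr W sZJ) 1 lz_repr lam (bres Z psi)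
  (delta_mx 0 (Ordinal e0)) eZ (mx_abs_irrW absl) (tr_lam TR) (affords_sub sZJ affW).
apply: h => [|z Zz]; first by rewrite -mxrank_eq0 mxrank_delta.
by rewrite /= -[z]mul1g scW // repr_mx1 mul1g mul_scalar_mx scalemx1 mul_mx_scalar.
Qed.

Lemma corr_over_theta chi psi : corr J J' chi psi -> IBr_over J N theta chi.
Proof.
move=> c; split; first exact: corr_IBr c.
case: c => e [W [irrW scW affW affl]]; have e0 := irr_deg_gt0 irrW.
have [m0 _] := mx_abs_irrP absV.
(* The inclusion of V as the first summand of the restriction to N of the lift, which is a sum of e
   copies of V. *)
pose g : 'M[F]_(m, e * m) := \matrix_(a, j)
  (((mxpair j).1 == Ordinal e0) && ((mxpair j).2 == a))%:R.
have gE i a b : g b (mxvec_index i a) = ((i == Ordinal e0) && (a == b))%:R.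
  by rewrite mxE mxpairK.
apply: (@hom_over p S gT N _ (subg_repr (lift_repr TP mJ extJ scW) sNJ) m V theta
   (bres N chi) g (reg_exp_sub sNA reg_exp_A) (tr_irrV TR) (tr_affV TR)
   (affords_sub sNJ affl)) => [|x Nx].
  apply/eqP=> /matrixP/(_ (Ordinal m0) (mxvec_index (Ordinal e0) (Ordinal m0)))/eqP.
  by rewrite gE !eqxx mxE oner_eq0.
rewrite /= (liftN TP mJ extJ) ?repr_mx1 //.
apply/matrixP=> a j; case/mxvec_indexP: j => j b; rewrite !mxE sum_mxpair.
rewrite (bigD1 b) //= big1 ?addr0 => [|c ncb]; last first.
  by rewrite gE [b == c]eq_sym (negPf ncb) andbF mulr0.
rewrite [RHS](bigD1 (Ordinal e0)) //= [X in _ = _ + X]big1 ?addr0; last first.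
  by move=> i ni; rewrite big1 // => c _; rewrite gE (negPf ni) mul0r.
rewrite [RHS](bigD1 a) //= [X in _ = _ + X]big1 ?addr0 => [|c nca]; last first.
  by rewrite gE (negPf nca) andbF mul0r.
by rewrite !gE kronE mxE !eqxx andbT mul1r eq_sym mulrC.
Qed.

Lemma corr_surj psi : IBr_over J' Z lam psi -> exists chi, corr J J' chi psi.
Proof.
case=> -[e [W [irrW affW]]] [psi' [bc psiE]].
have scW : lz_scalar Z lz J' W.
  by apply: lz_scalar_over irrW _ bc; rewrite -psiE; apply: affords_sub affW.
have [chi affl] := exists_affords (lift_repr TP mJ extJ scW) eJ.
by exists chi, e, W.
Qed.

Lemma lift_rsim e1 e2 (W1 : mx_representation F J' e1) (W2 : mx_representation F J' e2)
    (sc1 : lz_scalar Z lz J' W1) (sc2 : lz_scalar Z lz J' W2) :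
  mx_irreducible W1 -> mx_irreducible W2 ->
  mx_rsim (lift_repr TP mJ extJ sc1) (lift_repr TP mJ extJ sc2) <-> mx_rsim W1 W2.
Proof.
move=> irr1 irr2; have nNJ := normal_N sNJ sJA.
split=> [[B dim frB hB]|[B dim frB hB]].
  have [||t Bt homt] := hom_lift TP absV mJ extJ sc1 sc2 _ _ hB; rewrite ?repr_mx1 //.
  apply: (hom_irr_rsim irr1 irr2 _ homt).
  apply: contraTneq frB => t0; rewrite Bt t0 -row_leq_rank.
  have -> : kron (0 : 'M[F]_(e1, e2)) (1%:M : 'M_m) = 0.
    by apply/matrixP=> k l; rewrite !mxE mul0r.
  have [m0 _] := mx_abs_irrP absV.
  by rewrite mxrank0 -ltnNge muln_gt0 (irr_deg_gt0 irr1).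
exists (kron B 1%:M); first by rewrite dim.
  have /row_freeP[B' BB'] := frB.
  by apply/row_freeP; exists (kron B' 1%:M); rewrite -kronM BB' mulmx1 kron1.
exact: (lift_hom TP mJ extJ).
Qed.

Lemma corr_fun chi psi1 psi2 : corr J J' chi psi1 -> corr J J' chi psi2 -> psi1 = psi2.
Proof.
case=> e1 [W1 [irr1 sc1 aff1 affl1]] [e2 [W2 [irr2 sc2 aff2 affl2]]].
have irrl1 := lift_irr TP absV mJ extJ sc1 (normal_N sNJ sJA) irr1.
have irrl2 := lift_irr TP absV mJ extJ sc2 (normal_N sNJ sJA) irr2.
have sim := IBr_rsim (sub_splitting sJA irrl1) (sub_splitting sJA irrl2) affl1 affl2.
have {}sim := (lift_rsim sc1 sc2 irr1 irr2).1 sim.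
exact: affords_uniq (affords_rsim sim aff1) aff2.
Qed.

Lemma corr_inj chi1 chi2 psi : corr J J' chi1 psi -> corr J J' chi2 psi -> chi1 = chi2.
Proof.
case=> e1 [W1 [irr1 sc1 aff1 affl1]] [e2 [W2 [irr2 sc2 aff2 affl2]]].
have sim := IBr_rsim (lift_absV mJ sJ sc1 irr1) (lift_absV mJ sJ sc2 irr2) aff1 aff2.
have {}sim := (lift_rsim sc1 sc2 irr1 irr2).2 sim.
exact: (@affords_uniq p S gT J _ _ _ _ (affords_rsim sim affl1) affl2).
Qed.

Lemma split_above_J' : split_above J' Z lam.
Proof.
move=> n r irr aff; have n0 := irr_deg_gt0 irr.
have bc : brauer_char Z (lam *+ n.-1).
  have rl : mx_repr Z (fun z => (lz z)%:M : 'M[F]_n.-1).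
    split=> [|y z Zy Zz]; last by rewrite lzM // scalar_mxM.
    have [/(congr1 (fun M : 'M_1 => M 0 0))] := lz_mx_repr.
    by rewrite !mxE /= !mulr1n => ->.
  exists n.-1, (MxRepresentation rl) => z /=; have := tr_lam TR z.
  rewrite ffunMnE; case: ifP => [_|_ ->]; last by rewrite mul0rn.
  exact: brauer_value_scalar.
have scr : lz_scalar Z lz J' r.
  apply: lz_scalar_over irr _ bc.
  by rewrite -mulrS prednK.
split; first exact: (lift_absV mJ sJ scr irr).
exact: (exists_affords r reg_exp_J').
Qed.

End Correspondence.

Lemma matchedJ (J : {group gT}) (J' : {group kT}) x : matched X A K p1 p2 J J' ->
  x \in X -> matched X A K p1 p2 (J :^ p1 x)%G (J' :^ p2 x)%G.
Proof.
case=> sJA sJK mE Xx; split.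
- by rewrite conj_subG // (p1A TP).
- by rewrite conj_subG // (p2K TP).
move=> y Xy; rewrite !mem_conjg -(p1V TP) // -(p2V TP) //.
by rewrite -(p1J TP) ?groupV // -(p2J TP) ?groupV // mE // groupJ ?groupV.
Qed.

Lemma AtJ (J : {group gT}) s x : x \in X -> (s, p1 x) \in gstab Gam A N theta ->
  J \subset At -> (J :^ p1 x)%G \subset At.
Proof.
move=> Xx ax sJ; apply/subsetP=> _ /imsetP[g Jg ->].
have := subsetP sJ g Jg; rewrite !stab_gstab => ag.
have -> : (1%g : Gam, g ^ p1 x)%g = ((1, g) ^ (s, p1 x))%g.
  by rewrite [in RHS]/conjg; congr pair; rewrite /= ?mul1g ?mulVg.
by rewrite groupJ.
Qed.

Lemma lz_twist s x z : x \in X -> (s, p1 x) \in gstab Gam A N theta ->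
  z \in Z -> (z ^ p2 x^-1)%g \in Z /\ gal_F s (lz (z ^ p2 x^-1)%g) = lz z.
Proof.
move=> Xx; rewrite (tr_gstab TR) // => /gstabP[Kx Zx lamx] Zz.
have Zzx : (z ^ p2 x^-1)%g \in Z by rewrite (p2V TP) // -mem_conjg Zx.
split=> //.
have := affords_pact (s, p2 x) (tr_lam TR); rewrite lamx => affp.
have := @IBr_rsim p S kT Z 1 1 _ lz_repr lam _ _ _ (tr_lam TR).
have prr : mx_repr Z (pact (s, p2 x) lz_repr).
  by have := pact_mx_repr lz_repr (s, p2 x); rewrite /= Zx.
move/(_ (MxRepresentation prr)); case=> [||y|B _ frB hB].
- exact: linear_mx_abs_irr.
- exact: linear_mx_abs_irr.
- by have := affp y; rewrite /= Zx.
have := hB z Zz; rewrite /= mul_mx_scalar /pact /= map_scalar_mx mul_scalar_mx.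
have nzB : B != 0.
  by apply: contraTneq frB => ->; rewrite -row_leq_rank mxrank0.
rewrite (p2V TP) // => /eqP; rewrite -subr_eq0 -scalerBl scaler_eq0 (negPf nzB) orbF.
by rewrite subr_eq0 => /eqP.
Qed.

(* The twist by (s, x) turns W (x) V into W^(s, x) (x) V, because V extends   *)
(* to the stabilizer compatibly with the twist.                               *)
Lemma lift_pact (J : {group gT}) (J' : {group kT}) s x e (W : kT -> 'M[F]_e) :
  matched X A K p1 p2 J J' -> J \subset At -> lz_scalar Z lz J' W ->
  x \in X -> (s, p1 x) \in gstab Gam A N theta ->
  lz_scalar Z lz (J' :^ p2 x)%G (pact (s, p2 x) W) /\
  exists2 C, C \in unitmx & {in (J :^ p1 x)%G, forall g,
    kron 1%:M C *m pact (s, p1 x) (lift_mx X p1 p2 R W) g =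
    lift_mx X p1 p2 R (pact (s, p2 x) W) g *m kron 1%:M C}.
Proof.
move=> mJ sJ scW Xx ax.
have scW' : lz_scalar Z lz (J' :^ p2 x)%G (pact (s, p2 x) W).
  move=> k z; rewrite mem_conjg => Jk Zz; rewrite /pact /= conjMg.
  have [Zzx <-] := lz_twist Xx ax Zz.
  by rewrite (p2V TP) // in Zzx *; rewrite scW // map_mxZ.
split=> //; have [C uC hC] := tr_twist TR Xx ax; exists C => // g Jg.
have mJx := matchedJ mJ Xx; have sJx := AtJ Xx ax sJ.
have [_ _ mE] := mJ; have [sJA _ _] := mJx.
have [Xy yE] := sec1P TP (subsetP sJA g Jg); move: (sec1 _ _ _) Xy yE => y Xy yE.
have Jy : p1 y \in (J :^ p1 x)%G by rewrite yE.
have Xyx : (y ^ x^-1)%g \in X by rewrite groupJ ?groupV.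
have Jyx : p1 (y ^ x^-1)%g \in J.
  by rewrite (p1J TP) ?groupV // (p1V TP) // -mem_conjg.
rewrite -yE (liftE TP mJx (extends_sub sJx)) // /pact /=.
rewrite -(p1V TP) // -(p1J TP) ?groupV // (liftE TP mJ (extends_sub sJ)) //.
rewrite map_kron -!kronM mul1mx mulmx1 hC //; last exact: (subsetP sJx).
by rewrite (p2J TP) ?groupV // (p2V TP).
Qed.

Lemma corr_pact (J : {group gT}) (J' : {group kT}) chi psi s x :
  matched X A K p1 p2 J J' -> J \subset At -> corr J J' chi psi ->
  x \in X -> (s, p1 x) \in gstab Gam A N theta ->
  corr (J :^ p1 x)%G (J' :^ p2 x)%G (bact (s, p1 x) chi) (bact (s, p2 x) psi).
Proof.
move=> mJ sJ [e [W [irrW scW affW affl]]] Xx ax.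
have [scW' [C uC hC]] := lift_pact mJ sJ scW Xx ax.
exists e, (pact_repr W (s, p2 x)); split=> //.
- exact: (pact_irr (s, p2 x) irrW).
- exact: (affords_pact (s, p2 x) affW).
apply: affords_char_poly (affords_pact (s, p1 x) affl) => g Jg.
by apply: char_poly_simmx (hC g Jg); rewrite kron_unit ?unitmx1.
Qed.

End Transfer.

(** * Vertices *)

Section Vertices.

Variables (p : nat) (S : modular_system p) (Gam : galois_group S).
Local Notation F := (msF S).
Variables (gT kT xT : finGroupType).
Variables (X : {group xT}) (A N : {group gT}) (K Z : {group kT}).
Variables (p1 : xT -> gT) (p2 : xT -> kT).
Variables (m : nat) (V : mx_representation F N m) (R : xT -> 'M[F]_m) (lz : kT -> F).
Variables (theta : bfun S gT) (lam : bfun S kT).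
Hypothesis TR : triple_transfer Gam X A K Z p1 p2 V R lz theta lam.
Local Notation At := (stab Gam A N theta).

Let TP := tr_TP TR.
Let sNA : N \subset A. Proof. by case: (tr_triple TR). Qed.
Let absV : mx_absolutely_irreducible V.
Proof. by apply: (sub_splitting TR sNA); apply: (tr_irrV TR). Qed.
Let m_gt0 : (0 < m)%N. Proof. by case: (mx_abs_irrP absV). Qed.

Variables (J D : {group gT}) (J' D' : {group kT}).
Hypotheses (mJ : matched X A K p1 p2 J J') (sJ : J \subset At).
Hypotheses (mD : matched X A K p1 p2 D D') (sDJ : D \subset J).

Let sNJ : N \subset J. Proof. by case: (matched_sub TP mJ). Qed.
Let sJA : J \subset A. Proof. by case: mJ. Qed.
Let sJK : J' \subset K. Proof. by case: mJ. Qed.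
Let sND : N \subset D. Proof. by case: (matched_sub TP mD). Qed.
Let sZD : Z \subset D'. Proof. by case: (matched_sub TP mD). Qed.
Let extJ := extends_sub TR sJ.

Lemma matched_subset : D' \subset J'.
Proof.
have [_ sDK mDE] := mD; have [_ _ mJE] := mJ.
apply/subsetP=> k Dk; have [x Xx xk] := p2_onto TP (subsetP sDK k Dk).
by rewrite -xk -mJE // (subsetP sDJ) // mDE // xk.
Qed.

Let rcosetN c g : c \in rcosets D J -> g \in N -> (c :* g)%g = c.
Proof.
case/rcosetsP=> y Jy -> Ng; rewrite -rcosetM conjgCV rcosetM rcoset_id //.
rewrite (subsetP sND) // memJ_norm // groupV.
by have /andP[_ /subsetP] := normal_N TR sNJ sJA; apply.
Qed.

Let rcosetZ c z : c \in rcosets D' J' -> z \in Z -> (c :* z)%g = c.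
Proof.
case/rcosetsP=> y Jy -> Zz; rewrite -rcosetM (J'_cent TR mJ sJ Jy Zz) rcosetM.
by rewrite rcoset_id // (subsetP sZD).
Qed.

Let rcosetJ (hT : finGroupType) (E L : {group hT}) c g :
  c \in rcosets E L -> g \in L -> (c :* g)%g \in rcosets E L.
Proof.
by case/rcosetsP=> y Ly -> Lg; apply/rcosetsP; exists (y * g)%g; rewrite ?groupM ?rcosetM.
Qed.

Let memJ x : x \in X -> (p1 x \in J) = (p2 x \in J').
Proof. by case: mJ => _ _; apply. Qed.

Let memD x : x \in X -> (p1 x \in D) = (p2 x \in D').
Proof. by case: mD => _ _; apply. Qed.

Let sec1J g : g \in J -> [/\ sec1 X p1 g \in X, p1 (sec1 X p1 g) = g & p2 (sec1 X p1 g) \in J'].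
Proof.
move=> Jg; have [Xg gE] := sec1P TP (subsetP sJA g Jg).
by rewrite -memJ // gE.
Qed.

Let sec2J k : k \in J' -> [/\ sec2 X p2 k \in X, p2 (sec2 X p2 k) = k & p1 (sec2 X p2 k) \in J].
Proof.
move=> Jk; have [Xk kE] := sec2P TP (subsetP sJK k Jk).
by rewrite memJ // kE.
Qed.

Let same_rcoset1 c x y : c \in rcosets D J -> x \in X -> y \in X ->
  p1 x \in J -> p2 x = p2 y -> (c :* p1 x)%g = (c :* p1 y)%g.
Proof.
move=> Ic Xx Xy Jx xy; have [z [Xz z1] ->] := same_p2 TP Xx Xy xy.
by rewrite (p1M TP) // rcosetM (rcosetN (rcosetJ Ic Jx)) // (p1N TP).
Qed.

Let same_rcoset2 c x y : c \in rcosets D' J' -> x \in X -> y \in X ->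
  p2 x \in J' -> p1 x = p1 y -> (c :* p2 x)%g = (c :* p2 y)%g.
Proof.
move=> Ic Xx Xy Jx xy; have [z [Xz z1] ->] := same_p1 TP Xx Xy xy.
by rewrite (p2M TP) // rcosetM (rcosetZ (rcosetJ Ic Jx)) // (p2Z TP).
Qed.

(** N fixes the cosets of D, so the matrices of a decomposition of 1 for the lift commute with 1 (x)
    V and have the form b (x) 1. The matrices b serve for W over the same set of cosets, on which J'
    acts through X. Conversely M |-> M (x) 1 carries a decomposition for W to one for the lift. *)
Lemma lift_rel_projective e (W : mx_representation F J' e) (scW : lz_scalar Z lz J' W) :
  rel_projective (lift_repr TP mJ extJ scW) D <-> rel_projective W D'.
Proof.
have one_neq0 : 1%:M != 0 :> 'M[F]_m by rewrite -mxrank_eq0 mxrank1 -lt0n.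
split=> [/(rel_projective_higman sDJ)[M [hM sM]]|].
  pose i0 := Ordinal m_gt0.
  pose b c : 'M[F]_e := \matrix_(i, j) M c (mxvec_index i i0) (mxvec_index j i0).
  have bE c : c \in rcosets D J -> M c = kron (b c) 1%:M.
    move=> Ic; have [|t tE] := @kron_comm F gT N m V e e (M c) absV.
      move=> x Nx; have := hM c x Ic (subsetP sNJ x Nx).
      by rewrite rcosetN //= (liftN TP mJ extJ) ?repr_mx1.
    rewrite tE; congr (kron _ _); apply/matrixP=> i j.
    by rewrite mxE tE kronE mxE eqxx mulr1.
  pose act (c : {set gT}) k := (c :* p1 (sec2 X p2 k))%g.
  have DI : (D : {set gT}) \in rcosets D J by apply/rcosetsP; exists 1%g; rewrite // mulg1.
  apply: (@transitive_rel_projective p S kT J' e W D' _ act (rcosets D J) D b) => //.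
  - by move=> c k Ic Jk; have [_ _ Jp] := sec2J Jk; apply: rcosetJ.
  - move=> c Ic; have [X1 E1 J1] := sec2J (group1 J').
    by rewrite /act (same_rcoset1 Ic X1 (group1 X)) ?(p2_1 TP) // (p1_1 TP) rcoset1.
  - move=> k l Jk Jl c Ic; have [Xk kE Jpk] := sec2J Jk; have [Xl lE Jpl] := sec2J Jl.
    have [Xkl klE Jpkl] := sec2J (groupM Jk Jl).
    rewrite /act -rcosetM -(p1M TP) //; apply: same_rcoset1 => //; first exact: groupM.
    by rewrite (p2M TP) // klE kE lE.
  - move=> _ /rcosetsP[g Jg ->]; have [Xg gE Jpg] := sec1J Jg.
    exists (p2 (sec1 X p1 g)) => //; have [Xk kE Jpk] := sec2J Jpg.
    by rewrite /act (same_rcoset1 DI Xk Xg) // gE.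
  - move=> k Jk cE; have [Xk kE Jpk] := sec2J Jk; rewrite -kE -memD // -cE.
    exact: rcoset_refl.
  - move=> c k Ic Jk; have [Xk kE Jpk] := sec2J Jk.
    have Iac := rcosetJ Ic Jpk; have := hM c _ Ic Jpk.
    rewrite /= (liftE TP mJ extJ) // !bE // -!kronM kE mulmx1 mul1mx.
    by apply: kron_inj; apply: (R_neq0 TP absV extJ).
  apply: (kron_inj one_neq0); rewrite kron1 kron_suml -[RHS]sM.
  by apply: eq_bigr => c Ic; rewrite bE.
move/(rel_projective_higman matched_subset) => [M [hM sM]].
pose act (c : {set kT}) g := (c :* p2 (sec1 X p1 g))%g.
have DI : (D' : {set kT}) \in rcosets D' J' by apply/rcosetsP; exists 1%g; rewrite // mulg1.
apply: (@transitive_rel_projective p S gT J _ _ D _ act (rcosets D' J') D'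
   (fun c => kron (M c) 1%:M)) => //.
- by move=> c k Ic Jk; have [_ _ Jp] := sec1J Jk; apply: rcosetJ.
- move=> c Ic; have [X1 E1 J1] := sec1J (group1 J).
  by rewrite /act (same_rcoset2 Ic X1 (group1 X)) ?(p1_1 TP) // (p2_1 TP) rcoset1.
- move=> k l Jk Jl c Ic; have [Xk kE Jpk] := sec1J Jk; have [Xl lE Jpl] := sec1J Jl.
  have [Xkl klE Jpkl] := sec1J (groupM Jk Jl).
  rewrite /act -rcosetM -(p2M TP) //; apply: same_rcoset2 => //; first exact: groupM.
  by rewrite (p1M TP) // klE kE lE.
- move=> _ /rcosetsP[g Jg ->]; have [Xg gE Jpg] := sec2J Jg.
  exists (p1 (sec2 X p2 g)) => //; have [Xk kE Jpk] := sec1J Jpg.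
  by rewrite /act (same_rcoset2 DI Xk Xg) // gE.
- move=> k Jk cE; have [Xk kE Jpk] := sec1J Jk; rewrite -kE memD // -cE.
  exact: rcoset_refl.
- move=> c k Ic Jk; have [Xk kE Jpk] := sec1J Jk.
  by rewrite /= /lift_mx -!kronM mulmx1 mul1mx hM.
by rewrite -kron_suml sM kron1.
Qed.

End Vertices.

Lemma exists_min_group (hT : finGroupType) (Y : {group hT}) (P : {group hT} -> Prop) :
  P Y -> exists2 W : {group hT}, W \subset Y & P W /\
    forall L : {group hT}, L \proper W -> ~ P L.
Proof.
have [k] := ubnP #|Y|; elim: k Y => // k IH Y ltk PY.
case: (classic (exists2 L : {group hT}, L \proper Y & P L)) => [[L pL PL]|none].
  have [|W sWL [PW minW]] := IH L _ PL.
    by apply: leq_trans (proper_card pL) _; rewrite -ltnS.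
  by exists W => //; apply: subset_trans sWL (proper_sub pL).
by exists Y => //; split=> // L pL PL; apply: none; exists L.
Qed.

(** * Vertices and stabilizers of corresponding characters *)

Section CorrespondingStabilizers.

Variables (p : nat) (S : modular_system p) (Gam : galois_group S).
Local Notation F := (msF S).
Variables (gT kT xT : finGroupType).
Variables (X : {group xT}) (A N : {group gT}) (K Z : {group kT}).
Variables (p1 : xT -> gT) (p2 : xT -> kT).
Variables (m : nat) (V : mx_representation F N m) (R : xT -> 'M[F]_m) (lz : kT -> F).
Variables (theta : bfun S gT) (lam : bfun S kT).
Hypothesis TR : triple_transfer Gam X A K Z p1 p2 V R lz theta lam.
Local Notation At := (stab Gam A N theta).
Local Notation matched := (matched X A K p1 p2).
Local Notation lift_mx := (lift_mx X p1 p2 R).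
Local Notation corr := (corr X Z p1 p2 R lz).

Let TP := tr_TP TR.
Let sNA : N \subset A. Proof. by case: (tr_triple TR). Qed.
Let absV : mx_absolutely_irreducible V.
Proof. by apply: (sub_splitting TR sNA); apply: (tr_irrV TR). Qed.
Let m_gt0 : (0 < m)%N. Proof. by case: (mx_abs_irrP absV). Qed.

Lemma matched_sub1 (J D : {set gT}) (J' D' : {set kT}) :
  matched J J' -> matched D D' -> D' \subset J' -> D \subset J.
Proof.
move=> [_ _ mJ] [sDA _ mD] sDJ; apply/subsetP=> g Dg.
have [x Xx xg] := p1_onto TP (subsetP sDA g Dg).
by rewrite -xg mJ // (subsetP sDJ) // -mD // xg.
Qed.

Lemma matched_sub2 (J D : {set gT}) (J' D' : {set kT}) :
  matched J J' -> matched D D' -> D \subset J -> D' \subset J'.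
Proof.
move=> [_ _ mJ] [_ sDK mD] sDJ; apply/subsetP=> k Dk.
have [x Xx xk] := p2_onto TP (subsetP sDK k Dk).
by rewrite -xk -mJ // (subsetP sDJ) // mD // xk.
Qed.

Lemma matched_eq1 (J D : {set gT}) (J' D' : {set kT}) :
  matched J J' -> matched D D' -> D' = J' -> D = J.
Proof.
by move=> mJ mD DJ; apply/eqP; rewrite eqEsubset (matched_sub1 mJ mD) ?(matched_sub1 mD mJ) ?DJ.
Qed.

Lemma matched_eq2 (J D : {set gT}) (J' D' : {set kT}) :
  matched J J' -> matched D D' -> D = J -> D' = J'.
Proof.
by move=> mJ mD DJ; apply/eqP; rewrite eqEsubset (matched_sub2 mJ mD) ?(matched_sub2 mD mJ) ?DJ.
Qed.

(** W is projective relative to the partner Y of D N; V1 is taken minimal inside Y with this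
    property. Then the lift is projective relative to the partner X1 of V1 Z, which lies in D N. By
    [rel_projective_meet] and the minimality of D, some conjugate of X1 contains D, hence D N, and
    comparing orders gives X1 = D N. *)
Lemma corr_vertex (J : {group gT}) (J' : {group kT}) chi psi (D : {group gT}) :
  matched J J' -> J \subset At -> corr J J' chi psi -> vertex J chi D ->
  exists2 V1 : {group kT}, vertex J' psi V1 &
    {in X, forall x, (p1 x \in (D * N)%g) = (p2 x \in (V1 * Z)%g)}.
Proof.
move=> mJ sJ [e [W [irrW scW affW affl]]] [n [r [irr aff [sDJ projD minD]]]].
have [sNJ sZJ] := matched_sub TP mJ; have [sJA sJK _] := mJ.
have nNJ := normal_N TR sNJ sJA; have extJ := extends_sub TR sJ.
have irrl := lift_irr TP absV mJ extJ scW nNJ irrW.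
have absl := sub_splitting TR sJA irrl.
have sim := IBr_rsim absl (sub_splitting TR sJA irr) affl aff.
have nND : D \subset 'N(N) by apply: subset_trans sDJ _; case/andP: nNJ.
pose DN := (D <*> N)%G.
have sDNJ : DN \subset J by rewrite join_subG sDJ.
have sNDN : N \subset DN by apply: joing_subr.
have [Y mY] := matched_exists TR sNDN (subset_trans sDNJ sJA).
have sYJ : Y \subset J' := matched_sub2 mJ mY sDNJ.
have projY : rel_projective W Y.
  apply/(lift_rel_projective TR mJ sJ mY sDNJ scW).
  apply: rel_projective_mono (joing_subl D N) _.
  exact: rel_projective_rsim sDJ (mx_rsim_sym sim) projD.
have [V1 sVY [projV minV]] := exists_min_group projY.
exists V1; first by exists e, W; split=> //; split=> //; apply: subset_trans sVY sYJ.
pose VZ := (V1 <*> Z)%G.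
have [_ sZY] := matched_sub TP mY.
have sVZY : VZ \subset Y by rewrite join_subG sVY.
have [X1 mX] := matched_exists2 TR (joing_subr V1 Z) (subset_trans sVZY (subset_trans sYJ sJK)).
have sX1DN : X1 \subset DN := matched_sub1 mY mX sVZY.
have sX1J := subset_trans sX1DN sDNJ.
have projX : rel_projective (lift_repr TP mJ extJ scW) X1.
  apply/(lift_rel_projective TR mJ sJ mX sX1J scW).
  exact: rel_projective_mono (joing_subl V1 Z) projV.
have projD' := rel_projective_rsim sDJ (mx_rsim_sym sim) projD.
have [j Jj projI] := rel_projective_meet absl sDJ sX1J projD' projX.
have sDXj : D \subset (X1 :^ j)%g.
  apply: contraT => nsD; case: (minD (D :&: X1 :^ j)%G).
    rewrite properE subsetIl; apply: contra nsD => /subset_trans; apply; exact: subsetIr.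
  apply: rel_projective_rsim sim projI.
  by apply: subset_trans (subsetIl _ _) sDJ.
have XDN : X1 :=: DN.
  apply/eqP; rewrite eqEcard sX1DN -(cardJg X1 j) subset_leq_card //.
  rewrite join_subG sDXj.
  have [sNX1 _] := matched_sub TP mX.
  by rewrite /= -(normsP (normal_norm nNJ) j Jj) conjSg.
move=> x Xx; have [_ _ hX] := mX; have := hX x Xx.
rewrite XDN /= norm_joinEl // => ->; rewrite norm_joinEl //.
have sKl : V1 \subset stab Gam K Z lam.
  apply/subsetP=> k Vk; apply: (J'_Kl TR mJ sJ).
  by apply: (subsetP sYJ); apply: (subsetP sVY).
exact: subset_trans sKl (subset_trans (tr_cent TR) (cent_sub Z)).
Qed.

(** On N the lift is a multiple of V and its twist a multiple of the twist of V. An isomorphism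
    between the two has a nonzero block, and by irreducibility this block is an isomorphism from V
    to its twist. *)
Lemma stabilizes_theta (J : {group gT}) (J' : {group kT}) chi psi s x :
  matched J J' -> J \subset At -> corr J J' chi psi -> x \in X ->
  (J :^ p1 x)%g = J -> bact (s, p1 x) chi = chi ->
  (s, p1 x) \in gstab Gam A N theta.
Proof.
move=> mJ sJ [e [W [irrW scW affW affl]]] Xx JE chiE.
have [sNJ sZJ] := matched_sub TP mJ; have [sJA sJK _] := mJ.
have nNJ := normal_N TR sNJ sJA; have extJ := extends_sub TR sJ.
pose L := lift_repr TP mJ extJ scW.
have absl := sub_splitting TR sJA (lift_irr TP absV mJ extJ scW nNJ irrW).
have prr : mx_repr J (pact (s, p1 x) L).
  by have := pact_mx_repr L (s, p1 x); rewrite /= JE.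
have affr : affords J (MxRepresentation prr) chi.
  by rewrite -{1}chiE => y; have := affords_pact (s, p1 x) affl y; rewrite /= JE.
have [B _ frB hB] := affords_IBr_rsim absl affl affr.
have nzB : B != 0.
  apply: contraTneq frB => ->; rewrite -row_leq_rank mxrank0 -ltnNge.
  by rewrite muln_gt0 (irr_deg_gt0 irrW).
have NE : (N :^ p1 x)%g = N.
  have /andP[_ nN] := normal_N TR sNA (subxx A).
  by apply: (normsP nN); apply: (p1A TP).
have Nx n : n \in N -> (n ^ (p1 x)^-1)%g \in N by rewrite -mem_conjg NE.
have [i [k [j [l nzij]]]] : exists i k j l, B (mxvec_index i k) (mxvec_index j l) != 0.
  apply: NNPP => h; case/eqP: nzB; apply: kronP => i j k l; rewrite mxE.
  by apply: NNPP => /eqP nz; apply: h; exists i, k, j, l.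
pose C := \matrix_(k, l) B (mxvec_index i k) (mxvec_index j l) : 'M[F]_m.
have homC : {in N, forall n, V n *m C = C *m pact (s, p1 x) V n}.
  move=> n Nn; apply: (kron1_hom_block i j).
  have := hB n (subsetP sNJ n Nn); rewrite /= (liftN TP mJ extJ) ?repr_mx1 //.
  rewrite /pact /= (liftN TP mJ extJ) ?repr_mx1 ?Nx //.
  by rewrite map_kron map_mx1.
have nzC : C != 0.
  by apply: contraNneq nzij => /matrixP/(_ k l); rewrite !mxE => ->.
have uC : C \in unitmx.
  by rewrite -row_free_unit; apply: hom_irr_free (tr_irrV TR) nzC homC.
apply/gstabP; split=> //; first exact: (p1A TP).
apply: (@affords_uniq p S gT N m (pact (s, p1 x) V)).
  by move=> n; have := affords_pact (s, p1 x) (tr_affV TR) n; rewrite /= NE.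
apply: affords_char_poly (tr_affV TR) => n Nn; apply/esym.
by apply: char_poly_simmx uC _; rewrite homC.
Qed.

Lemma stabilizes_lam (J : {group gT}) (J' : {group kT}) chi psi s x :
  matched J J' -> J \subset At -> corr J J' chi psi -> x \in X ->
  (J' :^ p2 x)%g = J' -> bact (s, p2 x) psi = psi ->
  (s, p2 x) \in gstab Gam K Z lam.
Proof.
move=> mJ sJ [e [W [irrW scW affW affl]]] Xx JE psiE.
have [sNJ sZJ] := matched_sub TP mJ.
have absW := lift_absV TR mJ sJ scW irrW.
have prr : mx_repr J' (pact (s, p2 x) W).
  by have := pact_mx_repr W (s, p2 x); rewrite /= JE.
have affr : affords J' (MxRepresentation prr) psi.
  by rewrite -{1}psiE => y; have := affords_pact (s, p2 x) affW y; rewrite /= JE.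
have [B _ frB hB] := affords_IBr_rsim absW affW affr.
have nzB : B != 0.
  apply: contraTneq frB => ->; rewrite -row_leq_rank mxrank0 -ltnNge.
  exact: irr_deg_gt0 irrW.
have conjZ y z : y \in X -> z \in Z -> (z ^ p2 y)%g \in Z.
  move=> Xy Zz; have [w Xw [<- w1]] := p2_ontoZ TP Zz.
  by rewrite -(p2J TP) // (p2Z TP) ?groupJ // (p1J TP) // w1 conj1g.
have Zx z : z \in Z -> (z ^ (p2 x)^-1)%g \in Z.
  by rewrite -(p2V TP) // => Zz; rewrite conjZ ?groupV.
have ZE : (Z :^ p2 x)%g = Z.
  apply/eqP; rewrite eqEcard cardJg leqnn andbT.
  by apply/subsetP=> _ /imsetP[z Zz ->]; apply: conjZ.
have Wz z : z \in Z -> W z = (lz z)%:M.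
  by move=> Zz; rewrite -[z]mul1g scW // repr_mx1 scalemx1 mul1g.
have lzE z : z \in Z -> gal_F s (lz (z ^ (p2 x)^-1)%g) = lz z.
  move=> Zz; have := hB z (subsetP sZJ z Zz); rewrite /= /pact /= !Wz ?Zx //.
  rewrite map_scalar_mx mul_scalar_mx mul_mx_scalar => /eqP.
  by rewrite eq_sym -subr_eq0 -scalerBl scaler_eq0 (negPf nzB) orbF subr_eq0 => /eqP.
apply/gstabP; split=> //; first exact: (p2K TP).
apply: (@affords_uniq p S kT Z 1 (pact (s, p2 x) (lz_repr TR))).
  by move=> n; have := affords_pact (s, p2 x) (tr_lam TR) n; rewrite /= ZE.
apply: affords_char_poly (tr_lam TR) => z Zz.
by rewrite /pact /= map_scalar_mx lzE.
Qed.

Lemma gstab_corr (B J : {group gT}) (B' J' : {group kT}) chi psi s x :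
  matched B B' -> matched J J' -> J \subset At -> corr J J' chi psi -> x \in X ->
  ((s, p1 x) \in gstab Gam B J chi) = ((s, p2 x) \in gstab Gam B' J' psi).
Proof.
move=> [_ _ mB] mJ sJ c Xx; have mJx := matchedJ TR mJ Xx.
apply/idP/idP=> /gstabP[Bx JE E]; apply/gstabP.
  have JE' : (J' :^ p2 x)%G = J' by apply/group_inj/(matched_eq2 mJ mJx JE).
  split; [by rewrite -mB | by rewrite -[RHS]/(gval J') -[in RHS]JE' | ].
  have a := stabilizes_theta mJ sJ c Xx JE E; have := corr_pact TR mJ sJ c Xx a.
  rewrite JE' E (group_inj JE : (J :^ p1 x)%G = J) => c'.
  exact: (corr_fun TR mJ sJ c' c).
have JE' : (J :^ p1 x)%G = J by apply/group_inj/(matched_eq1 mJ mJx JE).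
split; [by rewrite mB | by rewrite -[RHS]/(gval J) -[in RHS]JE' | ].
have a := stabilizes_lam mJ sJ c Xx JE E; rewrite -(tr_gstab TR) // in a.
have := corr_pact TR mJ sJ c Xx a.
rewrite JE' E (group_inj JE : (J' :^ p2 x)%G = J') => c'.
exact: (corr_inj TR mJ sJ c' c).
Qed.

Lemma Htriple_corr (G J : {group gT}) (G' J' : {group kT}) chi psi :
  matched G G' -> matched J J' -> J \subset At -> corr J J' chi psi ->
  Htriple Gam G' J' psi -> Htriple Gam G J chi.
Proof.
move=> mG mJ sJ c [sJG _ /eqP/orb_stabP stG]; split.
- exact: matched_sub1 mG mJ sJG.
- exact: (corr_IBr TR mJ sJ c).
apply/eqP/orb_stabP=> g Gg; have [sGA _ mGE] := mG.
have [x Xx xg] := p1_onto TP (subsetP sGA g Gg); rewrite -xg in Gg *.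
rewrite mGE // in Gg; have [JE [s sE]] := stG _ Gg.
have : (s, p2 x) \in gstab Gam G' J' psi by apply/gstabP.
rewrite -(gstab_corr s mG mJ sJ c Xx) => /gstabP[_ -> E]; split=> //.
by exists s.
Qed.

End CorrespondingStabilizers.

Lemma invmx_mul (E : fieldType) n (A B : 'M[E]_n) :
  A \in unitmx -> B \in unitmx -> invmx (A *m B) = invmx B *m invmx A.
Proof.
move=> uA uB; have uAB : A *m B \in unitmx by rewrite unitmx_mul uA.
by apply: (can_inj (mulKmx uAB)); rewrite mulmxV // mulmxA mulmxK // mulmxV.
Qed.

Lemma class_joing_cycle (hT : finGroupType) (J : {group hT}) x :
  x \in 'N(J) -> (x ^: (J <*> <[x]>) = x ^: J)%g.
Proof.
move=> nJx; apply/eqP; rewrite eqEsubset andbC classS ?joing_subl //=.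
apply/subsetP=> _ /imsetP[y + ->].
rewrite joingC norm_joinEl ?cycle_subG // => /mulsgP[_ j /cycleP[i ->] Jj ->].
by rewrite conjgM (conjgE x) commuteX // mulKg memJ_class.
Qed.

Lemma sub_stab p (S : modular_system p) (Gam : galois_group S) (gT : finGroupType)
    (B J : {group gT}) (chi : bfun S gT) :
  IBr J chi -> J \subset B -> J \subset stab Gam B J chi.
Proof.
move=> [n [r [irr aff]]] sJB; apply/subsetP=> g Jg; rewrite stab_gstab.
have JE : (J :^ g)%g = J by rewrite conjGid.
apply/gstabP; split=> //; first exact: (subsetP sJB).
apply: (@affords_uniq p S gT J n (pact ((1%g : Gam), g) r)).
  by move=> n0; have := affords_pact ((1%g : Gam), g) aff n0; rewrite /= JE.
apply: affords_char_poly aff => x Jx; apply/esym.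
apply: (@char_poly_simmx _ _ _ _ (r g^-1%g)); first by rewrite repr_mx_unit ?groupV.
rewrite /pact /= map_mx_id; last exact: gal_F1.
by rewrite -!repr_mxM ?groupV ?groupJ ?groupV // conjgE invgK mulKg.
Qed.

(** This brings the sets of [block_cond] to the form to which [class_sum_lift] applies. As x
    normalizes J, its class under J and x is its J-class, which stays in the stabilizer of chi;
    inside H this stabilizer is the one of phi. *)
Lemma class_joing_stab p (S : modular_system p) (Gam : galois_group S) (gT : finGroupType)
    (G J H M : {group gT}) (chi phi : bfun S gT) x :
  IBr J chi -> J \subset G -> gstab Gam H J chi = gstab Gam H M phi ->
  x \in stab Gam G J chi ->
  (x ^: (J <*> <[x]>) :&: H = x ^: J :&: stab Gam H M phi)%g.
Proof.
move=> Jchi sJG HE Tx; have sJT := sub_stab Gam Jchi sJG.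
rewrite class_joing_cycle; last first.
  by move: Tx; rewrite stab_gstab => /gstabP[_ /normP].
apply/setP=> g; rewrite !inE; case: imsetP => //= -[j Jj gE].
have : g \in stab Gam G J chi by rewrite gE groupJ // (subsetP sJT).
have := stab_gstab Gam H M phi g; rewrite [in LHS]inE => ->.
rewrite stab_gstab -HE => /gstabP[_ gJ gchi]; apply/idP/gstabP=> [Hg|[]//].
by split.
Qed.

(** * Tensoring projective representations with R and lifting the order relations *)

Section LiftProjective.

Variables (p : nat) (S : modular_system p) (Gam : galois_group S).
Local Notation F := (msF S).
Variables (gT kT xT : finGroupType).
Variables (X : {group xT}) (A N : {group gT}) (K Z : {group kT}).
Variables (p1 : xT -> gT) (p2 : xT -> kT).
Variables (m : nat) (V : mx_representation F N m) (R : xT -> 'M[F]_m) (lz : kT -> F).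
Variables (theta : bfun S gT) (lam : bfun S kT).
Hypothesis TR : triple_transfer Gam X A K Z p1 p2 V R lz theta lam.
Local Notation At := (stab Gam A N theta).
Local Notation matched := (matched X A K p1 p2).
Local Notation lift_mx := (lift_mx X p1 p2 R).
Local Notation corr := (corr X Z p1 p2 R lz).

Let TP := tr_TP TR.
Let sNA : N \subset A. Proof. by case: (tr_triple TR). Qed.
Let absV : mx_absolutely_irreducible V.
Proof. by apply: (sub_splitting TR sNA); apply: (tr_irrV TR). Qed.
Let m_gt0 : (0 < m)%N. Proof. by case: (mx_abs_irrP absV). Qed.

Section OneSide.

Variables (G J : {group gT}) (G' J' : {group kT}) (chi : bfun S gT) (psi : bfun S kT).
Hypotheses (mG : matched G G') (mJ : matched J J') (sJ : J \subset At) (sJG : J \subset G).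
Hypothesis (cor : corr J J' chi psi).
Local Notation T := (stab Gam G J chi).
Local Notation T' := (stab Gam G' J' psi).

Lemma matched_stab : matched T T'.
Proof.
have [sGA sGK _] := mG; split.
- by apply: subset_trans sGA; apply/subsetP=> g; rewrite inE => /andP[].
- by apply: subset_trans sGK; apply/subsetP=> g; rewrite inE => /andP[].
by move=> x Xx; rewrite !stab_gstab (gstab_corr TR _ mG mJ sJ cor Xx).
Qed.

Lemma stab_sub_At : T \subset At.
Proof.
have [sGA _ _] := mG; apply/subsetP=> g; rewrite !stab_gstab => /gstabP[Gg JE E].
have [x Xx xg] := p1_onto TP (subsetP sGA g Gg); rewrite -xg in JE E *.
exact: (stabilizes_theta TR mJ sJ cor Xx JE E).
Qed.

Lemma J_sub_T : J \subset T.
Proof. exact: sub_stab (corr_IBr TR mJ sJ cor) sJG. Qed.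

Lemma J'_sub_T' : J' \subset T'.
Proof. exact: (matched_sub2 TR matched_stab mJ J_sub_T). Qed.

Variables (e : nat) (P : kT -> 'M[F]_e).
Hypothesis assP : associated T' J' psi P.

Let mT := matched_stab.
Let extT := extends_sub TR stab_sub_At.

(** On J' the map P affords psi and so is isomorphic to W, where Z acts by lz; the product rule of
    an associated projective representation extends this to all of T'. *)
Lemma assoc_lz_scalar : lz_scalar Z lz T' P.
Proof.
have [rP affP mulP] := assP; have [_ sZJ] := matched_sub TP mJ.
have [d [W [irrW scW affW affl]]] := cor.
have absW := lift_absV TR mJ sJ scW irrW.
have affP' : affords J' (MxRepresentation rP) psi := affP.
have [B _ frB hB] := mx_rsim_sym (affords_IBr_rsim absW affW affP').
have scP := lz_scalar_mono TP mJ frB hB scW.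
move=> k z Tk Zz; have Jz := subsetP sZJ z Zz.
have /= := scP 1%g z (group1 J') Zz; rewrite mul1g => Pz.
by rewrite -(mulP k z Tk Jz).1 Pz -scalemxAr; have [-> _] := rP; rewrite mulmx1.
Qed.

Lemma lift_associated : associated T J chi (lift_mx P).
Proof.
have [rP affP mulP] := assP; have scP := assoc_lz_scalar.
have sJT := J_sub_T; have sJT' := J'_sub_T'.
have [d [W [irrW scW affW affl]]] := cor.
have absW := lift_absV TR mJ sJ scW irrW.
have simW := affords_IBr_rsim absW affW (affP : affords J' (MxRepresentation rP) psi).
have scJ : lz_scalar Z lz J' P by move=> k z Jk; apply: scP; apply: (subsetP sJT').
have irrP := mx_rsim_irr simW irrW.
have extJ := extends_sub TR sJ.
pose rPP := MxRepresentation rP.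
split.
- exact: (@lift_mx_repr _ _ _ _ _ _ _ _ _ _ _ TP _ _ _ _ _ _ mJ extJ _ rPP scJ).
- exact: affords_rsim ((lift_rsim TR mJ sJ (W1 := W) (W2 := rPP) scW scJ irrW irrP).2 simW) affl.
move=> g n Tg Jn; have Tn := subsetP sJT n Jn; have [sTA _ mTE] := mT.
have [Xx xg] := sec1P TP (subsetP sTA g Tg).
have [Xy yn] := sec1P TP (subsetP sTA n Tn).
have Tk : p2 (sec1 X p1 g) \in T' by rewrite -mTE // xg.
have Jl : p2 (sec1 X p1 n) \in J' by case: mJ => _ _ <- //; rewrite yn.
rewrite -xg -yn -!(p1M TP) // !(liftE TP mT extT) ?(p1M TP) ?xg ?yn ?groupM //.
have [PM MP] := mulP _ _ Tk Jl.
by rewrite -!kronM !(p2M TP) // PM MP !(extM extT) ?xg ?yn.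
Qed.

Lemma lift_proj_rep al : proj_rep T' P al ->
  proj_rep T (lift_mx P) (fun g h => al (p2 (sec1 X p1 g)) (p2 (sec1 X p1 h))).
Proof.
case=> P1 uP nzal mulP; have scP := assoc_lz_scalar; have [sTA _ mTE] := mT.
have secT g : g \in T ->
    [/\ sec1 X p1 g \in X, p1 (sec1 X p1 g) = g & p2 (sec1 X p1 g) \in T'].
  by move=> Tg; have [Xx xg] := sec1P TP (subsetP sTA g Tg); rewrite -mTE // xg.
split.
- rewrite -(p1_1 TP) (liftE TP mT extT) ?(p1_1 TP) ?group1 //.
  by rewrite (p2_1 TP) P1 (ext1 extT) kron1.
- move=> g Tg; have [Xx xg Tx] := secT g Tg.
  by rewrite /lift_mx kron_unit ?uP // (R_unit TP extT) ?xg.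
- by move=> g h /secT[_ _ Tx] /secT[_ _ Ty]; apply: nzal.
move=> g h Tg Th; have [Xx xg Tx] := secT g Tg; have [Xy yh Ty] := secT h Th.
rewrite -{3}xg -{3}yh -(p1M TP) // (liftE TP mT extT) ?groupM ?(p1M TP) ?xg ?yh ?groupM //.
by rewrite /lift_mx -kronM mulP // (p2M TP) // (extM extT) ?xg ?yh // kronZl.
Qed.

(** The twist of R is conjugate to R by C with no scalar, so the only scalar function left is that
    of P; the conjugating matrix combines C on the factor R with B on the factor P. *)
Lemma lift_is_mu s x mu : x \in X -> (s, p1 x) \in gstab Gam G J chi ->
  is_mu T' J' P (s, p2 x) mu ->
  is_mu T J (lift_mx P) (s, p1 x) (fun g => mu (p2 (sec1 X p1 g))).
Proof.
move=> Xx ax [nzmu muJ [B uB hB]]; have scP := assoc_lz_scalar; have [sTA _ mTE] := mT.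
have sJT := J_sub_T.
have secT g : g \in T ->
    [/\ sec1 X p1 g \in X, p1 (sec1 X p1 g) = g & p2 (sec1 X p1 g) \in T'].
  by move=> Tg; have [Xy yg] := sec1P TP (subsetP sTA g Tg); rewrite -mTE // yg.
split.
- by move=> g /secT[_ _ Ty]; apply: nzmu.
- move=> g n Tg Jn; have [Xy yg Ty] := secT g Tg.
  have [Xw wgn Tw] := secT (g * n)%g (groupM Tg (subsetP sJT n Jn)).
  set y := sec1 X p1 g in Xy yg Ty *; set w := sec1 X p1 (g * n)%g in Xw wgn Tw *.
  have -> : w = (y * (y^-1 * w))%g by rewrite mulKVg.
  rewrite (p2M TP) ?groupM ?groupV // muJ //; case: mJ => _ _ <-; rewrite ?groupM ?groupV //.
  by rewrite (p1M TP) ?groupV // (p1V TP) // yg wgn mulKg.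
have aA : (s, p1 x) \in gstab Gam A N theta.
  have [_ JE E] := gstabP _ _ _ _ _ ax.
  exact: (stabilizes_theta TR mJ sJ cor Xx JE E).
have [_ [C uC hC]] := lift_pact TR mT stab_sub_At scP Xx aA.
exists (invmx (kron 1%:M C) *m kron B 1%:M).
  by rewrite unitmx_mul unitmx_inv !kron_unit ?unitmx1.
have u1C : kron (1%:M : 'M_e) C \in unitmx by rewrite kron_unit ?unitmx1.
have uB1 : kron B (1%:M : 'M_m) \in unitmx by rewrite kron_unit ?unitmx1.
move=> g Tg; have [Xy yg Ty] := secT g Tg.
have Tgx : g \in (stab Gam G J chi :^ p1 x)%g.
  rewrite mem_conjg stab_gstab; rewrite stab_gstab in Tg.
  have -> : (1%g : Gam, (g ^ (p1 x)^-1))%g = ((1, g) ^ (s, p1 x)^-1)%g.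
    by rewrite [in RHS]/conjg; congr pair; rewrite /= ?mul1g ?mulVg.
  by rewrite groupJ // groupV.
have := hC g Tgx => /(canRL (mulKmx u1C)) ->.
rewrite invmx_mul ?unitmx_inv // invmxK -!mulmxA; congr (_ *m _); rewrite !mulmxA.
congr (_ *m _); rewrite /lift_mx hB // -kronZl.
by rewrite invmx_kron ?unitmx1 // invmx1 -!kronM mul1mx mulmx1.
Qed.

End OneSide.

Lemma sub_cent_At (J : {group gT}) : N \subset J -> 'C_A(J) \subset At.
Proof.
move=> sNJ; apply/subsetP=> c /setIP[Ac /centP cJ]; rewrite stab_gstab.
have nNA : c \in 'N(N).
  by have /andP[_ /subsetP] := normal_N TR sNA (subxx A); apply.
apply/gstabP; split=> //; first exact/normP.
apply/ffunP=> n; rewrite ffunE /= gal_K1.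
case: (boolP (n \in N)) => Nn; last first.
  have := tr_affV TR n; have := tr_affV TR (n ^ c^-1)%g.
  by rewrite memJ_norm ?groupV // (negPf Nn) /= => -> ->.
by rewrite conjgE invgK mulgA (cJ n (subsetP sNJ n Nn)) mulgK.
Qed.

(* An element of X over c in C_A(J) acts on V by a scalar, hence it commutes  *)
(* with the preimage of J: the commutators lie in Z and are killed by the     *)
(* faithful character lz.                                                     *)
Lemma lift_cent (J : {group gT}) (J' : {group kT}) x :
  matched J J' -> J \subset At -> x \in X -> p1 x \in 'C(J) ->
  p2 x \in 'C(J') /\ exists nu, R x = nu%:M.
Proof.
move=> mJ sJ Xx cx; have [sNJ sZJ] := matched_sub TP mJ; have [sJA sJK mJE] := mJ.
have extR := tr_ext TR.
have Atx : p1 x \in At.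
  by apply: (subsetP (sub_cent_At sNJ)); rewrite inE (p1A TP).
have [nu Rx] : exists nu, R x = nu%:M.
  apply/is_scalar_mxP/(mx_abs_irr_cent_scalar absV)/centgmxP=> n Nn.
  have [y Xy [yn y1]] := p1_ontoN TP Nn.
  have Aty : p1 y \in At by rewrite yn (subsetP (sNAt TR)).
  have Xyx : (y ^ x)%g \in X by rewrite groupJ.
  have ynx : p1 (y ^ x)%g = n.
    rewrite (p1J TP) // yn conjgE.
    by rewrite -(centP cx n (subsetP sNJ n Nn)) mulKg.
  have yx1 : p2 (y ^ x)%g = 1%g by rewrite (p2J TP) // y1 conj1g.
  have Ryx := extN extR Xyx yx1; have Ry := extN extR Xy y1.
  rewrite ynx in Ryx; rewrite yn in Ry; rewrite -{1}Ryx -Ry.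
  by rewrite -!(extM extR) // -?conjgC // ynx -yn.
split; last by exists nu.
apply/centP=> k Jk; have [y Xy yk] := p2_onto TP (subsetP sJK k Jk).
have Jy : p1 y \in J by rewrite mJE // yk.
have Aty := subsetP sJ _ Jy; pose w := [~ y, x]%g.
have Xw : w \in X by rewrite groupR.
have w1 : p1 w = 1%g.
  rewrite /w commgEl (p1M TP) ?groupV ?groupJ // (p1V TP) // (p1J TP) //.
  by rewrite conjgE -(centP cx _ Jy) mulKg mulVg.
have Zw := p2Z TP Xw w1.
have nzw := lz_neq0 extR Zw.
suff w2 : p2 w = 1%g.
  have w2E : p2 w = [~ p2 y, p2 x]%g.
    by rewrite /w !commgEl (p2M TP) ?groupV ?groupJ // (p2V TP) // (p2J TP).
  by rewrite -yk; apply/esym/commgP; rewrite -w2E w2.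
apply: (tr_faithful TR) => //.
have Rxy : R (x * y * w)%g = R (x * y)%g.
  by rewrite /w -commgC !(extM extR) // Rx scalar_mxC.
have Atxy : p1 (x * y)%g \in At by rewrite (p1M TP) ?groupM.
have Atw : p1 w \in At by rewrite w1.
have uxy : R (x * y)%g \in unitmx by rewrite (R_unit TP extR) ?groupM.
have : R w = 1%:M.
  apply: (can_inj (mulKmx uxy)); rewrite mulmx1 -{2}Rxy.
  by rewrite (extM extR (groupM Xx Xy) Xw).
rewrite (extZ extR) // => /matrixP/(_ (Ordinal m_gt0) (Ordinal m_gt0)).
by rewrite !mxE eqxx => /eqP; rewrite invr_eq1 => /eqP.
Qed.

(* The conjugates of x under the preimage of J project onto one class on each *)
(* side. Over a point of the class in A they form a coset of a p'-group; over *)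
(* a point of the class in K the sum of R is the same scalar.                 *)
Lemma class_sum_lift (J : {group gT}) (J' : {group kT}) x :
  matched J J' -> J \subset At -> x \in X -> p1 x \in At ->
  exists om : F, forall (D : {set gT}) (D' : {set kT}) e (P : kT -> 'M[F]_e)
      (L : gT -> 'M[F]_(e * m)),
    {in X, forall w, (p1 w \in D) = (p2 w \in D')} ->
    {in X, forall w, p1 w \in At -> p1 w \in D -> L (p1 w) = kron (P (p2 w)) (R w)} ->
    \sum_(g in p1 x ^: J :&: D) L g =
      kron (\sum_(k in p2 x ^: J' :&: D') P k) om%:M.
Proof.
move=> mJ sJ Xx Atx; have [sNJ sZJ] := matched_sub TP mJ; have [sJA sJK mJE] := mJ.
have extR := tr_ext TR.
pose JX := [set y in X | p1 y \in J].
have JXP y : y \in JX -> [/\ y \in X, p1 y \in J & p2 y \in J'].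
  by rewrite inE => /andP[Xy Jy]; rewrite -mJE.
have JXM y z : y \in JX -> z \in JX -> (y * z)%g \in JX.
  by rewrite !inE => /andP[Xy Jy] /andP[Xz Jz]; rewrite groupM // (p1M TP) ?groupM.
have JXV y : y \in JX -> y^-1%g \in JX.
  by rewrite !inE => /andP[Xy Jy]; rewrite groupV Xy (p1V TP) // groupV.
have [Ct CtE] : {C | C = [set (x ^ y)%g | y in JX]} by exists [set (x ^ y)%g | y in JX].
have CtX w : w \in Ct -> w \in X.
  by rewrite CtE => /imsetP[y /JXP[Xy _ _] ->]; rewrite groupJ.
have CtAt w : w \in Ct -> p1 w \in At.
  rewrite CtE => /imsetP[y /JXP[Xy Jy _] ->]; rewrite (p1J TP) // groupJ //.
  exact: (subsetP sJ).
have CtJ w y : y \in JX -> ((w ^ y)%g \in Ct) = (w \in Ct).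
  move=> Jy; rewrite CtE; apply/imsetP/imsetP=> -[z Jz E].
    by exists (z * y^-1)%g; rewrite ?JXM ?JXV // conjgM -E conjgK.
  by exists (z * y)%g; rewrite ?JXM // conjgM E.
have C1 w : w \in Ct -> p1 w \in (p1 x ^: J)%g.
  by rewrite CtE => /imsetP[y /JXP[Xy Jy _] ->]; rewrite (p1J TP) // imset_f.
have C2 w : w \in Ct -> p2 w \in (p2 x ^: J')%g.
  by rewrite CtE => /imsetP[y /JXP[Xy _ Jy] ->]; rewrite (p2J TP) // imset_f.
have kerC z y : z \in X -> p1 z = 1%g -> y \in JX -> (z ^ y)%g = z.
  move=> Xz z1 /JXP[Xy Jy Jy']; have Zz := p2Z TP Xz z1.
  have z2 : (p2 z ^ p2 y)%g = p2 z by rewrite conjgE -(J'_cent TR mJ sJ Jy' Zz) mulKg.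
  rewrite -[RHS]mulg1 -[LHS](mulKVg z); congr (_ * _)%g.
  apply: (p12_inj TP); rewrite ?groupM ?groupV ?groupJ //.
    by rewrite (p1M TP) ?groupV ?groupJ // (p1V TP) // (p1J TP) // z1 conj1g mulVg.
  by rewrite (p2M TP) ?groupV ?groupJ // (p2V TP) // (p2J TP) // z2 mulVg.
(* The elements z over 1 for which x z is still conjugate to x. They commute with the preimage of J,
   so they form a group, and its order is invertible in F. *)
pose Zx := [set z in X | (p1 z == 1%g) && ((x * z)%g \in Ct)].
have gZx : group_set Zx.
  apply/group_setP; split.
    rewrite inE group1 (p1_1 TP) eqxx mulg1 CtE; apply/imsetP; exists 1%g; rewrite ?conjg1 //.
    by rewrite inE group1 (p1_1 TP) group1.
  move=> a b; rewrite !inE => /and3P[Xa /eqP a1 Ca] /and3P[Xb /eqP b1 Cb].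
  rewrite groupM // (p1M TP) // a1 b1 mulg1 eqxx /=.
  move: Ca; rewrite {1}CtE => /imsetP[y Jy E].
  by rewrite mulgA E -(kerC b y Xb b1 Jy) -conjMg CtJ.
have nzZx : #|Zx|%:R != 0 :> F.
  have : p^'.-group Zx.
    apply: (@exp_p'group p S _ (group gZx)) => z; rewrite inE => /and3P[Xz /eqP z1 _].
    apply: (p12_inj TP); rewrite ?groupX ?(p1X TP) ?(p2X TP) ?z1 ?expg1n //.
    exact: (expZ TR (p2Z TP Xz z1)).
  rewrite -(dvdn_pcharf (ms_pcharF S)) /pgroup p'natE ?(pcharf_prime (ms_pcharF S)) //.
have fibre w0 : w0 \in Ct -> #|[set w in Ct | p1 w == p1 w0]| = #|Zx|.
  rewrite {1}CtE => /imsetP[y Jy ->]; have [Xy _ _] := JXP y Jy.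
  rewrite -(card_lcoset Zx x) -[RHS](card_imset _ (conjg_inj y)); apply: eq_card => w.
  rewrite inE; apply/andP/imsetP=> [[Cw /eqP Ew] | [v /lcosetP[z Zz ->] ->]].
    have Xw := CtX w Cw.
    exists (w ^ y^-1)%g; last by rewrite conjgKV.
    apply/lcosetP; exists (x^-1 * w ^ y^-1)%g; last by rewrite mulKVg.
    rewrite inE groupM ?groupV ?groupJ ?groupV // mulKVg CtJ ?JXV // Cw andbT.
    rewrite (p1M TP) ?groupV ?groupJ ?groupV // (p1V TP) // (p1J TP) ?groupV // Ew.
    by rewrite (p1J TP) // (p1V TP) // conjgK mulVg eqxx.
  move: Zz; rewrite inE => /and3P[Xz /eqP z1 Cxz]; rewrite CtJ //; split=> //.
  by rewrite !(p1J TP) ?groupM // (p1M TP) // z1 mulg1.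
pose Om k := \sum_(w in Ct | p2 w == k) R w.
have OmJ k y : y \in JX -> Om k *m R y = R y *m Om (k ^ p2 y)%g.
  move=> Jy; have [Xy Jy1 _] := JXP y Jy; have Aty := subsetP sJ _ Jy1.
  rewrite /Om mulmx_suml mulmx_sumr [RHS](reindex_inj (conjg_inj y)) /=.
  apply: eq_big => [w|w /andP[Cw _]].
    rewrite CtJ //; case: (boolP (w \in Ct)) => //= Cw.
    by rewrite (p2J TP (CtX w Cw) Xy); apply/eqP/eqP=> [->|/conjg_inj].
  have Xw := CtX w Cw; have Atw := CtAt w Cw.
  by rewrite -!(extM extR) ?groupJ // -?conjgC // (p1J TP) // groupJ.
have OmZ k : exists om, Om k = om%:M.
  apply/is_scalar_mxP/(mx_abs_irr_cent_scalar absV)/centgmxP=> n Nn.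
  have [y Xy [yn y1]] := p1_ontoN TP Nn.
  have Jy : y \in JX by rewrite inE Xy yn (subsetP sNJ).
  by have := OmJ k y Jy; rewrite y1 conjg1 (extN extR Xy y1) yn.
have [om0 Omx] := OmZ (p2 x).
have OmC k : k \in (p2 x ^: J')%g -> Om k = om0%:M.
  case/imsetP=> j Jj ->; have [y Xy yj] := p2_onto TP (subsetP sJK j Jj).
  have J1 : p1 y \in J by rewrite mJE // yj.
  have uy : R y \in unitmx by rewrite (R_unit TP extR) // (subsetP sJ).
  apply: (can_inj (mulKmx uy)).
  by rewrite -yj -OmJ ?inE ?Xy // Omx scalar_mxC.
(* The sum of P (x) R over the class Ct is computed twice: every fibre of p1 contributes the same
   term #|Zx| times, and on every fibre of p2 the sum of R is the scalar om0. *)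
exists (#|Zx|%:R^-1 * om0) => D D' e P L DD' LE.
apply: (scalerI nzZx); rewrite -kronZr scale_scalar_mx mulVKf //.
transitivity (\sum_(w in Ct | p1 w \in D) kron (P (p2 w)) (R w)).
  rewrite (partition_big p1 (mem (p1 x ^: J :&: D)%g)) /=; last first.
    by move=> w /andP[Cw Dw]; rewrite inE C1.
  rewrite scaler_sumr; apply: eq_bigr => g /setIP[/imsetP[j Jj gE] Dg].
  have [y Xy yj] := p1_onto TP (subsetP sJA j Jj).
  have Jy : y \in JX by rewrite inE Xy yj.
  have Cw0 : (x ^ y)%g \in Ct by rewrite CtE imset_f.
  have gw : p1 (x ^ y)%g = g by rewrite (p1J TP) // yj.
  rewrite -(fibre _ Cw0) gw scaler_nat -sumr_const; apply: eq_big => [w|w].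
    by rewrite inE; case: eqP => [->|]; rewrite ?Dg ?andbT ?andbF.
  rewrite inE => /andP[Cw /eqP wg]; rewrite -wg LE ?CtX ?CtAt //.
  by rewrite wg.
rewrite (partition_big p2 (mem (p2 x ^: J' :&: D')%g)) /=; last first.
  by move=> w /andP[Cw Dw]; rewrite inE C2 // -DD' ?CtX.
rewrite kron_suml; apply: eq_bigr => k /setIP[Ck Dk].
rewrite -(OmC k Ck) kron_sumr; apply: eq_big => [w|w /andP[_ /eqP->] //].
case: (boolP (w \in Ct)) => //= Cw; case: eqP => [wk|]; rewrite ?andbF // andbT.
by rewrite DD' ?CtX // wk.
Qed.

(** Both projective representations are tensored with the same R. On an element centralizing J both
    scalars are multiplied by the scalar of R, and on class sums both are multiplied by om, which
    [class_sum_lift] provides uniformly in the set intersected with the class and in P. *)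
Lemma triple_geq_lift st (G J H M : {group gT}) (G' J' H' M' : {group kT}) chi psi phi xi :
  matched G G' -> matched J J' -> matched H H' -> matched M M' ->
  J \subset At -> M \subset At -> corr J J' chi psi -> corr M M' phi xi ->
  triple_geq Gam st G' J' psi H' M' xi -> triple_geq Gam st G J chi H M phi.
Proof.
move=> mG mJ mH mM sJ sM cJ cM [[tG tH GE] [ME gE [e [e' [P [P' gPP']]]]]].
have tG1 := Htriple_corr TR mG mJ sJ cJ tG; have tH1 := Htriple_corr TR mH mM sM cM tH.
have [sJG iJ _] := tG1; have [sMH iM _] := tH1.
have [sJG' iJ' _] := tG; have [sMH' iM' _] := tH.
have [sGA sGK mGE] := mG; have [sHA sHK mHE] := mH.
have [sJA sJK mJE] := mJ; have [sMA sMK mME] := mM.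
have sHG' : H' \subset G' by rewrite -GE mulG_subr.
have sHG : H \subset G by apply: (matched_sub1 TR mG mH).
have gE1 : gstab Gam H J chi = gstab Gam H M phi.
  apply/setP=> -[s g]; case: (boolP (g \in A)) => [Ag | nAg]; last first.
    by rewrite !inE /= (contraNF (subsetP sHA g) nAg).
  have [x Xx <-] := p1_onto TP Ag.
  by rewrite (gstab_corr TR s mH mJ sJ cJ Xx) (gstab_corr TR s mH mM sM cM Xx) gE.
have mT := matched_stab mG mJ sJ cJ; have mT1 := matched_stab mH mM sM cM.
have sTA := stab_sub_At mG mJ sJ cJ; have sTA1 := stab_sub_At mH mM sM cM.
split; split=> //.
- apply/setP=> g; apply/mulsgP/idP=> [[j h Jj Hh ->]|Gg].
    by rewrite groupM ?(subsetP sJG j Jj) ?(subsetP sHG h Hh).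
  have [x Xx xg] := p1_onto TP (subsetP sGA g Gg).
  have : p2 x \in G' by rewrite -mGE // xg.
  rewrite -GE => /mulsgP[j' h' Jj Hh xE].
  have [y Xy yj] := p2_onto TP (subsetP sJK j' Jj).
  exists (p1 y) (p1 (y^-1 * x)%g); rewrite ?mJE ?mHE ?groupM ?groupV ?yj //.
    by rewrite (p2M TP) ?groupV // (p2V TP) // yj xE mulKg.
  by rewrite (p1M TP) ?groupV // (p1V TP) // mulKVg.
- apply/setP=> g; case: (boolP (g \in A)) => [Ag | nAg]; last first.
    by rewrite inE (contraNF (subsetP sJA g) nAg) (contraNF (subsetP sMA g) nAg).
  have [x Xx <-] := p1_onto TP Ag.
  by rewrite inE mJE // mHE // mME // -ME inE.
exists (e * m)%N, (e' * m)%N, (lift_mx P), (lift_mx P').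
have [aP aP' [al [al' [rP rP' alE]]] muE starE] := gPP'.
have secT1 g : g \in stab Gam H M phi ->
    [/\ sec1 X p1 g \in X, p1 (sec1 X p1 g) = g & p2 (sec1 X p1 g) \in stab Gam H' M' xi].
  move=> Tg; have [sA _ E] := mT1; have [Xy yg] := sec1P TP (subsetP sA g Tg).
  by rewrite -E // yg.
have cent1 : central_cond G' J' H' P P' -> central_cond G J H (lift_mx P) (lift_mx P').
  case=> sCH scal.
  have centP1 c : c \in 'C_G(J) -> [/\ sec1 X p1 c \in X, p1 (sec1 X p1 c) = c,
      p2 (sec1 X p1 c) \in 'C_G'(J') & exists nu, R (sec1 X p1 c) = nu%:M].
    case/setIP=> Gc Jc; have [Xx xc] := sec1P TP (subsetP sGA c Gc).
    rewrite -xc in Jc; have [J'c nuE] := lift_cent mJ sJ Xx Jc.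
    by split=> //; rewrite inE J'c andbT -mGE // xc.
  split; first by apply/subsetP=> c /centP1[Xx xc Cc _]; rewrite -xc mHE // (subsetP sCH).
  move=> c /centP1[Xx xc Cc [nu Rc]]; have [z [Pz Pz']] := scal _ Cc.
  by exists (z * nu); rewrite /lift_mx Pz Pz' Rc !kron_scalar.
split.
- exact: (lift_associated mG mJ sJ sJG cJ aP).
- exact: (lift_associated mH mM sM sMH cM aP').
- exists (fun g h => al (p2 (sec1 X p1 g)) (p2 (sec1 X p1 h))).
  exists (fun g h => al' (p2 (sec1 X p1 g)) (p2 (sec1 X p1 h))).
  split; [exact: (lift_proj_rep mG mJ sJ cJ aP rP) | exact: (lift_proj_rep mH mM sM cM aP' rP') |].
  by move=> g h /secT1[_ _ Tg] /secT1[_ _ Th]; apply: alE.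
- move=> [s g] ag; have [Hg gJ gchi] := gstabP _ _ _ _ _ ag.
  have [x Xx xg] := p1_onto TP (subsetP sHA g Hg); rewrite -xg in ag gJ gchi *.
  have ag' : (s, p2 x) \in gstab Gam H' J' psi by rewrite -(gstab_corr TR s mH mJ sJ cJ Xx).
  have agG : (s, p1 x) \in gstab Gam G J chi.
    by apply/gstabP; split=> //; rewrite xg (subsetP sHG).
  have [mu [mu' [muP muP' muEq]]] := muE _ ag'.
  exists (fun g => mu (p2 (sec1 X p1 g))), (fun g => mu' (p2 (sec1 X p1 g))); split.
  + exact: (lift_is_mu mG mJ sJ sJG cJ aP Xx agG muP).
  + by rewrite gE1 in ag; exact: (lift_is_mu mH mM sM sMH cM aP' Xx ag muP').
  by move=> h /secT1[_ _ Th]; apply: muEq.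
case: st starE {gPP'} => //= -[cPP' bPP']; split; first exact: cent1.
have [sTA' _ mTE] := mT; move=> g Tg /=; have [x Xx xg] := p1_onto TP (subsetP sTA' g Tg).
have Tx : p2 x \in stab Gam G' J' psi by rewrite -mTE // xg.
have [om omE] := class_sum_lift mJ sJ Xx (subsetP sTA _ (eq_ind_r (fun y => y \in _) Tg xg)).
have scP := assoc_lz_scalar mJ sJ cJ aP; have scP' := assoc_lz_scalar mM sM cM aP'.
have {bPP'} [z [Pz Pz']] := bPP' _ Tx.
(* The case H = G of [class_joing_stab], where the intersection with H changes nothing. *)
have fixC (hT : finGroupType) (B I : {group hT}) eta y : IBr I eta -> I \subset B ->
    y \in stab Gam B I eta ->
    (y ^: (I <*> <[y]>) = y ^: I :&: stab Gam B I eta)%g.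
  move=> iI sIB Ty; rewrite -(class_joing_stab iI sIB (erefl _) Ty).
  apply/esym/setIidPl; rewrite class_joing_cycle; last first.
    by move: Ty; rewrite stab_gstab => /gstabP[_ /normP].
  apply/subsetP=> _ /imsetP[j Ij ->]; rewrite groupJ ?(subsetP sIB j Ij) //.
  by move: Ty; rewrite inE => /andP[].
exists (z * om); split.
  rewrite /sum_on (fixC _ G J chi) // -xg.
  rewrite (omE _ (stab Gam G' J' psi) _ P); first 1 last.
  - by move=> w Xw; rewrite mTE.
  - by move=> w Xw _ Tw; rewrite (liftE TP mT (extends_sub TR sTA)).
  by rewrite -(fixC _ G' J' psi) //; rewrite /sum_on in Pz; rewrite Pz kron_scalar.
have [_ _ mTE1] := mT1; rewrite /sum_on (class_joing_stab iJ sJG gE1 Tg) -xg.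
rewrite (omE _ (stab Gam H' M' xi) _ P'); first 1 last.
- by move=> w Xw; rewrite mTE1.
- by move=> w Xw _ Tw; rewrite (liftE TP mT1 (extends_sub TR sTA1)).
rewrite -(class_joing_stab iJ' sJG' gE Tx).
by rewrite /sum_on in Pz'; rewrite Pz' kron_scalar.
Qed.

End LiftProjective.

(** * Descent to the prime field *)

Section CentralizerRing.

Variables (E : finFieldType) (gT : finGroupType) (G : {group gT}).
Variables (n : nat) (r : mx_representation E G n.+1).

Definition centralizing : {pred 'M[E]_n.+1} := [pred z | centgmx r z].

Fact centralizing_divring : divring_closed centralizing.
Proof.
split=> [|z w|z w]; rewrite !inE.
- by apply/centgmxP=> x _; rewrite mul1mx mulmx1.
- by move=> /centgmxP cz /centgmxP cw; apply/centgmxP=> x Gx; rewrite mulmxBl mulmxBr cz ?cw.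
move=> /centgmxP cz /centgmxP cw; apply/centgmxP=> x Gx.
case: (boolP (w \in unitmx)) => [uw|nuw]; last first.
  by rewrite (invr_out nuw) -[z * w]/(z *m w) -mulmxA cw // !mulmxA cz.
apply: (can_inj (mulmxK uw)).
by rewrite -[z / w]/(z *m invmx w) -!mulmxA -cw // !mulmxA !(mulmxKV uw) cz.
Qed.

HB.instance Definition _ :=
  GRing.isDivringClosed.Build 'M[E]_n.+1 centralizing centralizing_divring.

Record centralizer_ring := CentralizerRing {
  cent_val : 'M[E]_n.+1; _ : cent_val \in centralizing}.
HB.instance Definition _ := [isSub for cent_val].
HB.instance Definition _ := [Finite of centralizer_ring by <:].
HB.instance Definition _ := [SubChoice_isSubUnitRing of centralizer_ring by <:].

(** By Schur's lemma the commuting ring has no zero divisors. It is packaged above as a finite unit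
    ring so that Wedderburn's theorem, [finDomain_mulrC], makes it commutative. *)
Lemma irr_cent_comm (z w : 'M[E]_n.+1) :
  mx_irreducible r -> centgmx r z -> centgmx r w -> z *m w = w *m z.
Proof.
move=> irr cz cw.
suff dom : GRing.integral_domain_axiom centralizer_ring.
  have := finDomain_mulrC dom (CentralizerRing cz) (CentralizerRing cw).
  by move/(congr1 cent_val).
move=> x y xy0; apply/orP; case: (eqVneq x 0) => [|nzx]; [by left | right].
have ux : cent_val x \in unitmx.
  by apply: (mx_Schur irr); [exact: (valP x) | rewrite -(inj_eq val_inj) in nzx].
apply/eqP/val_inj/(can_inj (mulKmx ux)); rewrite mulmx0.
exact: (congr1 cent_val xy0).
Qed.

(** The commuting ring is commutative, so z lies in the double centralizer, which is the enveloping
    algebra by Jacobson density. *)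
Lemma cent_envelop (z : 'M[E]_n.+1) :
  mx_irreducible r -> centgmx r z -> (z \in enveloping_algebra_mx r)%MS.
Proof.
move=> irr cz; apply: submx_trans (mx_Jacobson_density irr).
apply/cent_mxP=> w; rewrite memmx_cent_envelop => cw.
exact: (irr_cent_comm irr cw cz).
Qed.

End CentralizerRing.

Section DescentToPrimeField.

Variables (E F : finFieldType) (phi : {rmorphism E -> F}).
Variables (gT : finGroupType) (N : {group gT}) (m d : nat).
Variables (rho : mx_representation F N m) (r : mx_representation E N d.+1).
Hypotheses (absrho : mx_absolutely_irreducible rho) (irr : mx_irreducible r).
Local Notation phim := (map_mx phi).

Definition intertwines (f : 'M[F]_(d.+1, m)) :=
  {in N, forall n, phim (r n) *m f = f *m rho n}.

Variable f0 : 'M[F]_(d.+1, m).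
Hypotheses (nzf0 : f0 != 0) (hf0 : intertwines f0).

Lemma intertwiner_full f : f != 0 -> intertwines f -> row_full f.
Proof.
by move=> nzf hf; apply: (hom_irr_full (r1 := fun n => phim (r n)) (mx_abs_irrW absrho)) hf.
Qed.

Lemma intertwiner_cancel f k (X Y : 'M_(m, k)) : f != 0 -> intertwines f ->
  f *m X = f *m Y -> X = Y.
Proof.
move=> nzf hf /(congr1 (mulmx (pinvmx f))).
by rewrite !mulmxA mulVpmx ?intertwiner_full // !mul1mx.
Qed.

Lemma ga_intertwine f a : intertwines f ->
  phim (ga N r a) *m f = f *m ga N rho (fun x => phi (a x)).
Proof.
move=> hf; have hf' : {in N, forall n, phim (r n) *m f = f *m rho n} := hf.
rewrite -(ga_hom (fun x => phi (a x)) hf').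
by congr (_ *m f); rewrite /ga map_mx_sum; apply: eq_bigr => x _; rewrite map_mxZ.
Qed.

Lemma intertwiner_row_neq0 (v : 'rV[E]_d.+1) : v != 0 -> phim v *m f0 != 0.
Proof.
move=> nzv; apply: contraNneq nzf0 => vf0; apply/eqP/row_matrixP=> i; rewrite row0.
have [_ _ simp] := irr.
have : (1%:M <= cyclic_mx r v)%MS.
  by apply: simp; rewrite ?cyclic_mx_module ?submx1 ?cyclic_mx_eq0.
move/row_subP/(_ i)/cyclic_mxP=> [B /ga_env[a ->] iE].
have -> : row i f0 = phim (row i 1%:M) *m f0 by rewrite map_row map_mx1 -row_mul mul1mx.
by rewrite iE map_mxM -mulmxA ga_intertwine // mulmxA vf0 mul0mx.
Qed.

(** By [cent_envelop] z is the action of some a in the group algebra, so it acts on V through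
    rho(a). This commutes with rho and is a scalar, the same for all intertwiners f because a does
    not depend on f. *)
Lemma cent_scalar z : centgmx r z ->
  exists c, forall f, intertwines f -> phim z *m f = c *: f.
Proof.
move=> cz; have [a zE] := ga_env (cent_envelop irr cz).
have [c cE] : exists c, ga N rho (fun x => phi (a x)) = c%:M.
  apply/is_scalar_mxP/(mx_abs_irr_cent_scalar absrho)/centgmxP=> n Nn.
  apply: (intertwiner_cancel nzf0 hf0).
  rewrite !mulmxA -(ga_intertwine a hf0) -zE -mulmxA -!hf0 // -mulmxA.
  by rewrite -(ga_intertwine a hf0) -zE !mulmxA -!map_mxM (centgmxP cz).
by exists c => f hf; rewrite zE (ga_intertwine a hf) cE mul_mx_scalar.
Qed.

Let m_gt0 : (0 < m)%N. Proof. by case: (mx_abs_irrP absrho). Qed.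

(** For z in the commuting field this reads off the scalar by which z acts on V, that is, the
    embedding of this field in F; elsewhere the value carries no meaning. *)
Definition cent_char (z : 'M[E]_d.+1) : F :=
  (pinvmx f0 *m phim z *m f0) (Ordinal m_gt0) (Ordinal m_gt0).

Lemma cent_charE z f : centgmx r z -> intertwines f -> phim z *m f = cent_char z *: f.
Proof.
move=> cz hf; have [c cE] := cent_scalar cz; rewrite cE //; congr (_ *: _).
rewrite /cent_char -mulmxA cE // -scalemxAr mulVpmx ?intertwiner_full //.
by rewrite !mxE eqxx mulr1.
Qed.

Lemma cent_char_inj z c : centgmx r z -> phim z *m f0 = (phi c) *: f0 -> z = c%:M.
Proof.
move=> cz; case: (eqVneq z c%:M) => // nzc E1.
have czc : centgmx r (z - c%:M).
  by apply/centgmxP=> x Nx; rewrite mulmxBl mulmxBr (centgmxP cz) // scalar_mxC.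
have u : z - c%:M \in unitmx by apply: (mx_Schur irr czc); rewrite subr_eq0.
case/eqP: nzf0; rewrite -[f0](mulKmx (etrans (map_unitmx phi _) u)).
by rewrite map_mxB map_scalar_mx mulmxBl E1 mul_scalar_mx subrr mulmx0.
Qed.

(** Nonzero elements of the commuting ring are invertible, so commuting with its units suffices.
    Centralizers are compatible with extension of scalars, and the double centralizer property over
    E passes to F. *)
Lemma cent_in_span (Y : 'M[F]_d.+1) :
  (forall z, z \in unitmx -> centgmx r z -> phim z *m Y = Y *m phim z) ->
  exists b, Y = ga N (map_repr phi r) b.
Proof.
move=> cY; apply: ga_env; rewrite -map_enveloping_algebra_mx.
suff: (Y \in 'C(phim 'C(enveloping_algebra_mx r)))%MS.
  by move/submx_trans; apply; rewrite -map_cent_mx map_submx mx_Jacobson_density.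
apply/cent_rowP=> i; rewrite -map_row -map_vec_mx.
set w := vec_mx _; have cw : centgmx r w.
  by rewrite -memmx_cent_envelop vec_mxK row_sub.
case: (eqVneq w 0) => [->|nzw] /=; first by rewrite map_mx0 mul0mx mulmx0.
by apply: cY => //; apply: (mx_Schur irr cw nzw).
Qed.

End DescentToPrimeField.

(** * Construction of the triple (K, Z, lambda) *)

Section TripleConstruction.

Variables (p : nat) (S : modular_system p) (Gam : galois_group S).
Local Notation F := (msF S).
Local Notation q := #|F|.
Variables (gT : finGroupType) (A N : {group gT}) (theta : bfun S gT).
Hypotheses (splA : splits S A) (triA : Htriple Gam A N theta).
Variables (m d : nat) (rho : mx_representation F N m).
Hypotheses (irrho : mx_irreducible rho) (affrho : affords N rho theta).
Variables (phi : {rmorphism 'F_p -> F}) (r : mx_representation 'F_p N d.+1).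
Variable f0 : 'M[F]_(d.+1, m).
Hypotheses (irr : mx_irreducible r) (nzf0 : f0 != 0) (hf0 : intertwines phi rho r f0).
Local Notation phim := (map_mx phi).
Local Notation GL := {'GL_d.+1['F_p]}.
Local Notation At := (stab Gam A N theta).

Let sNA : N \subset A. Proof. by case: triA. Qed.
Let absrho : mx_absolutely_irreducible rho.
Proof. by have [_ /(_ _ _ irrho)] := splA sNA. Qed.

Definition mat_of (u : GL) : 'M['F_p]_d.+1 := GLval u.

Lemma mat_ofM u v : mat_of (u * v)%g = mat_of u *m mat_of v. Proof. by []. Qed.

Lemma mat_of1 : mat_of 1%g = 1%:M. Proof. by []. Qed.

Lemma mat_of_unit u : mat_of u \in unitmx. Proof. exact: (GL_unit u). Qed.

Lemma mat_of_inj : injective mat_of. Proof. exact: val_inj. Qed.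

Local Notation cc u := (cent_char phi absrho f0 (mat_of u)).

Lemma cc_eq (u : GL) f : centgmx r (mat_of u) -> intertwines phi rho r f ->
  phim (mat_of u) *m f = cc u *: f.
Proof. exact: (cent_charE absrho irr nzf0 hf0). Qed.

Lemma scaler_f0_inj a b : a *: f0 = b *: f0 -> a = b.
Proof. by move/eqP; rewrite -subr_eq0 -scalerBl scaler_eq0 (negPf nzf0) orbF subr_eq0 => /eqP. Qed.

Definition cent_units : {set GL} := [set u : GL | centgmx r (mat_of u)].

Fact cent_units_group_set : group_set cent_units.
Proof.
apply/group_setP; split=> [|u v]; rewrite !inE.
  by apply/centgmxP=> n _; rewrite mul1mx mulmx1.
move=> /centgmxP cu /centgmxP cv; apply/centgmxP=> n Nn.
by rewrite mat_ofM -mulmxA cv // !mulmxA cu.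
Qed.
Canonical cent_units_group := Group cent_units_group_set.

Lemma ccM : {in cent_units &, forall u v, cc (u * v)%g = cc u * cc v}.
Proof.
move=> u v Uu Uv; have Uuv := groupM Uu Uv; move: Uu Uv Uuv; rewrite !inE => cu cv cuv.
apply: scaler_f0_inj; rewrite -cc_eq // mat_ofM map_mxM -mulmxA (cc_eq cv hf0).
by rewrite -scalemxAr (cc_eq cu hf0) scalerA mulrC.
Qed.

Lemma cc1 : cc (1%g : GL) = 1.
Proof.
have : (1%g : GL) \in cent_units by apply: group1.
rewrite inE => c1; apply: scaler_f0_inj; rewrite -cc_eq // scale1r.
by rewrite mat_of1 map_mx1 mul1mx.
Qed.

Lemma cc_inj u : u \in cent_units -> cc u = 1 -> u = 1%g.
Proof.
rewrite inE => cu cu1; apply: mat_of_inj; rewrite mat_of1.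
apply: (cent_char_inj (phi := phi) irr nzf0 (c := 1) cu).
by rewrite cc_eq // cu1 rmorph1.
Qed.

Lemma cc_neq0 u : u \in cent_units -> cc u != 0.
Proof.
move=> Uu; apply: contraTneq isT => cu0; have := ccM Uu (groupVr Uu).
by rewrite mulgV cc1 cu0 mul0r => /eqP; rewrite oner_eq0.
Qed.

Lemma cent_units_exp u : u \in cent_units -> (u ^+ q.-1)%g = 1%g.
Proof.
move=> Uu; apply: cc_inj; first exact: groupX.
have ccX i : cc (u ^+ i)%g = cc u ^+ i.
  by elim: i => [|i IHi]; rewrite ?cc1 // expgS exprS ccM ?groupX ?IHi.
by rewrite ccX expq1 // cc_neq0.
Qed.

Lemma cent_units_p' : p^'.-group cent_units.
Proof. by apply: (@exp_p'group p S _ cent_units_group) => u; apply: cent_units_exp. Qed.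

(* With s the idempotent, up to a factor, of the centralizing units for the   *)
(* eigenvalue cc, every s X s lies in the span of r, and s fixes h and f0.    *)
Lemma intertwiner_mult_one (h : 'M[F]_(d.+1, m)) :
  {in cent_units, forall u, phim (mat_of u) *m h = cc u *: h} ->
  exists t, h = f0 *m t.
Proof.
move=> hh; pose s := \sum_(u in cent_units) (cc u)^-1 *: phim (mat_of u).
have ws w : w \in cent_units -> phim (mat_of w) *m s = cc w *: s.
  move=> Uw; rewrite /s mulmx_sumr scaler_sumr [RHS](reindex_inj (mulgI w)) /=.
  apply: eq_big => [u|u Uu]; first by rewrite groupMl.
  rewrite -scalemxAr -map_mxM scalerA ccM // invfM mulVKf ?cc_neq0 //.
have sw w : w \in cent_units -> s *m phim (mat_of w) = cc w *: s.
  move=> Uw; rewrite /s mulmx_suml scaler_sumr [RHS](reindex_inj (mulIg w)) /=.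
  apply: eq_big => [u|u Uu]; first by rewrite groupMr.
  by rewrite -scalemxAl -map_mxM scalerA ccM // invfM mulrCA mulfV ?mulr1 ?cc_neq0.
have eigs k' (h' : 'M_(d.+1, k')) :
    {in cent_units, forall u, phim (mat_of u) *m h' = cc u *: h'} ->
    s *m h' = #|cent_units|%:R *: h'.
  move=> e; rewrite /s mulmx_suml scaler_nat -sumr_const; apply: eq_bigr => u Uu.
  by rewrite -scalemxAl e // scalerA mulVf ?cc_neq0 // scale1r.
have sf0 : s *m f0 = #|cent_units|%:R *: f0.
  by apply: eigs => u; rewrite inE => cu; apply: cc_eq.
have nzU : #|cent_units|%:R != 0 :> F.
  have := cent_units_p'; rewrite -(dvdn_pcharf (ms_pcharF S)) /pgroup.
  by rewrite p'natE ?(pcharf_prime (ms_pcharF S)).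
have [g gf0] : exists g, g *m f0 = 1%:M.
  by exists (pinvmx f0); rewrite mulVpmx // (intertwiner_full absrho nzf0 hf0).
have [b bE] : exists b, s *m (h *m g) *m s = ga N (map_repr phi r) b.
  apply: (cent_in_span irr) => z uz cz.
  pose w : GL := Sub z uz; have Uw : w \in cent_units by rewrite inE.
  have -> : z = mat_of w by [].
  by rewrite !mulmxA ws // -[RHS](mulmxA _ s) sw // -!scalemxAl -scalemxAr.
have := congr1 (fun Y => Y *m f0) bE.
rewrite (ga_hom b (hf0 : {in N, forall n, map_repr phi r n *m f0 = f0 *m rho n})).
rewrite -!mulmxA sf0 -!scalemxAr gf0 mulmx1 (eigs _ h) // scalerA => E.
exists ((#|cent_units|%:R * #|cent_units|%:R)^-1 *: ga N rho b).
by rewrite -scalemxAr -E scalerA mulVf ?scale1r // mulf_neq0.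
Qed.

Let normN g : g \in A -> (N :^ g)%g = N.
Proof. by move=> Ag; have [_ _ /eqP/orb_stabP/(_ g Ag)[]] := triA. Qed.

Let memNJ g n : g \in A -> (n ^ g \in N)%g = (n \in N).
Proof. by move=> Ag; rewrite -{1}(normN Ag) memJ_conjg. Qed.

Definition covers (g : gT) (u : GL) :=
  {in N, forall n, r n *m mat_of u = mat_of u *m r (n ^ g)%g}.

(** When u covers g this is an intertwiner from r to the twist of rho by (s, g), as [twisted_hom]
    shows; r itself is unmoved because automorphisms fix F_p. *)
Definition twisted (s : Gam) (u : GL) := phim (mat_of u^-1%g) *m map_mx (gal_F s) f0.

Lemma mat_ofV u : mat_of u^-1%g = invmx (mat_of u). Proof. by []. Qed.

Lemma gal_phi s x : gal_F (s : Gam) (phi x) = phi x.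
Proof. by rewrite -(natr_Zp x) !rmorph_nat. Qed.

Lemma map_gal_phim s a b (M : 'M_(a, b)) : map_mx (gal_F (s : Gam)) (phim M) = phim M.
Proof. by apply/matrixP=> i j; rewrite !mxE gal_phi. Qed.

Lemma covers_cent g u z : g \in A -> covers g u -> z \in cent_units ->
  (z ^ u^-1)%g \in cent_units.
Proof.
move=> Ag cu; rewrite !inE conjgE invgK => /centgmxP cz; apply/centgmxP=> n Nn.
rewrite !mat_ofM mat_ofV; apply: (can_inj (mulmxK (mat_of_unit u))).
rewrite !mulmxA -(mulmxA _ (r n)) cu // !mulmxA !(mulmxKV (mat_of_unit u)).
by rewrite -!mulmxA cz // memNJ.
Qed.

Lemma twisted_neq0 s u : twisted s u != 0.
Proof.
apply: contraNneq nzf0; rewrite /twisted mat_ofV map_invmx => /(congr1 (mulmx (phim (mat_of u)))).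
rewrite mulKVmx ?map_unitmx ?mat_of_unit // mulmx0 => /eqP.
by rewrite map_mx_eq0.
Qed.

Lemma twisted_hom s g u : g \in A -> covers g u ->
  {in N, forall n, phim (r n) *m twisted s u = twisted s u *m pact (s, g) rho n}.
Proof.
move=> Ag cu n Nn; have Nng : (n ^ g^-1)%g \in N by rewrite memNJ ?groupV.
have E : r n *m mat_of u^-1%g = mat_of u^-1%g *m r (n ^ g^-1)%g.
  apply: (can_inj (mulKmx (mat_of_unit u))); rewrite mat_ofV mulKVmx ?mat_of_unit //.
  apply: (can_inj (mulmxK (mat_of_unit u))).
  by rewrite !mulmxA mulmxKV ?mat_of_unit // cu // conjgKV.
rewrite /twisted mulmxA -map_mxM E map_mxM -mulmxA -mulmxA; congr (_ *m _).
by rewrite /pact /= -map_mxM -hf0 // map_mxM map_gal_phim.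
Qed.

Lemma twisted_eig s g u z : g \in A -> covers g u -> z \in cent_units ->
  phim (mat_of z) *m twisted s u = gal_F s (cc (z ^ u^-1)%g) *: twisted s u.
Proof.
move=> Ag cu Uz; have := covers_cent Ag cu Uz; rewrite inE => Uzu.
have E : mat_of z *m mat_of u^-1%g = mat_of u^-1%g *m mat_of (z ^ u^-1)%g.
  by rewrite -!mat_ofM conjgE invgK !mulgA mulVg mul1g.
rewrite /twisted mulmxA -map_mxM E map_mxM -mulmxA scalemxAr; congr (_ *m _).
by rewrite -map_mxZ -cc_eq // map_mxM map_gal_phim.
Qed.

Fact pact_N_repr s g : g \in A -> mx_repr N (pact ((s : Gam), g) rho).
Proof. by move=> Ag; have := pact_mx_repr rho (s, g); rewrite /= normN. Qed.

Lemma affords_pact_N s g : g \in A -> affords N (pact ((s : Gam), g) rho) (bact (s, g) theta).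
Proof. by move=> Ag x; have := affords_pact (s, g) affrho x; rewrite /= normN. Qed.

(** An isomorphism B from the twisted rho to rho turns [twisted s u] into an intertwiner to rho, on
    which z acts by cc z; by [twisted_eig] it also acts by the twisted value. *)
Lemma gstab_cent_char s g u : covers g u -> (s, g) \in gstab Gam A N theta ->
  {in cent_units, forall z, gal_F s (cc (z ^ u^-1)%g) = cc z}.
Proof.
move=> cu /gstabP[Ag _ thE] z Uz.
have affa : affords N (MxRepresentation (pact_N_repr s Ag)) theta.
  by rewrite -[X in affords _ _ X]thE; apply: affords_pact_N.
have [B _ frB hB] := mx_rsim_sym (affords_IBr_rsim absrho affrho affa).
have uB : B \in unitmx by rewrite -row_free_unit.
have hf : intertwines phi rho r (twisted s u *m B).
  by move=> n Nn; rewrite mulmxA (twisted_hom s Ag cu) // -!mulmxA hB.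
move: (Uz); rewrite inE => cz; have := cc_eq cz hf.
rewrite mulmxA scalemxAl => /(can_inj (mulmxK uB)).
rewrite (twisted_eig s Ag cu Uz) => /eqP; rewrite -subr_eq0 -scalerBl scaler_eq0.
by rewrite (negPf (twisted_neq0 s u)) orbF subr_eq0 => /eqP.
Qed.

(** Invariance of cc puts [twisted s u] in the cc-eigenspace, a single copy of V by
    [intertwiner_mult_one]. The matrix t is invertible since u, followed by a left inverse of the
    twisted f0, undoes it. *)
Lemma cent_char_twisted s g u : g \in A -> covers g u ->
  {in cent_units, forall z, gal_F s (cc (z ^ u^-1)%g) = cc z} ->
  exists2 t, t \in unitmx & twisted s u = f0 *m t.
Proof.
move=> Ag cu ccE; have [|t tE] := @intertwiner_mult_one (twisted s u).
  by move=> z Uz; rewrite (twisted_eig s Ag cu Uz) ccE.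
exists t => //; have fl := intertwiner_full absrho nzf0 hf0.
suff : (map_mx (gal_F s) (pinvmx f0) *m phim (mat_of u) *m f0) *m t = 1%:M.
  by case/mulmx1_unit.
rewrite -mulmxA -tE /twisted mat_ofV map_invmx mulmxA.
by rewrite mulmxK ?map_unitmx ?mat_of_unit // -map_mxM mulVpmx // map_mx1.
Qed.

Lemma twisted_gstab s g u t : g \in A -> covers g u -> t \in unitmx ->
  twisted s u = f0 *m t -> (s, g) \in gstab Gam A N theta.
Proof.
move=> Ag cu ut tE; apply/gstabP; rewrite normN //; split=> //.
apply: affords_uniq (affords_pact_N s Ag) _.
apply: affords_char_poly affrho => n Nn; apply/esym.
apply: (char_poly_simmx ut); apply: (intertwiner_cancel absrho nzf0 hf0).
by rewrite !mulmxA -tE -(twisted_hom s Ag cu) // tE mulmxA hf0.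
Qed.

(** By [ker_sub_rsim] it is enough that an element of F_p N killing r kills its conjugate by g. It
    kills rho, hence the twist of rho by (s, g^-1), which affords theta. Its coefficients are fixed
    by s, so s can be removed, and it annihilates rho conjugated by g; injectivity of f0 on rows
    over F_p brings this back to r. *)
Lemma covers_exists g : g \in A -> exists u, covers g u.
Proof.
move=> Ag; have rP : mx_repr N (fun n => r (n ^ g)%g).
  split=> [|n n' Nn Nn']; first by rewrite conj1g repr_mx1.
  by rewrite conjMg repr_mxM ?memNJ.
pose r' := MxRepresentation rP.
have irr' : mx_irreducible r'.
  have [d0 irrU] := (mx_irrP r).1 irr; apply/mx_irrP; split=> // U modU nzU; apply: irrU nzU.
  apply/mxmoduleP=> n Nn; have Nng : (n ^ g^-1)%g \in N by rewrite memNJ ?groupV.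
  by have := mxmoduleP modU _ Nng; rewrite /= conjgKV.
have [_ _ /eqP/orb_stabP/(_ _ (groupVr Ag))[_ [s thE]]] := triA.
have affa : affords N (MxRepresentation (pact_N_repr s (groupVr Ag))) theta.
  by rewrite -[X in affords _ _ X]thE; apply: affords_pact_N; rewrite groupV.
have [B _ frB hB] := affords_IBr_rsim absrho affrho affa.
have uB : B \in unitmx by rewrite -row_free_unit.
have ker a : ga N r a = 0 -> ga N r' a = 0.
  move=> ra0; have : ga N rho (fun x => phi (a x)) = 0.
    apply: (intertwiner_cancel absrho nzf0 hf0).
    by rewrite -(ga_intertwine _ hf0) ra0 map_mx0 mul0mx mulmx0.
  move=> /(congr1 (mulmx^~ B)); rewrite mul0mx (ga_hom _ hB) => z0.
  have : ga N (pact (s, g^-1%g) rho) (fun x => phi (a x)) = 0.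
    by apply: (can_inj (mulKmx uB)); rewrite mulmx0.
  have -> : ga N (pact (s, g^-1%g) rho) (fun x => phi (a x)) =
            map_mx (gal_F s) (ga N (fun n => rho (n ^ g)%g) (fun x => phi (a x))).
    rewrite /ga map_mx_sum; apply: eq_bigr => n _.
    by rewrite map_mxZ gal_phi /pact /= invgK.
  move/eqP; rewrite map_mx_eq0 => /eqP rho0.
  have Df0 : phim (ga N r' a) *m f0 = 0.
    have -> : phim (ga N r' a) = ga N (fun n => phim (r (n ^ g)%g)) (fun x => phi (a x)).
      by rewrite /ga map_mx_sum; apply: eq_bigr => x _; rewrite map_mxZ.
    rewrite (ga_hom (r2 := fun n => rho (n ^ g)%g)) ?rho0 ?mulmx0 // => n Nn.
    by rewrite hf0 // memNJ.
  apply/row_matrixP=> i; rewrite row0; apply/eqP; apply: contraT => nzi.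
  have := intertwiner_row_neq0 irr nzf0 hf0 nzi.
  by rewrite map_row -row_mul Df0 row0 eqxx.
have [C _ frC hC] := ker_sub_rsim irr irr' ker.
have uC : C \in unitmx by rewrite -row_free_unit.
by exists (Sub C uC) => n Nn; rewrite hC.
Qed.

Lemma coversM g h u v : g \in A -> covers g u -> covers h v -> covers (g * h)%g (u * v)%g.
Proof.
move=> Ag cu cv n Nn; rewrite mat_ofM mulmxA cu // conjgM -!mulmxA; congr (_ *m _).
by rewrite cv // memNJ.
Qed.

Section AbstractExtension.

Variables (xT kT : finGroupType) (X : {group xT}) (K Z : {group kT}).
Variables (p1 : xT -> gT) (pu : xT -> GL) (p2 : xT -> kT).

(** The properties of X, K and Z that the proofs use, stated apart from the pairs and cosets that
    realize them. *)
Record extension_data : Prop := ExtensionData {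
  ed_p1M : {in X &, {morph p1 : x y / (x * y)%g}};
  ed_puM : {in X &, {morph pu : x y / (x * y)%g}};
  ed_p2M : {in X &, {morph p2 : x y / (x * y)%g}};
  ed_A : {in X, forall x, p1 x \in A};
  ed_covers : {in X, forall x, covers (p1 x) (pu x)};
  ed_onto : forall g u, g \in A -> covers g u -> exists x, [/\ x \in X, p1 x = g & pu x = u];
  ed_inj : {in X, forall x, p1 x = 1%g -> pu x = 1%g -> x = 1%g};
  ed_ker : {in X, forall x, (p2 x == 1%g) = (p1 x \in N) && (mat_of (pu x) == r (p1 x))};
  ed_K : {in X, forall x, p2 x \in K};
  ed_ontoK : {in K, forall k, exists2 x, x \in X & p2 x = k};
  ed_Z : {in X, forall x, p1 x = 1%g -> p2 x \in Z};
  ed_ontoZ : {in Z, forall z, exists2 x, x \in X & p2 x = z /\ p1 x = 1%g}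
}.

Hypothesis ED : extension_data.

Lemma two_projections_ext : two_projections X A N K Z p1 p2.
Proof.
split.
- exact: (ed_p1M ED).
- exact: (ed_p2M ED).
- exact: (ed_A ED).
- exact: (ed_K ED).
- move=> g Ag; have [u cu] := covers_exists Ag.
  by have [x [Xx xg _]] := ed_onto ED Ag cu; exists x.
- exact: (ed_ontoK ED).
- by move=> x Xx /eqP; rewrite (ed_ker ED) // => /andP[].
- exact: (ed_Z ED).
- move=> n Nn; have urn : r n \in unitmx by rewrite repr_mx_unit.
  have An := subsetP sNA n Nn.
  have cn : covers n (Sub (r n) urn : GL).
    by move=> n' Nn'; rewrite /mat_of /= -!repr_mxM ?memNJ // conjgE mulKVg.
  have [x [Xx xn xr]] := ed_onto ED An cn; exists x => //; split=> //.
  by apply/eqP; rewrite (ed_ker ED) // xn Nn xr /=.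
- exact: (ed_ontoZ ED).
move=> x Xx x1 /eqP; rewrite (ed_ker ED) // x1 repr_mx1 => /andP[_ /eqP x2].
by apply: (ed_inj ED) => //; apply: mat_of_inj; rewrite x2.
Qed.

Let TP := two_projections_ext.

Let pu1 : pu 1%g = 1%g.
Proof. by apply: (mulgI (pu 1%g)); rewrite -(ed_puM ED) // !mulg1. Qed.

Let puV x : x \in X -> pu x^-1%g = (pu x)^-1%g.
Proof. by move=> Xx; apply: (mulgI (pu x)); rewrite -(ed_puM ED) ?groupV // !mulgV pu1. Qed.

Let puJ x y : x \in X -> y \in X -> pu (x ^ y)%g = (pu x ^ pu y)%g.
Proof. by move=> Xx Xy; rewrite /conjg !(ed_puM ED) ?groupM ?groupV ?puV. Qed.

Lemma kernel_cent x : x \in X -> p1 x = 1%g -> pu x \in cent_units.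
Proof.
move=> Xx x1; rewrite inE; apply/centgmxP=> n Nn.
by have := ed_covers ED Xx Nn; rewrite x1 conjg1 => ->.
Qed.

Lemma cent_kernel u : u \in cent_units -> exists x, [/\ x \in X, p1 x = 1%g & pu x = u].
Proof.
rewrite inE => cu; apply: (ed_onto ED) => // n Nn.
by rewrite conjg1 (centgmxP cu).
Qed.

(** An element of X over 1 acts on V by cc, so lambda has to be the inverse of cc for W (x) R to
    descend to A. The value 1 is a default for k with no preimage over 1. *)
Definition quot_char (k : kT) : F :=
  if [pick x | [&& x \in X, p1 x == 1%g & p2 x == k]] is Some x then (cc (pu x))^-1 else 1.
Local Notation lz := quot_char.

Lemma quot_charE x : x \in X -> p1 x = 1%g -> lz (p2 x) = (cc (pu x))^-1.
Proof.
move=> Xx x1; rewrite /quot_char; case: pickP => [y /and3P[Xy /eqP y1 /eqP yx] | /(_ x)].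
  suff -> : y = x by [].
  apply/eqP; rewrite eq_mulVg1; apply/eqP/(p12_inj TP); first by rewrite groupM ?groupV.
    by rewrite (p1M TP) ?groupV // (p1V TP) // x1 y1 mulVg.
  by rewrite (p2M TP) ?groupV // (p2V TP) // yx mulVg.
by rewrite Xx x1 !eqxx.
Qed.

(** Since [pinvmx f0] is a left inverse of f0, this is the only possible Y with M f0 = f0 Y, M being
    the matrix of x; such a Y exists for x over the stabilizer of theta ([ext_reprE]). *)
Definition ext_repr (x : xT) : 'M[F]_m := pinvmx f0 *m phim (mat_of (pu x)) *m f0.
Local Notation R := ext_repr.

Lemma ext_repr_eq x Y : phim (mat_of (pu x)) *m f0 = f0 *m Y -> R x = Y.
Proof.
move=> E; rewrite /ext_repr -mulmxA E mulmxA mulVpmx ?mul1mx //.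
exact: (intertwiner_full absrho nzf0 hf0).
Qed.

Lemma ext_reprE x : x \in X -> p1 x \in At -> phim (mat_of (pu x)) *m f0 = f0 *m R x.
Proof.
move=> Xx Atx; rewrite stab_gstab in Atx.
have Ax := ed_A ED Xx; have cx := ed_covers ED Xx.
have [t ut tE] := cent_char_twisted Ax cx (gstab_cent_char cx Atx).
suff E : phim (mat_of (pu x)) *m f0 = f0 *m invmx t by rewrite (ext_repr_eq E).
apply: (can_inj (mulmxK ut)); rewrite -!mulmxA mulVmx // mulmx1 -tE /twisted.
have -> : map_mx (gal_F (1%g : Gam)) f0 = f0.
  by apply/matrixP=> i j; rewrite !mxE gal_F1.
by rewrite mulmxA -map_mxM mat_ofV mulmxV ?mat_of_unit // map_mx1 mul1mx.
Qed.

Lemma ext_repr_extends : extends X Z p1 p2 rho R lz At.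
Proof.
split.
- by apply: ext_repr_eq; rewrite pu1 mat_of1 map_mx1 mul1mx mulmx1.
- move=> x y Xx Xy Jx Jy; apply: ext_repr_eq.
  rewrite (ed_puM ED) // mat_ofM map_mxM -mulmxA (ext_reprE Xy Jy) (mulmxA _ f0).
  by rewrite (ext_reprE Xx Jx) -(mulmxA f0).
- move=> x Xx /eqP; rewrite (ed_ker ED) // => /andP[Nx /eqP rx].
  by apply: ext_repr_eq; rewrite rx hf0.
- move=> x Xx x1; have := kernel_cent Xx x1; rewrite inE => cx.
  by rewrite quot_charE // invrK; apply: ext_repr_eq; rewrite mul_mx_scalar cc_eq.
move=> k /(ed_ontoZ ED)[x Xx [<- x1]]; rewrite quot_charE // invr_eq0 cc_neq0 //.
exact: kernel_cent.
Qed.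

Fact quot_char_repr : mx_repr Z (fun z => (lz z)%:M : 'M[F]_1).
Proof.
split=> [|y z /(ed_ontoZ ED)[x Xx [<- x1]] /(ed_ontoZ ED)[w Xw [<- w1]]].
  by rewrite -(p2_1 TP) quot_charE ?(p1_1 TP) // pu1 cc1 invr1.
rewrite -scalar_mxM -(p2M TP) //; congr (_%:M).
rewrite !quot_charE ?groupM // ?(p1M TP) // ?x1 ?w1 ?mulg1 //.
by rewrite (ed_puM ED) // ccM ?kernel_cent // invfM.
Qed.

Lemma quot_char_afforded : exists lam : bfun S kT,
  affords Z (fun z => (lz z)%:M : 'M[F]_1) lam.
Proof.
apply: (exists_affords (MxRepresentation quot_char_repr)) => z /(ed_ontoZ ED)[x Xx [<- x1]] _.
have puX i : pu (x ^+ i)%g = (pu x ^+ i)%g.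
  by elim: i => [|i IHi]; rewrite ?pu1 // !expgS (ed_puM ED) ?groupX // IHi.
rewrite -(p2X TP) // (ed_inj ED (groupX _ Xx)) ?(p2_1 TP) //.
  by rewrite (p1X TP) // x1 expg1n.
by rewrite puX cent_units_exp ?kernel_cent.
Qed.

Let lzr := MxRepresentation quot_char_repr.

Let absZ : mx_absolutely_irreducible lzr.
Proof. exact: linear_mx_abs_irr. Qed.

Let ZJ x : x \in X -> (Z :^ p2 x)%g = Z.
Proof.
move=> Xx; apply/eqP; rewrite eqEcard cardJg leqnn andbT.
apply/subsetP=> _ /imsetP[z /(ed_ontoZ ED)[w Xw [<- w1]] ->].
by rewrite -(p2J TP) // (ed_Z ED) ?groupJ // (p1J TP) // w1 conj1g.
Qed.

Variable lam : bfun S kT.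
Hypothesis afflam : affords Z (fun z => (lz z)%:M : 'M[F]_1) lam.

(** Both memberships are equivalent to the invariance of cc under (s, x): for theta by the
    intertwiners [twisted], for lam because it is the inverse of cc on Z. *)
Lemma ext_gstab s : {in X, forall x,
  ((s, p1 x) \in gstab Gam A N theta) = ((s, p2 x) \in gstab Gam K Z lam)}.
Proof.
move=> x Xx; have Ax := ed_A ED Xx; have cx := ed_covers ED Xx.
have affa : affords Z (pact (s, p2 x) (fun z => (lz z)%:M : 'M[F]_1)) (bact (s, p2 x) lam).
  by move=> z; have := affords_pact (s, p2 x) afflam z; rewrite /= ZJ.
have lzJ w : w \in X -> p1 w = 1%g -> lz (p2 w ^ (p2 x)^-1)%g = (cc (pu w ^ (pu x)^-1)%g)^-1.
  move=> Xw w1; rewrite -(p2V TP) // -(p2J TP) ?groupV // quot_charE ?groupJ ?groupV //.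
    by rewrite (puJ Xw (groupVr Xx)) (puV Xx).
  by rewrite (p1J TP) ?groupV // w1 conj1g.
apply/idP/idP=> [ax | /gstabP[_ _ lamE]].
  have ccE := gstab_cent_char cx ax; apply/gstabP; split; rewrite ?(ed_K ED) ?ZJ //.
  apply: affords_uniq affa _; apply: affords_char_poly afflam => z Zz; congr char_poly.
  have [w Xw [<- w1]] := ed_ontoZ ED Zz; rewrite /pact /= map_scalar_mx lzJ //.
  by rewrite quot_charE // (fmorphV (gal_F s)) ccE // kernel_cent.
have ZP : mx_repr Z (pact (s, p2 x) (fun z => (lz z)%:M : 'M[F]_1)).
  by have := pact_mx_repr lzr (s, p2 x); rewrite /= ZJ.
rewrite lamE in affa.
have [B _ frB hB] := affords_IBr_rsim absZ afflam (affa : affords Z (MxRepresentation ZP) lam).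
have uB : B \in unitmx by rewrite -row_free_unit.
have ccE : {in cent_units, forall z, gal_F s (cc (z ^ (pu x)^-1)%g) = cc z}.
  move=> _ /cent_kernel[w [Xw w1 <-]]; have Zw := ed_Z ED Xw w1.
  apply: invr_inj; rewrite -fmorphV -lzJ // -quot_charE //.
  have := hB _ Zw; rewrite /= /pact map_scalar_mx -scalar_mxC => /(can_inj (mulKmx uB)).
  by move/matrixP/(_ 0 0); rewrite !mxE !mulr1n.
have [t ut tE] := cent_char_twisted Ax cx ccE.
exact: twisted_gstab Ax cx ut tE.
Qed.

Lemma triple_transfer_ext : triple_transfer Gam X A K Z p1 p2 rho R lz theta lam.
Proof.
split=> //.
- exact: ext_repr_extends.
- move=> z /(ed_ontoZ ED)[x Xx [<- x1]]; rewrite quot_charE // => /eqP.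
  rewrite invr_eq1 => /eqP/(cc_inj (kernel_cent Xx x1)) ux.
  by rewrite (ed_inj ED Xx x1 ux) (p2_1 TP).
- exact: ext_gstab.
(* An element of the stabilizer of lam, taken with the trivial automorphism, preserves cc; as cc is
   injective, it centralizes Z. *)
- apply/subsetP=> k; rewrite stab_gstab => kl; have [Kk _ _] := gstabP _ _ _ _ _ kl.
  have [x Xx xk] := ed_ontoK ED Kk; rewrite -xk -ext_gstab // in kl.
  apply/centP=> z /(ed_ontoZ ED)[w Xw [<- w1]]; rewrite -xk.
  have Uw := kernel_cent Xw w1; have cx := ed_covers ED Xx.
  have Xwx : (w ^ x^-1)%g \in X by rewrite groupJ ?groupV.
  have wx1 : p1 (w ^ x^-1)%g = 1%g by rewrite (p1J TP) ?groupV // w1 conj1g.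
  have Xwwx : (w^-1 * w ^ x^-1)%g \in X by rewrite groupM ?groupV.
  have wwx1 : p1 (w^-1 * w ^ x^-1)%g = 1%g.
    by rewrite (p1M TP) ?groupV // (p1V TP) // w1 wx1 mulg1 invg1.
  have uE : pu (w^-1 * w ^ x^-1)%g = 1%g.
    have := gstab_cent_char cx kl Uw; rewrite gal_F1 -puV // -puJ ?groupV // => E.
    apply: cc_inj; first exact: kernel_cent.
    apply: (mulfI (cc_neq0 Uw)); rewrite -ccM ?kernel_cent //.
    by rewrite -(ed_puM ED) ?groupM ?groupV // mulKVg mulr1 E.
  have : (w^-1 * w ^ x^-1)%g = 1%g.
    exact: (ed_inj ED Xwwx wwx1 uE).
  move/eqP; rewrite -eq_mulVg1 => /eqP wE; rewrite /commute -!(p2M TP) //; congr p2.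
  by rewrite {2}wE conjgE invgK -!mulgA mulVg mulg1.
(* The conjugating matrix is the t with [twisted s u] = f0 t. After multiplication by f0 both sides
   involve only matrices over F_p, which s fixes, so no scalar can appear. *)
move=> s x Xx ax; have Ax := ed_A ED Xx; have cx := ed_covers ED Xx.
have [t ut tE] := cent_char_twisted Ax cx (gstab_cent_char cx ax).
exists t => // y Xy Aty.
have Xyx : (y ^ x^-1)%g \in X by rewrite groupJ ?groupV.
have Atyx : p1 (y ^ x^-1)%g \in At.
  rewrite (p1J TP) ?groupV // (p1V TP) // stab_gstab.
  have -> : (1%g : Gam, (p1 y ^ (p1 x)^-1))%g = ((1, p1 y) ^ (s, p1 x)^-1)%g.
    by rewrite [in RHS]/conjg; congr pair; rewrite /= ?mul1g ?mulVg.
  by rewrite groupJ ?groupV -?stab_gstab.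
have E := ext_reprE Xyx Atyx.
apply: (intertwiner_cancel absrho nzf0 hf0).
rewrite (mulmxA f0 t) -tE (mulmxA f0 (R y)) -ext_reprE // -(mulmxA _ f0 t) -tE /twisted.
rewrite -mulmxA -map_mxM -E map_mxM map_gal_phim !mulmxA -!map_mxM; congr (phim _ *m _).
by rewrite -!mat_ofM puJ ?groupV // puV // conjgE invgK !mulgA mulVg mul1g.
Qed.

End AbstractExtension.

Local Notation xT := (gT * GL)%type.

Let fstM (x y : xT) : (x * y)%g.1 = (x.1 * y.1)%g. Proof. by []. Qed.
Let sndM (x y : xT) : (x * y)%g.2 = (x.2 * y.2)%g. Proof. by []. Qed.
Let fstJ (x y : xT) : (x ^ y)%g.1 = (x.1 ^ y.1)%g. Proof. by []. Qed.
Let sndJ (x y : xT) : (x ^ y)%g.2 = (x.2 ^ y.2)%g. Proof. by []. Qed.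

Definition ext_set : {set xT} := [set x : xT | (x.1 \in A) &&
  [forall n, (n \in N) ==> (r n *m mat_of x.2 == mat_of x.2 *m r (n ^ x.1)%g)]].

Lemma extP x : reflect (x.1 \in A /\ covers x.1 x.2) (x \in ext_set).
Proof.
rewrite inE; apply: (iffP andP) => -[Ax h]; split=> //.
  by move=> n Nn; have /implyP/(_ Nn)/eqP := forallP h n.
by apply/forallP=> n; apply/implyP=> Nn; rewrite h.
Qed.

Fact ext_group_set : group_set ext_set.
Proof.
apply/group_setP; split=> [|x y /extP[Ax cx] /extP[Ay cy]]; apply/extP.
  by rewrite group1; split=> // n Nn; rewrite conjg1 mat_of1 mul1mx mulmx1.
by rewrite fstM sndM groupM //; split=> //; apply: coversM.
Qed.
Canonical ext_group := Group ext_group_set.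
Local Notation X := ext_group.

Definition graph_set : {set xT} := [set x : xT | (x.1 \in N) && (mat_of x.2 == r x.1)].

Fact graph_group_set : group_set graph_set.
Proof.
apply/group_setP; split=> [|x y]; rewrite !inE; first by rewrite group1 mat_of1 repr_mx1 /=.
move=> /andP[Nx /eqP rx] /andP[Ny /eqP ry]; rewrite fstM sndM groupM //.
by rewrite mat_ofM rx ry repr_mxM /=.
Qed.
Canonical graph_group := Group graph_group_set.
Local Notation D := graph_group.

Lemma graph_sub : D \subset X.
Proof.
apply/subsetP=> x; rewrite inE => /andP[Nx /eqP rx]; apply/extP; rewrite (subsetP sNA) //.
split=> // n Nn; rewrite rx -!repr_mxM ?memNJ ?(subsetP sNA) //.
by rewrite conjgE mulKVg.
Qed.

Lemma graph_normal : D <| X.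
Proof.
rewrite /normal graph_sub; apply/subsetP=> x /extP[Ax cx]; rewrite inE.
apply/subsetP=> _ /imsetP[y Dy ->]; move: Dy; rewrite !inE => /andP[Ny /eqP ry].
rewrite fstJ sndJ memNJ // Ny (conjgE y.2) !mat_ofM ry cx //.
by rewrite mat_ofV mulKmx ?mat_of_unit /=.
Qed.

Let nDx x : x \in X -> x \in 'N(D).
Proof. by move=> Xx; rewrite (subsetP (normal_norm graph_normal)). Qed.

Lemma extension_data_pairs :
  extension_data X (X / D)%G ((X :&: setX [1 gT] [set: GL]) / D)%G fst snd (coset D).
Proof.
split=> //.
- by move=> x y Xx Xy; rewrite morphM ?nDx.
- by move=> x /extP[].
- by move=> x /extP[].
- by move=> g u Ag cu; exists (g, u); split=> //; apply/extP.
- by move=> [g u] _ /= -> ->.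
- move=> x Xx; apply/eqP/idP=> [/(coset_idr (nDx Xx)) | Dx]; first by rewrite inE.
  by apply: coset_id; rewrite inE.
- by move=> x Xx; apply: mem_quotient.
- by move=> k /morphimP[x _ Xx ->]; exists x.
- by move=> x Xx x1; apply: mem_quotient; rewrite in_setI Xx !inE x1 eqxx.
move=> z /morphimP[x _ /setIP[Xx]]; rewrite !inE andbT => /eqP x1 ->.
by exists x.
Qed.

End TripleConstruction.

Lemma prime_field_morphism p (F : fieldType) : p \in [pchar F] ->
  inhabited {rmorphism 'F_p -> F}.
Proof.
move=> pF; have f : {rmorphism 'F_p -> pPrimeCharType pF} := in_alg (pPrimeCharType pF).
exact: (inhabits (f : {rmorphism 'F_p -> F})).
Qed.

Lemma exists_triple_transfer p (S : modular_system p) (Gam : galois_group S)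
    (gT : finGroupType) (A N : {group gT}) (theta : bfun S gT) :
  splits S A -> Htriple Gam A N theta ->
  exists (xT kT : finGroupType) (X : {group xT}) (K Z : {group kT}) (p1 : xT -> gT)
      (p2 : xT -> kT) (m : nat) (V : mx_representation (msF S) N m)
      (R : xT -> 'M[msF S]_m) (lz : kT -> msF S) (lam : bfun S kT),
    triple_transfer Gam X A K Z p1 p2 V R lz theta lam.
Proof.
move=> splA triA; have [sNA [m [rho [irrho affrho]]] _] := triA.
have [phi] := prime_field_morphism (ms_pcharF S).
have [d [r [f0 [irr nzf0 hf0]]]] := exists_irr_above phi rho (subxx N) (irr_deg_gt0 irrho).
(* The degree is rewritten as a successor, the form in which square matrices make up a unit ring. *)
have d_gt0 := irr_deg_gt0 irr; case: d d_gt0 r f0 irr nzf0 hf0 => // d _ r f0 irr nzf0 hf0.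
have ED := extension_data_pairs triA r.
have [lam afflam] := quot_char_afforded splA triA irrho affrho irr nzf0 hf0 ED.
have TR := triple_transfer_ext affrho irr nzf0 hf0 ED afflam.
by do 12!eexists; exact: TR.
Qed.

(** * The isomorphism of A / N with K / Z *)

Section QuotientIsomorphism.

Variables (gT kT xT : finGroupType) (X : {group xT}).
Variables (A N : {group gT}) (K Z : {group kT}) (p1 : xT -> gT) (p2 : xT -> kT).
Hypothesis TP : two_projections X A N K Z p1 p2.

Let sNA : N \subset A.
Proof. by apply/subsetP=> n /(p1_ontoN TP)[x Xx [<- _]]; apply: (p1A TP). Qed.

Let sZK : Z \subset K.
Proof. by apply/subsetP=> z /(p2_ontoZ TP)[x Xx [<- _]]; apply: (p2K TP). Qed.

Lemma two_projections_norm1 : A \subset 'N(N).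
Proof.
apply/subsetP=> _ /(p1_onto TP)[x Xx <-]; rewrite inE.
apply/subsetP=> _ /imsetP[_ /(p1_ontoN TP)[w Xw [<- w1]] ->].
by rewrite -(p1J TP) // (p1N TP) ?groupJ // (p2J TP) // w1 conj1g.
Qed.

Lemma two_projections_norm2 : K \subset 'N(Z).
Proof.
apply/subsetP=> _ /(p2_onto TP)[x Xx <-]; rewrite inE.
apply/subsetP=> _ /imsetP[_ /(p2_ontoZ TP)[w Xw [<- w1]] ->].
by rewrite -(p2J TP) // (p2Z TP) ?groupJ // (p1J TP) // w1 conj1g.
Qed.

Let nNx x : x \in X -> p1 x \in 'N(N).
Proof. by move=> Xx; rewrite (subsetP two_projections_norm1) ?(p1A TP). Qed.

Let nZx x : x \in X -> p2 x \in 'N(Z).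
Proof. by move=> Xx; rewrite (subsetP two_projections_norm2) ?(p2K TP). Qed.

Lemma preimN_preimZ x : x \in X -> (p1 x \in N) = (p2 x \in Z).
Proof.
move=> Xx; apply/idP/idP=> [/(p1_ontoN TP) | /(p2_ontoZ TP)] [y Xy [yx y1]].
  have : p2 (y^-1 * x)%g \in Z.
    by rewrite (p2Z TP) ?groupM ?groupV // (p1M TP) ?groupV // (p1V TP) // yx mulVg.
  by rewrite (p2M TP) ?groupV // (p2V TP) // y1 invg1 mul1g.
have : p1 (y^-1 * x)%g \in N.
  by rewrite (p1N TP) ?groupM ?groupV // (p2M TP) ?groupV // (p2V TP) // yx mulVg.
by rewrite (p1M TP) ?groupV // (p1V TP) // y1 invg1 mul1g.
Qed.

Lemma coset_eq12 x y : x \in X -> y \in X ->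
  (coset N (p1 x) == coset N (p1 y)) = (coset Z (p2 x) == coset Z (p2 y)).
Proof.
move=> Xx Xy; have Xxy : (x^-1 * y)%g \in X by rewrite groupM ?groupV.
have E1 : (coset N (p1 x) == coset N (p1 y)) = (p1 (x^-1 * y)%g \in N).
  rewrite (p1M TP) ?groupV // (p1V TP) // eq_mulVg1.
  rewrite -(morphV (coset_morphism N)) ?nNx // -(morphM (coset_morphism N)) ?groupV ?nNx //.
  by apply/eqP/idP=> [/coset_idr|]; [apply; rewrite groupM ?groupV ?nNx | apply: coset_id].
rewrite E1 preimN_preimZ // (p2M TP) ?groupV // (p2V TP) // [RHS]eq_mulVg1.
rewrite -(morphV (coset_morphism Z)) ?nZx // -(morphM (coset_morphism Z)) ?groupV ?nZx //.
by apply/idP/eqP=> [|/coset_idr]; [apply: coset_id | apply; rewrite groupM ?groupV ?nZx].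
Qed.

Definition quotient_iso (c : coset_of N) : coset_of Z := coset Z (p2 (sec1 X p1 (repr c))).

Lemma quotient_isoE x : x \in X -> quotient_iso (coset N (p1 x)) = coset Z (p2 x).
Proof.
move=> Xx; have Ac : repr (coset N (p1 x)) \in A.
  have := mem_repr_coset (coset N (p1 x)); rewrite val_coset ?nNx // => /rcosetP[n Nn ->].
  by rewrite groupM ?(p1A TP) ?(subsetP sNA).
have [Xs sE] := sec1P TP Ac; apply/eqP; rewrite /quotient_iso -coset_eq12 // sE.
by rewrite coset_reprK.
Qed.

Fact quotient_iso_morphic : {in (A / N)%g &, {morph quotient_iso : c d / (c * d)%g}}.
Proof.
move=> _ _ /morphimP[_ _ /(p1_onto TP)[x Xx <-] ->] /morphimP[_ _ /(p1_onto TP)[y Xy <-] ->].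
rewrite -(morphM (coset_morphism N)) ?nNx // -(p1M TP) // !quotient_isoE ?groupM //.
by rewrite (p2M TP) // (morphM (coset_morphism Z)) ?nZx.
Qed.
Canonical quotient_iso_morphism := Morphism quotient_iso_morphic.
Local Notation eps := quotient_iso_morphism.

Lemma mem_quotient_iso (D : {group gT}) x : D \subset A -> x \in X ->
  (coset Z (p2 x) \in eps @* (D / N))%g = (p1 x \in (D * N)%g).
Proof.
move=> sDA Xx; apply/idP/idP=> [/morphimP[_ _ /morphimP[g _ Dg ->]] | /mulsgP[g n Dg Nn xE]].
  have [y Xy yg] := p1_onto TP (subsetP sDA g Dg).
  rewrite -yg /= quotient_isoE // => /eqP; rewrite -coset_eq12 // => /eqP E.
  have : p1 x \in coset N (p1 y) by rewrite -E val_coset ?nNx // rcoset_refl.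
  rewrite val_coset ?nNx // yg => /rcosetP[n Nn ->].
  rewrite normC; last by rewrite (subset_trans sDA) ?two_projections_norm1.
  by rewrite mem_mulg.
have Ag := subsetP sDA g Dg.
have -> : coset Z (p2 x) = eps (coset N g).
  have [y Xy yg] := p1_onto TP Ag; rewrite -yg /= quotient_isoE //; apply/eqP.
  rewrite -coset_eq12 // xE yg (morphM (coset_morphism N)) ?(coset_id Nn) /=.
  - by rewrite (coset_id Nn) mulg1.
  - by rewrite (subsetP two_projections_norm1).
  by rewrite (subsetP (normG N)).
by rewrite mem_morphim ?mem_quotient.
Qed.

(** This says that X maps onto the fibre product of A and K over their common quotient: a lift of g
    is corrected by an element over Z. *)
Lemma quotient_iso_lift g k : g \in A -> k \in K -> coset Z k = eps (coset N g) ->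
  exists x, [/\ x \in X, p1 x = g & p2 x = k].
Proof.
move=> Ag Kk; have [y Xy yg] := p1_onto TP Ag; have [w Xw wk] := p2_onto TP Kk.
rewrite -yg -wk /= quotient_isoE // => E.
have Xyw : (y^-1 * w)%g \in X by rewrite groupM ?groupV.
have : coset Z (p2 (y^-1 * w)%g) = 1%g.
  rewrite (p2M TP) ?groupV // (p2V TP) // (morphM (coset_morphism Z)) ?groupV ?nZx //.
  by rewrite (morphV (coset_morphism Z)) ?nZx //= E mulVg.
move/(coset_idr (nZx Xyw))/(p2_ontoZ TP) => [v Xv [vE v1]].
exists (y * v)%g; split; first exact: groupM.
  by rewrite (p1M TP) // v1 mulg1.
by rewrite (p2M TP) // vE (p2M TP) ?groupV // (p2V TP) // mulKVg.
Qed.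

Lemma quotient_iso_isom : isom (A / N) (K / Z) eps.
Proof.
apply/isomP; split.
  apply/injmP=> c d /morphimP[_ _ /(p1_onto TP)[x Xx <-] ->].
  move=> /morphimP[_ _ /(p1_onto TP)[y Xy <-] ->].
  by rewrite /= !quotient_isoE // => /eqP; rewrite -coset_eq12 // => /eqP.
apply/setP=> c; apply/idP/idP=> [/morphimP[_ _ /morphimP[_ _ /(p1_onto TP)[x Xx <-] ->] ->]|].
  by rewrite /= quotient_isoE // mem_quotient ?(p2K TP).
case/morphimP=> _ _ /(p2_onto TP)[x Xx <-] -> /=.
by rewrite mem_quotient_iso // -[p1 x]mulg1 mem_mulg ?(p1A TP).
Qed.

Lemma matched_bullet (J : {group gT}) : N \subset J -> J \subset A ->
  matched X A K p1 p2 J (bullet eps J).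
Proof.
move=> sNJ sJA.
have memb k : (k \in bullet eps J) = (k \in 'N(Z)) && (coset Z k \in eps @* (J / N))%g.
  by apply/morphpreP/andP.
have nZK : Z <| K by rewrite /normal sZK two_projections_norm2.
split=> //.
  apply/subsetP=> k; rewrite memb => /andP[nk].
  have /subsetP/[apply] : (eps @* (J / N) \subset K / Z)%g.
    by have /isomP[_ <-] := quotient_iso_isom; rewrite morphimS ?quotientS.
  by move=> Kk; rewrite -(quotientGK nZK); apply/morphpreP.
move=> x Xx; rewrite memb nZx // mem_quotient_iso // mulGSid //.
Qed.

End QuotientIsomorphism.

(* Assembling the triple, the bijections and the comparison of order relations *)
Close Scope ring_scope.

Theorem theorem4p3 (p : nat) (S : modular_system p) (Gam : galois_group S)
    (gT : finGroupType) (A N : {group gT}) (theta : bfun S gT) :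
  splits S A -> Htriple Gam A N theta ->
  exists (kT : finGroupType) (K Z : {group kT}) (lam : bfun S kT)
         (eps : {morphism (A / N) >-> coset_of Z})
         (nu : {group gT} -> bfun S gT -> bfun S kT),
    Htriple Gam K Z lam /\
    (forall J : {group gT}, N \subset J -> J \subset stab Gam A N theta ->
       split_above (bullet eps J) Z lam) /\
    (* (1) *)
    (isom (A / N) (K / Z) eps /\
     [/\ Z \subset stab Gam K Z lam, stab Gam K Z lam \subset 'C(Z),
         p^'.-group Z & faithful_linear Z lam]) /\
    (* (2) *)
    [set (a.1, eps (coset N a.2)) | a in gstab Gam A N theta]
      = [set (b.1, coset Z b.2) | b in gstab Gam K Z lam] /\
    (* (3) *)
    (forall J : {group gT}, N \subset J -> J \subset stab Gam A N theta ->
       [/\ forall chi, IBr_over J N theta chi ->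
             IBr_over (bullet eps J) Z lam (nu J chi),
           forall chi1 chi2,
             IBr_over J N theta chi1 -> IBr_over J N theta chi2 ->
             nu J chi1 = nu J chi2 -> chi1 = chi2,
           forall psi, IBr_over (bullet eps J) Z lam psi ->
             exists2 chi, IBr_over J N theta chi & nu J chi = psi,
           (* (a) *)
           forall chi (a : Gam * gT) (b : Gam * kT),
             IBr_over J N theta chi -> a \in gstab Gam A N theta ->
             b.2 \in K -> b.1 = a.1 -> coset Z b.2 = eps (coset N a.2) ->
             bact b (nu J chi) = nu (J :^ a.2)%G (bact a chi)
         & (* (b) *)
           forall chi (V : {group gT}),
             IBr_over J N theta chi -> vertex J chi V ->
             exists2 V1 : {group kT}, vertex (bullet eps J) (nu J chi) V1 &
               eps @* (V * N / N) = V1 * Z / Z]) /\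
    (* (4) *)
    (forall (Q J G : {group gT}) (chi phi : bfun S gT) (st : star),
       N \subset Q -> Q \subset J -> J \subset G -> G \subset A ->
       p.-group (Q / N) -> J \subset stab Gam A N theta ->
       let H := 'N_G(Q)%G in
       let M := 'N_J(Q)%G in
       IBr_over J N theta chi -> IBr_over M N theta phi ->
       Htriple Gam (bullet eps G) (bullet eps J) (nu J chi) ->
       Htriple Gam (bullet eps H) (bullet eps M) (nu M phi) ->
       triple_geq Gam st (bullet eps G) (bullet eps J) (nu J chi)
                         (bullet eps H) (bullet eps M) (nu M phi) ->
       triple_geq Gam st G J chi H M phi).

Proof.
move=> splA triA.
have [xT [kT [X [K [Z [p1 [p2 [m [V [R [lz [lam TR]]]]]]]]]]]] := exists_triple_transfer splA triA.
have TP := tr_TP TR; pose eps : {morphism (A / N) >-> coset_of Z} := quotient_iso_morphism TP.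
have sNA : N \subset A by case: triA.
have sAtA : stab Gam A N theta \subset A by apply/subsetP=> g; rewrite inE => /andP[].
have mB (J : {group gT}) : N \subset J -> J \subset A -> matched X A K p1 p2 J (bullet eps J).
  by move=> sNJ sJA; apply: matched_bullet.
(* The choice is forced for characters over theta by [corr_fun]; the default 0 only makes nu
   total. *)
pose nu (J : {group gT}) chi := epsilon (inhabits 0%R) (corr X Z p1 p2 R lz J (bullet eps J) chi).
have nuP (J : {group gT}) chi : N \subset J -> J \subset stab Gam A N theta ->
    IBr_over J N theta chi -> corr X Z p1 p2 R lz J (bullet eps J) chi (nu J chi).
  move=> sNJ sJ ov; apply: epsilon_spec.
  exact: (corr_total TR (mB J sNJ (subset_trans sJ sAtA)) sJ ov).
have sZK : Z \subset K.
  by have /subset_trans := ZKl TR; apply; apply/subsetP=> k; rewrite inE => /andP[].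
exists kT, K, Z, lam, eps, nu; split.
  split=> //.
    exists 1%N, (lz_repr TR); split; last exact: (tr_lam TR).
    exact/mx_abs_irrW/linear_mx_abs_irr.
  apply/eqP/orb_stabP=> k Kk; have [x Xx xk] := p2_onto TP Kk.
  have [_ _ /eqP/orb_stabP/(_ _ (p1A TP Xx))[NE [s thE]]] := triA.
  have ax : (s, p1 x) \in gstab Gam A N theta by apply/gstabP; rewrite (p1A TP).
  rewrite (tr_gstab TR) // xk in ax.
  by have [_ ZE lE] := gstabP _ _ _ _ _ ax; split=> //; exists s.
split.
  move=> J sNJ sJ; exact: (split_above_J' TR (mB J sNJ (subset_trans sJ sAtA)) sJ).
split.
  split; first exact: quotient_iso_isom.
  split; [exact: (ZKl TR) | exact: (tr_cent TR) | exact: (p'Z TR) | ].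
  exists (lz_repr TR); split; first exact: (tr_lam TR).
  apply/subsetP=> z; rewrite !inE => /andP[Zz]; rewrite mul1mx => /eqP/matrixP/(_ 0%R 0%R).
  by rewrite !mxE !mulr1n => /(tr_faithful TR Zz) ->.
split.
  apply/setP=> -[s c]; apply/imsetP/imsetP=> -[[t g] /= ag [-> ->]].
    have [Ag _ _] := gstabP _ _ _ _ _ ag; have [x Xx xg] := p1_onto TP Ag.
    exists (t, p2 x); first by rewrite -(tr_gstab TR) // xg.
    by rewrite -xg /= (quotient_isoE TP).
  have [Kk _ _] := gstabP _ _ _ _ _ ag; have [x Xx xg] := p2_onto TP Kk.
  exists (t, p1 x); first by rewrite (tr_gstab TR) // xg.
  by rewrite -xg /= (quotient_isoE TP).
split.
  move=> J sNJ sJ; have sJA := subset_trans sJ sAtA; have mJ := mB J sNJ sJA; split.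
  - by move=> chi ov; apply: (corr_over TR mJ (nuP _ _ sNJ sJ ov)).
  - move=> chi1 chi2 ov1 ov2 E; have c1 := nuP _ _ sNJ sJ ov1; rewrite E in c1.
    exact: (corr_inj TR mJ sJ c1 (nuP _ _ sNJ sJ ov2)).
  - move=> psi ov; have [chi c] := corr_surj TR mJ sJ ov.
    have ovc := corr_over_theta TR mJ sJ c; exists chi => //.
    exact: (corr_fun TR mJ sJ (nuP _ _ sNJ sJ ovc) c).
  - move=> chi [s g] [t k] /= ov ag Kk ts kg; rewrite {t}ts.
    have [Ag _ _] := gstabP _ _ _ _ _ ag.
    have [x [Xx xg xk]] := quotient_iso_lift (TP := TP) Ag Kk kg.
    have mJx := matchedJ TR mJ Xx; have [sJxA _ _] := mJx.
    have [sNJx _] := matched_sub TP mJx.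
    have ax : (s, p1 x) \in gstab Gam A N theta by rewrite xg.
    have sJx := AtJ Xx ax sJ.
    have c := corr_pact TR mJ sJ (nuP _ _ sNJ sJ ov) Xx ax.
    (* Both groups are matched with the conjugate of J by p1 x, and a matching partner is unique. *)
    have bE : (bullet eps J :^ p2 x)%G = bullet eps (J :^ p1 x)%G.
      exact/group_inj/(matched_eq2 TR (mB _ sNJx sJxA) mJx (erefl _)).
    have ovx := corr_over_theta TR mJx sJx c.
    rewrite bE in c mJx; rewrite -xk -xg.
    exact: (corr_fun TR mJx sJx c (nuP _ _ sNJx sJx ovx)).
  move=> chi W ov vW; have [V1 vV1 VE] := corr_vertex TR mJ sJ (nuP _ _ sNJ sJ ov) vW.
  exists V1 => //; rewrite !quotientMidr.
  have sWA : W \subset A.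
    by case: vW => n [r [_ _ [sWJ _ _]]]; apply: subset_trans sJA.
  have sVK : V1 \subset K.
    case: vV1 => n [r [_ _ [sVJ _ _]]]; apply: subset_trans sVJ _.
    by case: mJ.
  apply/setP=> c; apply/idP/idP=> [cW | /morphimP[k nk Vk ->]].
    have : c \in K / Z.
      have /isomP[_ <-] := quotient_iso_isom TP.
      by apply: subsetP cW; rewrite morphimS ?quotientS.
    case/morphimP=> _ _ /(p2_onto TP)[x Xx <-] cE; rewrite cE in cW *.
    rewrite -quotientMidr; apply: (mem_morphim (coset_morphism Z)).
      by rewrite (subsetP (two_projections_norm2 TP)) ?(p2K TP).
    rewrite -VE //.
    by rewrite -(mem_quotient_iso TP).
  have [x Xx xk] := p2_onto TP (subsetP sVK k Vk); rewrite -xk.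
  rewrite (mem_quotient_iso TP) // VE // xk -[k]mulg1 mem_mulg //.
move=> Q J G chi phi st sNQ sQJ sJG sGA pQ sJ H M ovc ovp _ _ geq.
have sNJ := subset_trans sNQ sQJ; have sNG := subset_trans sNJ sJG.
have sNnQ : N \subset 'N(Q) by apply: subset_trans sNQ (normG Q).
have sMJ : M \subset J by apply: subsetIl.
have sNM : N \subset M by rewrite subsetI sNJ.
have sNH : N \subset H by rewrite subsetI sNG.
have sHA : H \subset A by apply: subset_trans sGA; apply: subsetIl.
have sM := subset_trans sMJ sJ.
apply: (triple_geq_lift TR _ _ _ _ sJ sM _ _ geq).
- exact: mB.
- by apply: mB => //; apply: subset_trans sGA.
- exact: mB.
- by apply: mB => //; apply: subset_trans sAtA.
- exact: nuP.
exact: nuP.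
Qed.
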